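(* For a prime $p$ let $V_p$ be the number of pairs $(x,y)\in\mathbb{F}_p^2$ satisfying both $x^4+6x^2-3=0$ and $y^2=x^3-x$. Then there are infinitely many primes $p\equiv 1\pmod{12}$ with $V_p>0$. However, there is no sub-congruence class of $p\equiv 1 \pmod{12}$ on which $V_p>0$ for all primes $p$ in it: for every positive integer $m$ divisible by $12$ and every integer $c$ with $c\equiv 1\pmod{12}$ and $\gcd(c,m)=1$, there exists a prime $p\equiv c\pmod m$ with $V_p=0$. *)

(* Defs.v *)
From mathcomp Require Import all_boot all_order all_algebra.
Set Implicit Arguments. Unset Strict Implicit. Unset Printing Implicit Defensive.
Import GRing.Theory Num.Theory.
Local Open Scope ring_scope.

(* V_p : number of (x,y) in F_p^2 with x^4+6x^2-3 = 0 and y^2 = x^3 - x.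
   Only meaningful (and only used) for p prime, where 'F_p is the field Z/pZ. *)
Definition Vp (p : nat) : nat :=
  #|[set xy : 'F_p * 'F_p |
      (xy.1 ^+ 4 + 6%:R * xy.1 ^+ 2 - 3%:R == 0) &&
      (xy.2 ^+ 2 == xy.1 ^+ 3 - xy.1)]|.

(* Main.v *)
(* If V_p > 0 then 12 is a fourth power mod p. For p = 1 mod 4 the quartic Jacobi sum J satisfies
   J conj(J) = p, J = 1 mod 2 and J^2 = chi(12) mod 3, so that 12 being a fourth power forces
   psi(J) = 1 for the Hecke character psi of Q(i) of conductor dividing 6 with
   psi(a) = a^2 mod 3 on a = 1 mod 2. If V_p > 0 for all primes p = c mod m, then
   psi(P) + psi(conj P) = 2 for all of them, and the sum of (2 - tv p) ln p / p over these primes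
   is bounded. By orthogonality it is a combination of sums twisted by the characters mod m, and
   equals 2 ln x / phi(m) + O(1), provided that the series L(1, chi) and L(1, chi psi) do not
   vanish. As in Mertens' proof of Dirichlet's theorem, vanishing adds - ln x to the sum of
   chi(n) Lambda(n) / n; positivity then excludes it, since L(1, chi psi) = 0 would entail the
   vanishing of the series for two further characters.

   For the first part, w^8 + 6 w^4 - 3 = 0 and i^2 = -1 give the point (w^2, i w (w^4 + 1) / 2) and
   force p = 1 mod 12. The norm P(n)^2 + Q(n)^2 of (n - i)^8 + 6 (n - i)^4 - 3 has, as in Euclid's
   argument, prime factors p larger than any bound, and then i = - P / Q and w = n - i are such
   roots mod p. *)
From HB Require Import structures.
Require Import Defs.
From Stdlib Require PeanoNat.
From mathcomp Require Import all_boot all_order all_algebra.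
From mathcomp Require Import all_fingroup all_solvable all_field all_character.
From mathcomp Require Import boolp classical_sets reals exp complex Rstruct.
From mathcomp Require Import ring lra zify.
Set Implicit Arguments. Unset Strict Implicit. Unset Printing Implicit Defensive.
Import Order.TTheory GRing.Theory Num.Theory.
Local Open Scope ring_scope.
Local Notation Re := (@complex.Re _).
Local Notation Im := (@complex.Im _).

(** * Dirichlet convolution *)

(** Behind the congruences stands the field Q(i, 12^(1/4)), dihedral of degree 8 over Q. Its largest
    abelian subfield is Q(i, sqrt 3), the field of twelfth roots of unity, which is why no
    congruence finer than 1 mod 12 can force 12 to be a fourth power. The two-dimensional
    representation of its Galois group is induced from psi. Chebotarev's theorem is replaced by
    elementary estimates at s = 1: all sums run over n <= x, and nothing is continued analytically.
    This works because the coefficients twisted by chi have partial sums O(sqrt x), as psi times chi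
    of the norm sums to 0 over a period of the lattice Z[i]. The representation is unchanged by the
    quadratic characters mod 4 and mod 3. Together with complex conjugation, a zero for chi thus
    gives zeros for chi chi4 and for conj(chi) chi3. The latter is never chi itself, so that real
    chi need no separate treatment here; for Dirichlet's own series, which lack this symmetry, the
    real characters do. *)

Definition divs n := [seq d <- index_iota 1 n.+1 | d %| n]%N.

Lemma dvdn_divs d n : (0 < n)%N -> (d %| n)%N = (d \in divs n).
Proof.
move=> n0; rewrite mem_filter mem_index_iota ltnS.
by case dn: (d %| n)%N => //=; rewrite (dvdn_gt0 n0 dn) dvdn_leq.
Qed.

Lemma divs_uniq n : uniq (divs n).
Proof. by rewrite filter_uniq ?iota_uniq. Qed.

(** Meant for the divisors of p n, which are divisible by p or divide n, and for the Gaussian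
    integers of norm p n, which are divisible by pi or by its conjugate. *)
Lemma big_incl_excl (V : zmodType) (I : eqType) (F : I -> V) (P Q : pred I) (s : seq I) :
  {in s, forall d, P d || Q d} ->
  \sum_(d <- s) F d = \sum_(d <- s | P d) F d + \sum_(d <- s | Q d) F d
     - \sum_(d <- s | P d && Q d) F d.
Proof.
move=> PQ; rewrite (bigID P) /= -addrA; congr (_ + _).
rewrite [X in _ = X - _](bigID P) /= addrC -addrA [X in _ + X](_ : _ = 0) ?addr0.
  rewrite big_seq_cond [RHS]big_seq_cond; apply: eq_bigl => d.
  case ds: (d \in s) => //=; have := PQ _ ds; by case: (P d) (Q d) => [] [].
rewrite (eq_bigl (fun d => P d && Q d)); first by rewrite subrr.
by move=> d; rewrite andbC.
Qed.

Section Convolution.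
Variable K : comNzRingType.
Implicit Types f g h u w A B : nat -> K.

Definition conv f g n : K := \sum_(d <- divs n) f d * g (n %/ d)%N.

Definition cmul A := A 1%N = 1 /\
  forall m n, (0 < m)%N -> (0 < n)%N -> A (m * n)%N = A m * A n.

Definition delta n : K := (n == 1%N)%:R.

Lemma conv0 f g : conv f g 0 = 0.
Proof. by rewrite /conv big_nil. Qed.

Lemma conv1 f g : conv f g 1 = f 1%N * g 1%N.
Proof. by rewrite /conv big_seq1. Qed.

Lemma eq_conv f g f' g' n :
  (forall k, (0 < k)%N -> f k = f' k) -> (forall k, (0 < k)%N -> g k = g' k) ->
  conv f g n = conv f' g' n.
Proof.
move=> ff' gg'; rewrite /conv; case: n => [|n]; first by rewrite !big_nil.
rewrite [LHS]big_seq [RHS]big_seq; apply: eq_bigr => d; rewrite -dvdn_divs// => dn.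
by rewrite ff' ?gg' ?divn_gt0 ?(dvdn_gt0 _ dn)// dvdn_leq.
Qed.

Lemma sum_eq_nat (N k : nat) (F : nat -> K) :
  \sum_(1 <= n < N | n == k) F n = if (0 < k < N)%N then F k else 0.
Proof.
case: ifP => [kN|/negP kN].
  rewrite big_mkcond (bigD1_seq k) ?mem_index_iota ?iota_uniq//= eqxx.
  by rewrite big1 ?addr0// => i /negPf ->.
rewrite big_nat_cond big1// => i /andP[iN /eqP ik].
by case: kN; rewrite -ik.
Qed.

(** A box that does not depend on n lets the sums over n, d and e be exchanged freely. *)
Lemma conv_box f g n N : (0 < n < N)%N ->
  conv f g n = \sum_(1 <= d < N) \sum_(1 <= e < N | (d * e == n)%N) f d * g e.
Proof.
case/andP=> n0 nN.
transitivity (\sum_(1 <= d < N | (d %| n)%N) f d * g (n %/ d)%N).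
  rewrite /conv -[RHS]big_filter; apply: perm_big.
  apply: uniq_perm; rewrite ?divs_uniq ?filter_uniq ?iota_uniq// => d.
  rewrite -dvdn_divs// mem_filter mem_index_iota.
  case dn: (d %| n)%N => //=; apply/esym/andP; split; first exact: dvdn_gt0 dn.
  exact: leq_ltn_trans (dvdn_leq n0 dn) nN.
rewrite big_mkcond /=; apply: eq_big_nat => d /andP[d0 dN].
case: ifP => [dn|/negP dn].
  rewrite (eq_bigl (fun e => e == n %/ d)%N).
    rewrite sum_eq_nat divn_gt0// dvdn_leq//=.
    by rewrite (leq_ltn_trans (leq_div _ _) nN).
  by move=> e; rewrite eqn_div// mulnC.
rewrite big1// => e /eqP den; case: dn; rewrite -den; exact: dvdn_mulr.
Qed.

Lemma convC f g n : conv f g n = conv g f n.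
Proof.
case: n => [|n]; first by rewrite !conv0.
rewrite !(@conv_box _ _ _ n.+2) ?ltnSn//.
under eq_bigr do rewrite big_mkcond.
under [RHS]eq_bigr do rewrite big_mkcond.
rewrite exchange_big; apply: eq_bigr => d _; apply: eq_bigr => e _.
by rewrite mulnC mulrC.
Qed.

Lemma sum_conv (w f g : nat -> K) x :
  \sum_(1 <= n < x.+1) w n * conv f g n =
  \sum_(1 <= d < x.+1) \sum_(1 <= e < (x %/ d).+1) w (d * e)%N * (f d * g e).
Proof.
transitivity (\sum_(1 <= n < x.+1) \sum_(1 <= d < x.+1) \sum_(1 <= e < x.+1)
   if (d * e == n)%N then w n * (f d * g e) else 0).
  apply: eq_big_nat => n nx; rewrite (@conv_box _ _ _ x.+1)// mulr_sumr.
  apply: eq_bigr => d _; rewrite mulr_sumr big_mkcond.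
  by apply: eq_bigr => e _; case: ifP.
rewrite exchange_big; apply: eq_big_nat => d /andP[d0 dx].
rewrite exchange_big /=.
transitivity (\sum_(1 <= e < x.+1 | (e <= x %/ d)%N) w (d * e)%N * (f d * g e)).
  rewrite [RHS]big_mkcond; apply: eq_big_nat => e /andP[e0 ex].
  rewrite -big_mkcond /= (eq_bigl (fun n => n == d * e)%N); last first.
    by move=> i; rewrite eq_sym.
  by rewrite sum_eq_nat muln_gt0 d0 e0 ltnS /= leq_divRL// mulnC.
rewrite [RHS](big_nat_widen _ _ x.+1) ?ltnS ?leq_div//.
Qed.

Lemma convA f g h n : conv f (conv g h) n = conv (conv f g) h n.
Proof.
case: n => [|n]; first by rewrite !conv0.
set N := n.+2.
have E u v k : (0 < k < N)%N -> conv u v k =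
   \sum_(1 <= d < N) \sum_(1 <= e < N) if (d * e == k)%N then u d * v e else 0.
  move=> kN; rewrite (conv_box _ _ kN).
  by apply: eq_bigr => d _; rewrite big_mkcond.
have nN : (0 < n.+1 < N)%N by rewrite ltnSn.
pose G d e c := if (d * e * c == n.+1)%N then f d * g e * h c else 0.
transitivity (\sum_(1 <= d < N) \sum_(1 <= e < N) \sum_(1 <= c < N) G d e c).
  rewrite E//; apply: eq_big_nat => d dN.
  transitivity (\sum_(1 <= k < N) \sum_(1 <= e < N) \sum_(1 <= c < N)
     if (k == e * c)%N then (if (d * k == n.+1)%N then f d * (g e * h c) else 0) else 0).
    apply: eq_big_nat => k kN; rewrite (E _ _ _ kN).
    case: eqP => dk; last first.
      by rewrite big1// => e _; rewrite big1// => c _; case: ifP.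
    rewrite mulr_sumr; apply: eq_bigr => e _; rewrite mulr_sumr.
    by apply: eq_bigr => c _; rewrite eq_sym; case: ifP; rewrite ?mulr0.
  rewrite exchange_big; apply: eq_big_nat => e eN.
  rewrite exchange_big; apply: eq_big_nat => c cN.
  rewrite -big_mkcond sum_eq_nat /G mulnA.
  case: (d * e * c =P n.+1)%N => [dec|]; last by rewrite if_same.
  rewrite ifT ?mulrA//; nia.
rewrite E//.
transitivity (\sum_(1 <= c < N) \sum_(1 <= d < N) \sum_(1 <= e < N) G d e c).
  rewrite [RHS]exchange_big; apply: eq_bigr => d _.
  by rewrite exchange_big.
rewrite [RHS]exchange_big; apply: eq_big_nat => c cN.
transitivity (\sum_(1 <= k < N) \sum_(1 <= d < N) \sum_(1 <= e < N)
     if (k == d * e)%N then (if (k * c == n.+1)%N then f d * g e * h c else 0) else 0);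
  last first.
  apply: eq_big_nat => k kN; rewrite (E _ _ _ kN).
  case: eqP => dk; last first.
    by rewrite big1// => e _; rewrite big1// => d _; case: ifP.
  rewrite mulr_suml; apply: eq_bigr => d _; rewrite mulr_suml.
  by apply: eq_bigr => e _; rewrite eq_sym; case: ifP; rewrite ?mul0r.
rewrite [RHS]exchange_big; apply: eq_big_nat => d dN.
rewrite [RHS]exchange_big; apply: eq_big_nat => e eN.
rewrite -big_mkcond sum_eq_nat /G.
case: (d * e * c =P n.+1)%N => [dec|]; last by rewrite if_same.
rewrite ifT//; nia.
Qed.

Lemma conv_delta f n : (0 < n)%N -> conv f delta n = f n.
Proof.
move=> n0; rewrite convC /conv (bigD1_seq 1%N) ?divs_uniq -?dvdn_divs//=.
rewrite divn1 mul1r big1 ?addr0// => d /negPf d1.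
by rewrite /delta d1 mul0r.
Qed.

Lemma conv_addr f g h n : conv f (fun k => g k + h k) n = conv f g n + conv f h n.
Proof. by rewrite /conv -big_split; apply: eq_bigr => d _; rewrite mulrDr. Qed.

Lemma conv_cmul A f g n : cmul A ->
  conv (fun k => A k * f k) (fun k => A k * g k) n = A n * conv f g n.
Proof.
case=> _ AM; case: n => [|n]; first by rewrite !conv0 mulr0.
rewrite /conv mulr_sumr [LHS]big_seq [RHS]big_seq.
apply: eq_bigr => d; rewrite -dvdn_divs// => dn.
rewrite -{3}(divnK dn) AM ?divn_gt0 ?(dvdn_gt0 _ dn)// 1?dvdn_leq//.
ring.
Qed.

(** Weighting by a completely additive l is a derivation; for the logarithm it is - d/ds on
    Dirichlet series. *)
Lemma conv_deriv (l : nat -> K) f g n :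
  (forall d e, (0 < d)%N -> (0 < e)%N -> l (d * e)%N = l d + l e) ->
  conv (fun k => l k * f k) g n + conv f (fun k => l k * g k) n = l n * conv f g n.
Proof.
move=> lM; case: n => [|n]; first by rewrite !conv0 mulr0 addr0.
rewrite /conv mulr_sumr -big_split [LHS]big_seq [RHS]big_seq.
apply: eq_bigr => d; rewrite -dvdn_divs// => dn /=.
rewrite -{4}(divnK dn) lM ?divn_gt0 ?(dvdn_gt0 _ dn)// 1?dvdn_leq//.
ring.
Qed.

Lemma perm_dvd_divs p n : prime p -> (0 < n)%N ->
  perm_eq [seq d <- divs (p * n) | p %| d]%N [seq (p * d)%N | d <- divs n].
Proof.
move=> pp n0; have p0 := prime_gt0 pp.
apply: uniq_perm; rewrite ?filter_uniq ?divs_uniq ?iota_uniq// ?map_inj_uniq ?divs_uniq//.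
  by move=> a b /eqP; rewrite eqn_pmul2l// => /eqP.
move=> d; rewrite mem_filter -dvdn_divs ?muln_gt0 ?p0//.
apply/andP/mapP => [[/dvdnP[e ->] de]|[e en ->]].
  exists e; last by rewrite mulnC.
  by rewrite -dvdn_divs//; rewrite mulnC dvdn_pmul2l in de.
by rewrite dvdn_mulr// dvdn_pmul2l// dvdn_divs.
Qed.

(* The recursion at p satisfied by the coefficients of an Euler product with local factors
   1 / (1 - t p X + q p X^2). *)
Definition three_term (t q : nat -> K) f := forall p n, prime p -> (0 < n)%N ->
  f (p * n)%N = t p * f n - (if (p %| n)%N then q p * f (n %/ p)%N else 0).

(** The least prime factor is split off at each step. This identifies sequences known only through
    recursions at the primes, so that the count of Gaussian integers becomes an Euler product with
    no appeal to unique factorization in Z[i]. *)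
Lemma three_term_uniq t q f g : three_term t q f -> three_term t q g ->
  f 1%N = g 1%N -> forall n, (0 < n)%N -> f n = g n.
Proof.
move=> Hf Hg fg1 n; have [k] := ubnP n; elim: k n => // k IH n nk n0.
have [n1|n1] := leqP n 1; first by rewrite (_ : n = 1%N) //; lia.
have pp := pdiv_prime n1; set p := pdiv n in pp.
have /dvdnP[m nE] := pdiv_dvd n; rewrite -/p in nE.
have p1 := prime_gt1 pp.
have m0 : (0 < m)%N by lia.
rewrite nE mulnC Hf// Hg// IH//; last by nia.
case: ifP => // pm; rewrite IH//; last by rewrite divn_gt0 ?prime_gt0// dvdn_leq.
by have := leq_div m p; nia.
Qed.

(** Among the divisors of p n, those divisible by p yield [A p * conv A B n], those dividing n yield
    [B p * conv A B n], and the overlap, empty unless p divides n, yields [A p * B p] times the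
    value at n / p. *)
Lemma conv_three_term A B : cmul A -> cmul B ->
  three_term (fun p => A p + B p) (fun p => A p * B p) (conv A B).
Proof.
move=> [A1 AM] [B1 BM] p n pp n0; have p0 := prime_gt0 pp.
have pn0 : (0 < p * n)%N by rewrite muln_gt0 p0.
pose F d := A d * B (p * n %/ d)%N.
rewrite {1}/conv (big_incl_excl F (P := fun d => (p %| d)%N) (Q := fun d => (d %| n)%N)); last first.
  move=> d; rewrite -dvdn_divs// => dpn.
  have [//|pd] := boolP (p %| d)%N; rewrite /=.
  by rewrite -(@Gauss_dvdr d p)// coprime_sym prime_coprime.
have -> : \sum_(d <- divs (p * n) | (p %| d)%N) F d = A p * conv A B n.
  rewrite -big_filter (perm_big _ (perm_dvd_divs pp n0)) big_map /conv mulr_sumr.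
  rewrite [LHS]big_seq [RHS]big_seq; apply: eq_bigr => d.
  rewrite -dvdn_divs// => dn; rewrite /F divnMl// AM ?mulrA//.
  exact: dvdn_gt0 dn.
have -> : \sum_(d <- divs (p * n) | (d %| n)%N) F d = B p * conv A B n.
  rewrite -big_filter (perm_big (divs n)).
    rewrite /conv mulr_sumr [LHS]big_seq [RHS]big_seq; apply: eq_bigr => d.
    rewrite -dvdn_divs// => dn; rewrite /F -muln_divA// BM//.
      by rewrite mulrCA.
    by rewrite divn_gt0 ?(dvdn_gt0 _ dn)// dvdn_leq.
  apply: uniq_perm; rewrite ?filter_uniq ?divs_uniq ?iota_uniq// => d.
  rewrite mem_filter -!dvdn_divs//; case dn: (d %| n)%N => //=.
  by rewrite dvdn_mull.
rewrite -mulrDl; congr (_ - _); case: ifP => [pn|pn].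
  have np0 : (0 < n %/ p)%N by rewrite divn_gt0 // dvdn_leq.
  have pdiv_n : (p * (n %/ p) = n)%N by rewrite mulnC divnK.
  rewrite -big_filter (perm_big [seq (p * d)%N | d <- divs (n %/ p)]); last first.
    rewrite -{2}pdiv_n; apply: (perm_trans _ (perm_dvd_divs pp np0)).
    apply: uniq_perm; rewrite ?filter_uniq ?divs_uniq ?iota_uniq// => d.
    rewrite [LHS]mem_filter [RHS]mem_filter -!dvdn_divs ?pdiv_n//.
    case: (p %| d)%N => //=; case dn: (d %| n)%N => //=.
    by rewrite dvdn_mull.
  rewrite big_map /conv mulr_sumr [LHS]big_seq [RHS]big_seq; apply: eq_bigr => d.
  rewrite -dvdn_divs// => dn; rewrite /F divnMl//.
  rewrite -{1}pdiv_n -muln_divA// AM ?(dvdn_gt0 _ dn)// BM//; first by ring.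
  by rewrite divn_gt0 ?(dvdn_gt0 _ dn)// dvdn_leq.
rewrite big_seq_cond big1// => d /and3P[_ pd dn].
by rewrite (dvdn_trans pd dn) in pn.
Qed.

Definition cmulext (a : nat -> K) n : K := \prod_(p <- primes n) a p ^+ logn p n.

Lemma cmulext_box a n N : (0 < n < N)%N ->
  cmulext a n = \prod_(1 <= p < N | prime p) a p ^+ logn p n.
Proof.
case/andP=> n0 nN.
rewrite (bigID (fun p => p \in primes n)) /= [X in _ * X]big1 ?mulr1; last first.
  move=> p /andP[pp]; rewrite -logn_gt0 lt0n negbK => /eqP ->; exact: expr0.
rewrite -[RHS]big_filter /cmulext; apply: perm_big.
apply: uniq_perm; rewrite ?primes_uniq ?filter_uniq ?iota_uniq// => p.
rewrite mem_filter mem_index_iota mem_primes n0 /=.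
case pp: (prime p) => //=; case pn: (p %| n)%N => //=.
by rewrite prime_gt0//= (leq_ltn_trans (dvdn_leq _ pn)).
Qed.

Lemma cmulext_cmul a : cmul (cmulext a).
Proof.
split=> [|m n m0 n0]; first by rewrite /cmulext big_nil.
have mn0 : (0 < m * n)%N by rewrite muln_gt0 m0.
rewrite !(@cmulext_box a _ (m * n).+1); try by apply/andP; split; nia.
by rewrite -big_split; apply: eq_bigr => p pp /=; rewrite lognM// exprD.
Qed.

Lemma cmulext_prime a p : prime p -> cmulext a p = a p.
Proof. by move=> pp; rewrite /cmulext primes_prime// big_seq1 logn_prime// eqxx. Qed.

Lemma cmulX A n k : cmul A -> (0 < n)%N -> A (n ^ k)%N = A n ^+ k.
Proof.
move=> [A1 AM] n0; elim: k => [|k IH]; first by rewrite expn0.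
by rewrite expnS AM ?expn_gt0 ?n0// IH exprS.
Qed.

Definition liouville := cmulext (fun=> -1).

(** The sequence u carried by the squares: its Dirichlet series is that of u at 2 s. *)
Definition sqext u n : K := \sum_(1 <= k < n.+1 | (k ^ 2 == n)%N) u k.

Lemma sqext_sq u k : (0 < k)%N -> sqext u (k ^ 2) = u k.
Proof.
move=> k0; rewrite /sqext (eq_bigl (fun i => i == k)).
  by rewrite sum_eq_nat k0 ltnS /=; case: ifP => //; nia.
by move=> i; rewrite eqn_exp2r.
Qed.

Lemma sqext_nsq u n : (forall k, (k ^ 2 != n)%N) -> sqext u n = 0.
Proof. by move=> H; rewrite /sqext big1// => k /eqP kn; have := H k; rewrite kn eqxx. Qed.

Lemma square_spec n :
  (exists2 k, (0 < k)%N & n = (k ^ 2)%N) \/ n = 0%N \/ (forall k, (k ^ 2 != n)%N).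
Proof.
have [|H] := boolP [exists k : 'I_n.+1, (k ^ 2 == n)%N].
  case/existsP=> k /eqP kn; have [k0|k0] := posnP k.
    by right; left; rewrite -kn k0.
  by left; exists k.
right; right => k; apply: contra H => /eqP kn; apply/existsP.
have kn' : (k < n.+1)%N by rewrite -kn; nia.
by exists (Ordinal kn'); rewrite /= kn.
Qed.

Lemma conv_sqext u w n : (0 < n)%N -> conv (sqext u) (sqext w) n = sqext (conv u w) n.
Proof.
move=> n0; have [[k k0 ->]|[n00|nsq]] := square_spec n; [|by rewrite n00 in n0|].
  rewrite sqext_sq// /conv.
  rewrite (bigID (fun d => d \in [seq (a ^ 2)%N | a <- divs k])) /=.
  rewrite [X in _ + X](_ : _ = 0) ?addr0; last first.
    rewrite big_seq_cond big1// => d /andP[]; rewrite -dvdn_divs ?expn_gt0 ?k0//.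
    move=> dk dN; rewrite [sqext u d]sqext_nsq ?mul0r// => a; apply: contra dN => /eqP ad.
    apply/mapP; exists a => //; rewrite -dvdn_divs//.
    by rewrite -ad dvdn_pexp2r in dk.
  rewrite -big_filter (perm_big [seq (a ^ 2)%N | a <- divs k]).
    rewrite big_map [LHS]big_seq [RHS]big_seq; apply: eq_bigr => a.
    rewrite -dvdn_divs// => ak; have a0 := dvdn_gt0 k0 ak.
    have -> : (k ^ 2 %/ a ^ 2 = (k %/ a) ^ 2)%N by rewrite -{1}(divnK ak) expnMn mulnK ?expn_gt0 ?a0.
    by rewrite !sqext_sq// divn_gt0// dvdn_leq.
  apply: uniq_perm; rewrite ?filter_uniq ?divs_uniq ?iota_uniq//.
    rewrite map_inj_in_uniq ?divs_uniq// => a b _ _ /eqP.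
    by rewrite eqn_exp2r// => /eqP.
  move=> d; rewrite mem_filter andbC; case dk: (d \in divs _) => //=.
  apply/esym/negbTE; apply/mapP => -[a]; rewrite -dvdn_divs// => ak da.
  by rewrite da -dvdn_divs ?expn_gt0 ?k0// dvdn_exp2r in dk.
rewrite [RHS]sqext_nsq// /conv big_seq big1// => d; rewrite -dvdn_divs// => dn.
have [[a a0 da]|[d0|dsq]] := square_spec d; last 2 first.
- by rewrite d0 dvd0n in dn; move: n0; rewrite (eqP dn).
- by rewrite sqext_nsq ?mul0r.
have [[b b0 db]|[d0|dsq]] := square_spec (n %/ d); last 2 first.
- by move: n0; rewrite -(divnK dn) d0.
- by rewrite [sqext w _]sqext_nsq ?mulr0.
by have := nsq (b * a)%N; rewrite -(divnK dn) db da expnMn eqxx.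
Qed.

(** Both sides satisfy the recursion with t p = 0 and q p = - 1, which says that f (p n) is f (n /
    p), or 0 if p does not divide n. *)
Lemma liouville_one n : (0 < n)%N -> conv liouville (fun=> 1) n = sqext (fun=> 1) n.
Proof.
move=> n0; have lc : cmul liouville := cmulext_cmul _.
have oc : cmul (fun=> 1 : K) by split=> // *; rewrite mulr1.
apply: (three_term_uniq (conv_three_term lc oc) _ _ n0); last first.
  by rewrite conv1 lc.1 mulr1 -(exp1n 2) sqext_sq.
move=> p {}n pp {}n0; have p0 := prime_gt0 pp.
rewrite /liouville cmulext_prime// addNr mul0r sub0r.
have [[k k0 e]|[e|nsq]] := square_spec (p * n); [|by move: n0; move/eqP: e; rewrite muln_eq0 => /orP[] /eqP e; rewrite e in p0 *|].
  have pk : (p %| k)%N by have := dvdn_mulr n (dvdnn p); rewrite e Euclid_dvdX// andbT.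
  case/dvdnP: pk => l kE.
  have nE : (n = p * l ^ 2)%N.
    by apply/eqP; rewrite -(eqn_pmul2l p0) e kE expnMn; apply/eqP; ring.
  have -> : (p %| n)%N by rewrite nE dvdn_mulr.
  have -> : (n %/ p = l ^ 2)%N by rewrite nE mulKn.
  rewrite e !sqext_sq//; first by rewrite mulr1 mulr1 opprK.
  by case: (l) kE k0 => // ->.
rewrite sqext_nsq//; case: ifP => [/dvdnP[l nE]|_]; last by rewrite oppr0.
rewrite nE mulnK// sqext_nsq ?mulr0 ?oppr0// => k; apply/eqP => kl.
by have := nsq (p * k)%N; rewrite nE expnMn kl; case/eqP; ring.
Qed.

Definition mobius n : K :=
  \prod_(p <- primes n) (if logn p n == 1%N then -1 else 0).

Lemma mobius_box n N : (0 < n < N)%N -> mobius n =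
  \prod_(1 <= p < N | prime p) (if logn p n == 0%N then 1 else if logn p n == 1%N then -1 else 0).
Proof.
case/andP=> n0 nN.
rewrite (bigID (fun p => p \in primes n)) /= [X in _ * X]big1 ?mulr1; last first.
  by move=> p /andP[pp]; rewrite -logn_gt0 lt0n negbK => /eqP ->.
rewrite -[RHS]big_filter /mobius.
rewrite (perm_big [seq p <- index_iota 1 N | prime p & p \in primes n]).
  rewrite !big_filter; apply: eq_bigr => p /andP[_].
  by rewrite -logn_gt0; case: (logn p n).
apply: uniq_perm; rewrite ?primes_uniq ?filter_uniq ?iota_uniq// => p.
rewrite mem_filter mem_index_iota mem_primes n0 /=.
case pp: (prime p) => //=; case pn: (p %| n)%N => //=.
by rewrite prime_gt0//= (leq_ltn_trans (dvdn_leq _ pn)).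
Qed.

Lemma mobiusM p n : prime p -> (0 < n)%N ->
  mobius (p * n) = if (p %| n)%N then 0 else - mobius n.
Proof.
move=> pp n0; have p0 := prime_gt0 pp.
have pn0 : (0 < p * n)%N by rewrite muln_gt0 p0.
rewrite !(@mobius_box _ (p * n).+1); try by apply/andP; split; nia.
have pr : p \in index_iota 1 (p * n).+1 by rewrite mem_index_iota; nia.
rewrite big_mkcond [in RHS]big_mkcond (bigD1_seq p) ?iota_uniq//= pp lognM// logn_prime// eqxx /=.
have [pn|pn] := boolP (p %| n)%N.
  have : p \in primes n by rewrite mem_primes pp n0.
  by rewrite -logn_gt0; case: (logn p n) => //= k _; rewrite mul0r.
have l0 : logn p n = 0%N.
  by apply/eqP; rewrite -leqn0 leqNgt logn_gt0 mem_primes pp n0.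
rewrite [X in _ = - X](bigD1_seq p) ?iota_uniq//= pp l0 /= mul1r mulN1r; congr (- _).
apply: eq_bigr => q qp; case: ifP => // qq.
by rewrite lognM// logn_prime// (negPf qp).
Qed.

(** With p the least prime factor, each divisor d not divisible by p cancels against p d, and the
    divisors divisible by p^2 contribute 0. *)
Lemma mobius_one n : (0 < n)%N -> conv mobius (fun=> 1) n = delta n.
Proof.
move=> n0; have [n1|n1] := leqP n 1.
  by rewrite (_ : n = 1%N) ?conv1 /mobius ?big_nil ?mulr1//; lia.
have pp := pdiv_prime n1; set p := pdiv n in pp.
have /dvdnP[m nE] := pdiv_dvd n; rewrite -/p mulnC in nE.
have m0 : (0 < m)%N by nia.
rewrite /delta (_ : n == 1%N = false) ?mulr0n; last by lia.
rewrite /conv (bigID (fun d => p %| d)%N) /= nE -big_filter.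
rewrite (perm_big _ (perm_dvd_divs pp m0)) big_map.
rewrite [X in _ + X](_ : _ = \sum_(d <- divs m | ~~ (p %| d)%N) mobius d).
  rewrite (bigID (fun d => p %| d)%N) /= [X in X + _ + _]big_seq_cond.
  rewrite [X in X + _ + _]big1 ?add0r; last first.
    move=> d /andP[]; rewrite -dvdn_divs// => dm pd.
    by rewrite mobiusM ?(dvdn_gt0 m0 dm)// pd mul0r.
  rewrite -big_split big_seq_cond big1// => d /andP[]; rewrite -dvdn_divs// => dm pd.
  by rewrite mobiusM ?(dvdn_gt0 m0 dm)// (negPf pd) mulr1 /= addNr.
rewrite -big_filter -[RHS]big_filter (perm_big [seq d <- divs m | ~~ (p %| d)%N]).
  by apply: eq_bigr => d _; rewrite mulr1.
apply: uniq_perm; rewrite ?filter_uniq ?divs_uniq ?iota_uniq// => d.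
rewrite [LHS]mem_filter [RHS]mem_filter -!dvdn_divs//; last by rewrite -nE.
case pd: (p %| d)%N => //=; rewrite Gauss_dvdr//.
by rewrite coprime_sym prime_coprime// pd.
Qed.

(* The convolution of liouville with 1 is the indicator of the squares, which mobius carried by
   the squares inverts; twisting by A and by B inverts each factor of conv A B. The summatory
   function of this inverse is controlled by that of conv A B itself. *)
Lemma conv_inverse A B n : cmul A -> cmul B -> (0 < n)%N ->
  conv (conv (conv (fun k => liouville k * conv A B k)
                   (fun k => A k * sqext mobius k)) (fun k => B k * sqext mobius k))
       (conv A B) n = delta n.
Proof.
move=> Ac Bc n0.
have lc : cmul liouville := cmulext_cmul _.
pose lA k := liouville k * A k; pose lB k := liouville k * B k.
pose mA k := A k * sqext mobius k; pose mB k := B k * sqext mobius k.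
have key C : cmul C -> forall k, (0 < k)%N ->
  conv (conv (fun k => liouville k * C k) (fun k => C k * sqext mobius k)) C k = delta k.
  move=> Cc k k0.
  rewrite convC convA -(@conv_delta delta k k0).
  have E : forall j, (0 < j)%N -> conv C (fun i => liouville i * C i) j = C j * sqext (fun=> 1) j.
    move=> j j0; rewrite -liouville_one// -conv_cmul// convC.
    by apply: eq_conv => i _; rewrite ?mulr1// mulrC.
  rewrite (eq_conv _ E (fun i _ => erefl)) conv_cmul// conv_sqext//.
  have [[i i0 e]|[e|nsq]] := square_spec k; [|by rewrite e in k0|].
    rewrite e sqext_sq// convC mobius_one// conv_delta ?expn_gt0 ?i0//.
    rewrite /delta; case: (i =P 1%N) => [->|i1]; first by rewrite exp1n Cc.1 mulr1.
    by rewrite mulr0 (_ : i ^ 2 == 1 = false)%N//; nia.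
  rewrite sqext_nsq// mulr0 conv_delta// /delta.
  by have := nsq 1%N; rewrite exp1n eq_sym => /negPf ->.
have E1 k : (0 < k)%N -> liouville k * conv A B k = conv lA lB k.
  by move=> _; rewrite -conv_cmul.
rewrite (eq_conv (f' := conv (conv (conv lA lB) mA) mB) (g' := conv A B) _ _ (fun k _ => erefl)); last first.
  by move=> k k0; apply: eq_conv => // j j0; apply: eq_conv.
rewrite -(conv_delta delta n0) -(eq_conv _ (key _ Ac) (key _ Bc)) -/mA -/mB -/lA -/lB.
have AC f g h k : conv (conv f g) h k = conv (conv f h) g k.
  by rewrite -convA (eq_conv k (fun _ _ => erefl) (fun j _ => convC g h j)) convA.
rewrite [LHS]convA [RHS]convA; apply: eq_conv => // k _.
rewrite [RHS]convA AC; apply: eq_conv => // j _.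
transitivity (conv (conv (conv lA mA) lB) A j); last exact: AC.
by apply: eq_conv => // i _; exact: AC.
Qed.

End Convolution.

(** * Chebyshev and Mertens estimates *)

Section RealSums.
Variable R : realType.
Implicit Types (g w : nat -> R) (C : R).

Lemma abel_le g w C x : 0 <= C -> (0 < x)%N ->
  (forall n, (0 < n <= x)%N -> \sum_(1 <= k < n.+1) g k <= C * n%:R) ->
  (forall n, (0 < n < x)%N -> w n.+1 <= w n) -> 0 <= w x ->
  \sum_(1 <= n < x.+1) g n * w n <= C * \sum_(1 <= n < x.+1) w n.
Proof.
move=> C0 x0 Hg wd wx.
have gx := Hg x; rewrite x0 leqnn in gx; have {}gx := gx isT.
(* The induction keeps the boundary term of partial summation, which is at most 0 by the hypothesis
   on g at x. *)
suff : \sum_(1 <= n < x.+1) g n * w n <=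
   C * (\sum_(1 <= n < x.+1) w n) + (\sum_(1 <= k < x.+1) g k - C * x%:R) * w x.
  move/le_trans; apply; rewrite gerDl mulr_le0_ge0// subr_le0//.
elim: x x0 Hg wd {wx gx} => // -[_ _ _ _|x IH _ Hg wd].
  by rewrite !big_nat1; nra.
have {}IH : \sum_(1 <= n < x.+2) g n * w n <=
   C * (\sum_(1 <= n < x.+2) w n) + (\sum_(1 <= k < x.+2) g k - C * x.+1%:R) * w x.+1.
  by apply: IH => // n nx; [apply: Hg|apply: wd]; lia.
rewrite !(big_nat_recr x.+2)//=.
have G := Hg x.+1; have W := wd x.+1.
have {}G : \sum_(1 <= k < x.+2) g k <= C * x.+1%:R by apply: G; lia.
have {}W : w x.+2 <= w x.+1 by apply: W; lia.
rewrite -[x.+2%:R]natr1; nra.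
Qed.

Definition sq n : R := Num.sqrt n%:R.

Lemma sq_ge0 n : 0 <= sq n. Proof. exact: sqrtr_ge0. Qed.
Lemma sq_gt0 n : (0 < n)%N -> 0 < sq n.
Proof. by move=> n0; rewrite sqrtr_gt0 ltr0n. Qed.
Lemma sqK n : sq n * sq n = n%:R.
Proof. by rewrite -expr2 sqr_sqrtr// ler0n. Qed.
Lemma sq_ge1 n : (0 < n)%N -> 1 <= sq n.
Proof. by move=> n0; rewrite -sqrtr1 ler_sqrt ?ler1n// ler0n. Qed.
Lemma sq_le m n : (m <= n)%N -> sq m <= sq n.
Proof. by move=> mn; rewrite ler_sqrt ?ler_nat// ler0n. Qed.

Lemma sum_inv_sq x : \sum_(1 <= n < x.+1) (sq n)^-1 <= 2 * sq x.
Proof.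
elim: x => [|x IH]; first by rewrite big_nil mulr_ge0// ?sq_ge0.
rewrite big_nat_recr//= -lerBrDr; apply: le_trans IH _; rewrite lerBrDr.
have a0 := sq_ge0 x; have b0 := @sq_gt0 x.+1 isT.
have := sqK x; have := sqK x.+1; rewrite -natr1.
move: (sq x) (sq x.+1) a0 b0 => a b a0 b0 bb aa.
have ab : a <= b by nra.
rewrite -(ler_pM2r b0) mulrDl mulVf ?gt_eqF//; nra.
Qed.

(** With a and b the square roots of n and n + 1, one has 1 / a - 1 / b = 1 / (a b (a + b)) and a (a
    + b) <= 2 b^2: a telescoping majorant of 1 / b^3. *)
Lemma inv_sq_diff n : (0 < n)%N ->
  (sq n.+1 * n.+1%:R)^-1 <= 2 * ((sq n)^-1 - (sq n.+1)^-1).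
Proof.
move=> n0.
have a0 := sq_gt0 n0; have b0 := @sq_gt0 n.+1 isT.
have := sqK n; have := sqK n.+1; have nR : 0 < n%:R :> R by rewrite ltr0n.
rewrite -[n.+1%:R]natr1.
move: (sq n) (sq n.+1) (n%:R : R) nR a0 b0 => a b N N0 a0 b0 bb aa.
have ab : a <= b by nra.
rewrite (_ : a^-1 - b^-1 = (b - a) / (a * b)); last first.
  by field; rewrite ?gt_eqF.
rewrite mulrA ler_pdivlMr ?mulr_gt0// ler_pdivrMl ?mulr_gt0//; last by lra.
have key : a * (a + b) <= 2 * (N + 1) by nra.
have ba : 0 <= b - a by lra.
have := ler_wpM2r ba key; have h1 : (a + b) * (b - a) = 1 by lra.
rewrite -mulrA h1 mulr1 => ka.
by rewrite mulrC -[_ * (N + 1) * _]mulrA ler_pM2l//; lra.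
Qed.

Lemma sum_inv_3half x : \sum_(1 <= n < x.+1) (sq n * n%:R)^-1 <= 3.
Proof.
case: x => [|x]; first by rewrite big_nil.
suff : \sum_(1 <= n < x.+2) (sq n * n%:R)^-1 <= 3 - 2 * (sq x.+1)^-1.
  by have : 0 <= (sq x.+1)^-1; [rewrite invr_ge0 sq_ge0|lra].
elim: x => [|x IH]; first by rewrite big_nat1 (sqrtr1 R : sq 1 = 1) mulr1 !invr1; lra.
rewrite big_nat_recr//=; apply: le_trans (lerD IH (@inv_sq_diff x.+1 isT)) _; lra.
Qed.

Lemma sum_inv_sqr x : \sum_(1 <= n < x.+1) (n%:R ^+ 2)^-1 <= 2 :> R.
Proof.
case: x => [|x]; first by rewrite big_nil.
suff : \sum_(1 <= n < x.+2) (n%:R ^+ 2)^-1 <= 2 - x.+1%:R^-1 :> R.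
  by move/le_trans; apply; rewrite gerBl invr_ge0 ler0n.
elim: x => [|x IH]; first by rewrite big_nat1 expr1n invr1; lra.
rewrite big_nat_recr//=.
apply: le_trans (lerD IH (_ : _ <= x.+1%:R^-1 - x.+2%:R^-1)) _; last by rewrite addrA subrK.
rewrite -[x.+2%:R]natr1; have : 0 < x.+1%:R :> R by rewrite ltr0n.
move: (x.+1%:R : R) => a a0.
have -> : a^-1 - (a + 1)^-1 = (a * (a + 1))^-1 by field; rewrite !gt_eqF//; lra.
by rewrite lef_pV2 ?posrE ?exprn_gt0 ?mulr_gt0//; nra.
Qed.

Definition lnn n : R := ln n%:R.

Lemma lnn_ge0 n : 0 <= lnn n.
Proof.
case: n => [|n]; first by rewrite /lnn ln0.
by apply: ln_ge0; rewrite ler1n.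
Qed.
Lemma lnn1 : lnn 1 = 0. Proof. exact: ln1. Qed.
Lemma lnnM m n : (0 < m)%N -> (0 < n)%N -> lnn (m * n) = lnn m + lnn n.
Proof. by move=> m0 n0; rewrite /lnn natrM lnM// posrE ltr0n. Qed.
Lemma lnnX p k : (0 < p)%N -> lnn (p ^ k) = k%:R * lnn p.
Proof. by move=> p0; rewrite /lnn natrX lnXn ?ltr0n// mulr_natl. Qed.
Lemma lnn_le m n : (0 < m)%N -> (m <= n)%N -> lnn m <= lnn n.
Proof. by move=> m0 mn; rewrite ler_ln ?posrE ?ltr0n ?ler_nat//; lia. Qed.
Lemma lnn_diff n : (0 < n)%N -> lnn n.+1 - lnn n <= n%:R^-1.
Proof.
move=> n0; have nR : 0 < n%:R :> R by rewrite ltr0n.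
rewrite /lnn -ln_div ?posrE ?ltr0n// -natr1 mulrDl mulfV ?gt_eqF// mul1r.
apply: le_ln1Dx; have : 0 < n%:R^-1 :> R by rewrite invr_gt0.
lra.
Qed.
Lemma lnn_unbounded C : exists n, (0 < n)%N /\ C < lnn n.
Proof.
have l2 : 0 < lnn 2 by apply: ln_gt0; rewrite ltr1n.
pose k := Num.bound `|C / lnn 2|.
exists (2 ^ k)%N; split; first by rewrite expn_gt0.
rewrite lnnX// -ltr_pdivrMr//.
exact: le_lt_trans (ler_norm _) (archi_boundP (normr_ge0 _)).
Qed.

Lemma lnn_le_sq n : (0 < n)%N -> lnn n <= 2 * sq n.
Proof.
move=> n0; rewrite /lnn -sqK -expr2 lnXn ?sq_gt0// mulr2n.
have := ln_sublinear (sq_gt0 n0); lra.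
Qed.

(** Going from x to x + 1 adds ln (x + 1) - ln x times a sum of size 2 sqrt x, hence at most 2 /
    sqrt x, and these increments add up to O(sqrt x). *)
Lemma sum_lnn_inv_sq x : (0 < x)%N ->
  \sum_(1 <= d < x.+1) (lnn x - lnn d) * (sq d)^-1 <= 4 * sq x.
Proof.
move=> x0; apply: le_trans (_ : _ <= \sum_(1 <= k < x) 2 * (sq k)^-1) _.
  case: x x0 => // x _; elim: x => [|x IH].
    by rewrite big_nil big_nat1 subrr mul0r.
  rewrite [X in X <= _]big_nat_recr//= subrr mul0r addr0 [X in _ <= X]big_nat_recr//=.
  have -> : \sum_(1 <= d < x.+2) (lnn x.+2 - lnn d) * (sq d)^-1 =
     \sum_(1 <= d < x.+2) (lnn x.+1 - lnn d) * (sq d)^-1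
     + (lnn x.+2 - lnn x.+1) * \sum_(1 <= d < x.+2) (sq d)^-1.
    by rewrite mulr_sumr -big_split; apply: eq_bigr => d _; rewrite /=; ring.
  apply: lerD => //.
  apply: le_trans (_ : _ <= x.+1%:R^-1 * (2 * sq x.+1)) _.
    apply: ler_pM; rewrite ?lnn_diff ?sum_inv_sq ?subr_ge0 ?lnn_le//.
    by apply: sumr_ge0 => d _; rewrite invr_ge0 sq_ge0.
  rewrite -[x.+1%:R]sqK invfM mulrCA -mulrA mulVf ?mulr1//.
  by rewrite gt_eqF// sq_gt0.
rewrite -mulr_sumr; case: x x0 => // x _.
have := sum_inv_sq x; have := sq_le (leqnSn x); lra.
Qed.

Lemma inv_sq_divn d x : (0 < d <= x)%N ->
  (sq (x %/ d))^-1 <= 2 * sq d * (sq x)^-1.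
Proof.
move=> /andP[d0 dx]; have q0 : (0 < x %/ d)%N by rewrite divn_gt0.
have x0 : (0 < x)%N by lia.
rewrite -div1r ler_pdivrMr ?sq_gt0// mulrAC ler_pdivlMr ?sq_gt0// mul1r.
have -> : 2 * sq d * sq (x %/ d) = sq (2 ^ 2 * (d * (x %/ d))).
  by rewrite /sq natrM natrX sqrtrM ?exprn_ge0// natrM sqrtrM ?ler0n// sqrtr_sqr ger0_norm// mulrA.
apply: sq_le; have := ltn_ceil x d0; nia.
Qed.

(** Error bound for convolutions: in a sum over d of u d / d times a remainder of order (x /
    d)^(-1/2), u is controlled only on average, and partial summation replaces it by the constant C.
    The weight w will be 1 or ln (x / d). *)
Lemma sum_weight_le u w C D x : (0 < x)%N -> 0 <= C -> (forall n, 0 <= u n) ->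
  (forall n, (0 < n)%N -> \sum_(1 <= k < n.+1) u k <= C * n%:R) ->
  (forall n, (0 < n <= x)%N -> 0 <= w n) ->
  (forall n, (0 < n < x)%N -> w n.+1 <= w n) ->
  \sum_(1 <= d < x.+1) w d * (sq d)^-1 <= D * sq x ->
  \sum_(1 <= d < x.+1) d%:R^-1 * u d * w d * (sq (x %/ d))^-1 <= 2 * C * D.
Proof.
move=> x0 C0 u0 Hu w0 wd HD; have X0 := sq_gt0 x0.
apply: le_trans (_ : _ <= \sum_(1 <= d < x.+1) (u d * (w d * (sq d)^-1)) * (2 / sq x)) _.
  apply: ler_sum_nat => d dx; have d0 : (0 < d)%N by lia.
  have D0 := sq_gt0 d0.
  apply: le_trans (ler_wpM2l _ (inv_sq_divn dx)) _.
    by rewrite !mulr_ge0// ?invr_ge0 ?ler0n//; apply: w0.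
  rewrite -[d%:R]sqK le_eqVlt; apply/orP; left; apply/eqP.
  by field; rewrite !gt_eqF.
rewrite -mulr_suml mulrA ler_pdivrMr// [_ * 2]mulrC -!mulrA ler_pM2l//.
apply: le_trans (abel_le C0 x0 _ _ _) _.
- by move=> n /andP[n0 _]; exact: Hu.
- move=> n nx; apply: ler_pM; rewrite ?invr_ge0 ?sq_ge0 ?wd//.
    by apply: w0; lia.
  by rewrite lef_pV2 ?posrE ?sq_gt0 ?sq_le//; lia.
- by rewrite mulr_ge0 ?invr_ge0 ?sq_ge0// w0// x0 leqnn.
exact: ler_wpM2l.
Qed.

Definition mangoldt n : R := if primes n is [:: p] then lnn p else 0.

Lemma mangoldt_ge0 n : 0 <= mangoldt n.
Proof. by rewrite /mangoldt; case: (primes n) => // p []// ; exact: lnn_ge0. Qed.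

Lemma mangoldtX p k : prime p -> (0 < k)%N -> mangoldt (p ^ k) = lnn p.
Proof. by move=> pp k0; rewrite /mangoldt primesX// primes_prime. Qed.

Lemma mangoldt_prime p : prime p -> mangoldt p = lnn p.
Proof. by move=> pp; rewrite -{1}(expn1 p) mangoldtX. Qed.

Lemma mangoldt_neq0 n : mangoldt n != 0 ->
  exists p k, [/\ prime p, (0 < k)%N & n = (p ^ k)%N].
Proof.
rewrite /mangoldt; case Pn : (primes n) => [|p []]; rewrite ?eqxx// => _.
have n0 : (0 < n)%N by case: n Pn.
have pn : p \in primes n by rewrite Pn mem_head.
exists p, (logn p n); split.
- by move: pn; rewrite mem_primes => /andP[].
- by rewrite logn_gt0.
by rewrite {1}(prod_prime_decomp n0) prime_decompE Pn /= big_seq1.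
Qed.

(** Pass from m to n = p m: among the divisors of n that do not divide m, the full power of p is the
    only prime power, and it accounts for ln p. *)
Lemma sum_mangoldt n : (0 < n)%N -> conv mangoldt (fun=> 1) n = lnn n.
Proof.
have [k] := ubnP n; elim: k n => // k IH n nk n0.
have [n1|n1] := leqP n 1.
  by rewrite (_ : n = 1%N) ?conv1 ?lnn1 ?mulr1//; lia.
have pp := pdiv_prime n1; set p := pdiv n in pp.
have /dvdnP[m nE] := pdiv_dvd n; rewrite -/p mulnC in nE.
have p1 := prime_gt1 pp; have p0 := prime_gt0 pp.
have m0 : (0 < m)%N by nia.
have IHm : conv mangoldt (fun=> 1) m = lnn m by apply: IH => //; nia.
rewrite nE lnnM// -IHm /conv.
rewrite (bigID (fun d => d %| m)%N) /= addrC; congr (_ + _); last first.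
  rewrite -big_filter; apply: perm_big.
  apply: uniq_perm; rewrite ?filter_uniq ?divs_uniq ?iota_uniq// => d.
  rewrite mem_filter -!dvdn_divs//; last by rewrite -nE.
  by case dm: (d %| m)%N => //=; rewrite dvdn_mull.
pose j := (logn p m).+1.
have jE : logn p n = j by rewrite nE lognM// logn_prime// eqxx.
rewrite big_mkcond (bigD1_seq (p ^ j)%N) ?divs_uniq//=; last first.
  by rewrite -dvdn_divs -?nE// pfactor_dvdn// jE.
rewrite pfactor_dvdn// ltnn /= mangoldtX// mulr1.
rewrite big_seq_cond big1 ?addr0// => d /andP[]; rewrite -dvdn_divs -?nE// => dn dj.
case: ifP => // dm; apply/eqP; rewrite mulr1; apply: contraR dm => /mangoldt_neq0.
case=> q [i [qq i0 dE]]; rewrite dE pfactor_dvdn//.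
move: dn; rewrite dE pfactor_dvdn// nE lognM// logn_prime//.
case: (q =P p) => [qp|_]; last by rewrite add0n.
rewrite add1n leq_eqVlt => /orP[/eqP ij|//].
by move: dj; rewrite dE qp ij qp /j eqxx.
Qed.

Lemma sum_lnn x : \sum_(1 <= n < x.+1) lnn n =
  \sum_(1 <= d < x.+1) mangoldt d * (x %/ d)%:R.
Proof.
transitivity (\sum_(1 <= n < x.+1) 1 * conv mangoldt (fun=> 1) n).
  by apply: eq_big_nat => n /andP[n0 _]; rewrite mul1r sum_mangoldt.
rewrite sum_conv; apply: eq_bigr => d _.
by rewrite sumr_const_nat subn1 /= mul1r mulr1 mulr_natr.
Qed.

(** This is (2 k)! <= 4^k (k!)^2, the bound on the central binomial coefficient. *)
Lemma sum_lnn_double k : \sum_(1 <= n < (2 * k).+1) lnn n <=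
  2 * (\sum_(1 <= n < k.+1) lnn n) + 2 * k%:R * lnn 2.
Proof.
elim: k => [|k IH]; first by rewrite !big_nil; lra.
rewrite (_ : (2 * k.+1).+1 = (2 * k).+3)%N; last by lia.
rewrite (big_nat_recr (2 * k).+2)// (big_nat_recr (2 * k).+1)// (big_nat_recr k.+1)//=.
have e : lnn (2 * k).+2 = lnn 2 + lnn k.+1 by rewrite -lnnM//; congr lnn; lia.
have l : lnn (2 * k).+1 <= lnn 2 + lnn k.+1.
  by rewrite -lnnM//; apply: lnn_le => //; lia.
rewrite -[k.+1%:R]natr1; move: IH; rewrite -[_ + lnn (2 * k).+2]addrA e; lra.
Qed.

(** In ln ((2 k)!) - 2 ln (k!) the integer d has coefficient floor (2 k / d) - 2 floor (k / d),
    which is never negative and is 1 for k < d <= 2 k. *)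
Lemma sum_mangoldt_double k : \sum_(1 <= d < (2 * k).+1) mangoldt d <=
  \sum_(1 <= d < k.+1) mangoldt d + 2 * k%:R * lnn 2.
Proof.
have := sum_lnn_double k; rewrite !sum_lnn.
have le2 : (k.+1 <= (2 * k).+1)%N by lia.
rewrite [X in 2 * X + _](_ : _ = \sum_(1 <= d < (2 * k).+1) mangoldt d * (k %/ d)%:R).
  rewrite -lerBlDl mulr_sumr -sumrB => H; rewrite -lerBlDl; apply: le_trans H.
  rewrite [X in _ <= X](@big_cat_nat _ _ _ k.+1)//= [X in X - _](@big_cat_nat _ _ _ k.+1)//=.
  rewrite addrAC subrr add0r -[X in X <= _]add0r; apply: lerD.
    apply: sumr_ge0 => d _; rewrite mulrCA -mulrBr; apply: mulr_ge0; first exact: mangoldt_ge0.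
    rewrite subr_ge0 -natrM ler_nat mulnC.
    by case: d => // d; rewrite leq_divRL// mulnAC mulnC leq_mul2l leq_trunc_div.
  apply: ler_sum_nat => d dk; rewrite [(k %/ d)%N]divn_small//; last by lia.
  have -> : (2 * k %/ d = 1)%N.
    have -> : (2 * k = 1 * d + (2 * k - d))%N by lia.
    by rewrite divnMDl ?divn_small//; lia.
  by rewrite mulr0 mulr0 subr0 mulr1.
rewrite [RHS](@big_cat_nat _ _ _ k.+1)//= [X in _ = _ + X]big_nat_cond.
by rewrite [X in _ = _ + X]big1 ?addr0// => d /andP[dk _]; rewrite divn_small ?mulr0//; lia.
Qed.

Lemma chebyshev x : \sum_(1 <= d < x.+1) mangoldt d <= 4 * lnn 2 * x%:R.
Proof.
have l2 := lnn_ge0 2.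
have [k] := ubnP x; elim: k x => // k IH x xk.
have [x2|x2] := leqP x 2.
  have -> : \sum_(1 <= d < x.+1) mangoldt d = if x == 2%N then lnn 2 else 0.
    case: x x2 {xk} => [|[|[|//]]] _; rewrite ?big_nil ?big_nat1//=.
    by rewrite big_nat_recr// big_nat1 /= add0r mangoldt_prime.
  case: eqP => [->|_]; first by lra.
  by rewrite !mulr_ge0.
(* x / 2 rounded up. The doubling step gives (4 + 2) h ln 2, which fits into 4 x ln 2 because 6 h <=
   4 x for x >= 3. *)
pose h := (x.+1)./2.
have xh : (x <= 2 * h)%N by rewrite /h; lia.
have h2 : (2 * h <= x.+1)%N by rewrite /h; lia.
have hk : (h < k)%N by rewrite /h; lia.
apply: (@le_trans _ _ (\sum_(1 <= d < (2 * h).+1) mangoldt d)).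
  rewrite [X in _ <= X](@big_cat_nat _ _ _ x.+1)//= lerDl.
  by apply: sumr_ge0 => d _; exact: mangoldt_ge0.
apply: le_trans (sum_mangoldt_double h) _.
have := IH _ hk.
have hx : 6 * h%:R <= 4 * x%:R :> R by rewrite -!natrM ler_nat /h; lia.
have := ler_wpM2l l2 hx; lra.
Qed.

Lemma sum_lnn_bounds x : (0 < x)%N ->
  x%:R * lnn x - x%:R <= \sum_(1 <= n < x.+1) lnn n <= x%:R * lnn x.
Proof.
case: x => // x _; elim: x => [|x IH].
  by rewrite big_nat1 lnn1; lra.
have d := @lnn_diff x.+1 isT; have l := @lnn_le x.+1 x.+2 isT (leqnSn _).
rewrite big_nat_recr//= -[x.+2%:R]natr1.
have x0 : 0 < x.+1%:R :> R by rewrite ltr0n.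
have {}d : x.+1%:R * (lnn x.+2 - lnn x.+1) <= 1.
  by rewrite mulrC -ler_pdivlMr// div1r.
have {}l := ler_wpM2l (ltW x0) l.
by apply/andP; split; case/andP: IH; lra.
Qed.

(** x times the sum differs from ln (x!) only by the fractional parts of the x / d, which cost at
    most the Chebyshev bound. *)
Lemma mertens x : (0 < x)%N ->
  lnn x - 1 <= \sum_(1 <= d < x.+1) mangoldt d / d%:R <= lnn x + 4 * lnn 2.
Proof.
move=> x0; have xR : 0 < x%:R :> R by rewrite ltr0n.
have /andP[lo hi] := sum_lnn_bounds x0; rewrite sum_lnn in lo hi.
apply/andP; split; rewrite -(ler_pM2l xR) mulr_sumr.
  rewrite mulrBr mulr1; apply: le_trans lo _; apply: ler_sum_nat => d /andP[d0 _].
  have dR : 0 < d%:R :> R by rewrite ltr0n.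
  rewrite mulrCA; apply: ler_wpM2l; first exact: mangoldt_ge0.
  by rewrite ler_pdivlMr// -natrM ler_nat leq_trunc_div.
rewrite mulrDr [x%:R * (4 * _)]mulrC -lerBlDr.
apply: le_trans hi.
apply: le_trans (_ : _ <= \sum_(1 <= d < x.+1) (x%:R * (mangoldt d / d%:R) - mangoldt d)) _.
  by rewrite sumrB lerD2l lerN2 chebyshev.
apply: ler_sum_nat => d /andP[d0 _]; have dR : 0 < d%:R :> R by rewrite ltr0n.
rewrite mulrCA -{2}[mangoldt d]mulr1 -mulrBr; apply: ler_wpM2l; first exact: mangoldt_ge0.
rewrite lerBlDr ler_pdivrMr// natr1 -natrM ler_nat.
by have := ltn_ceil x d0; lia.
Qed.

End RealSums.

(** * Estimates and convergence of complex sums *)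

Section ComplexSums.
Local Open Scope complex_scope.
Variable R : realType.
Local Notation K := R[i].
Implicit Types (f g u F : nat -> K) (w : nat -> R) (C : R).

(** The norm of R[i] takes its values in R[i]; its real part is the real number used in the
    estimates. *)
Definition nrm (z : K) : R := Re `|z|.

Lemma nrmE z : (nrm z)%:C = `|z|.
Proof. by rewrite /nrm normc_def. Qed.
Lemma nrm_ge0 z : 0 <= nrm z.
Proof. by rewrite -ler0c nrmE. Qed.
Lemma nrm0 : nrm 0 = 0. Proof. by apply: complexI; rewrite nrmE normr0. Qed.
Lemma nrm1 : nrm 1 = 1. Proof. by apply: complexI; rewrite nrmE normr1. Qed.
Lemma nrmM x y : nrm (x * y) = nrm x * nrm y.
Proof. by apply: complexI; rewrite rmorphM /= !nrmE normrM. Qed.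
Lemma nrmX x n : nrm (x ^+ n) = nrm x ^+ n.
Proof. by apply: complexI; rewrite rmorphXn /= !nrmE normrX. Qed.
Lemma nrmN x : nrm (- x) = nrm x.
Proof. by apply: complexI; rewrite !nrmE normrN. Qed.
Lemma nrmV x : nrm x^-1 = (nrm x)^-1.
Proof. by apply: complexI; rewrite fmorphV /= !nrmE normfV. Qed.
Lemma nrmD x y : nrm (x + y) <= nrm x + nrm y.
Proof. by rewrite -lecR rmorphD /= !nrmE ler_normD. Qed.
Lemma nrmB x y : nrm (x - y) <= nrm x + nrm y.
Proof. by rewrite -(nrmN y) nrmD. Qed.
Lemma nrm_real (x : R) : nrm x%:C = `|x|.
Proof. by rewrite /nrm normc_def /= expr0n addr0 sqrtr_sqr. Qed.
Lemma nrm_ge0_real (x : R) : 0 <= x -> nrm x%:C = x.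
Proof. by move=> x0; rewrite nrm_real ger0_norm. Qed.
Lemma nrm_nat n : nrm n%:R = n%:R.
Proof. by rewrite -[n%:R](rmorph_nat (real_complex R)) nrm_ge0_real// ler0n. Qed.
Lemma nrm_conj z : nrm z^* = nrm z.
Proof. by rewrite /nrm normcJ. Qed.
Lemma nrm_eq0 z : nrm z = 0 -> z = 0.
Proof. by move=> z0; apply/eqP; rewrite -normr_eq0 -nrmE z0. Qed.
Lemma nrm_Re z : `|Re z| <= nrm z.
Proof. by rewrite -lecR nrmE normc_ge_Re. Qed.
Lemma ReB (x y : K) : Re (x - y) = Re x - Re y. Proof. by case: x y => ??[]. Qed.
Lemma ImB (x y : K) : Im (x - y) = Im x - Im y. Proof. by case: x y => ??[]. Qed.
Lemma nrm_i : nrm 'i = 1.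
Proof. by rewrite /nrm normc_def /= expr0n expr1n add0r sqrtr1. Qed.
Lemma nrm_Im z : `|Im z| <= nrm z.
Proof.
have -> : Im z = - Re (z * 'i) by case: z => a b; rewrite /=; ring.
by rewrite normrN; apply: le_trans (nrm_Re _) _; rewrite nrmM nrm_i mulr1.
Qed.
Lemma nrm_le z : nrm z <= `|Re z| + `|Im z|.
Proof.
rewrite {1}[z]complexE; apply: le_trans (nrmD _ _) _.
by rewrite nrmM !nrm_real nrm_i mul1r.
Qed.
Lemma nrm_sum (I : Type) (s : seq I) (P : pred I) (F : I -> K) :
  nrm (\sum_(i <- s | P i) F i) <= \sum_(i <- s | P i) nrm (F i).
Proof.
elim/big_ind2: _ => [|x1 x2 y1 y2 h1 h2|//]; first by rewrite nrm0.
exact: le_trans (nrmD _ _) (lerD h1 h2).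
Qed.

Lemma abel_bound F w C n :
  (forall k, nrm (\sum_(0 <= j < k) F j) <= C) ->
  (forall k, w k.+1 <= w k) -> (forall k, 0 <= w k) ->
  nrm (\sum_(0 <= j < n) F j * (w j)%:C) <= C * w 0%N.
Proof.
move=> HF wd w0; have C0 : 0 <= C by apply: le_trans (nrm_ge0 _) (HF 0%N).
case: n => [|n]; first by rewrite big_nil nrm0 mulr_ge0.
have : nrm (\sum_(0 <= j < n.+1) F j * (w j)%:C
             - (\sum_(0 <= j < n.+1) F j) * (w n)%:C) <= C * (w 0%N - w n).
  elim: n => [|n IH]; first by rewrite !big_nat1 !subrr nrm0 mulr0.
  rewrite !(big_nat_recr n.+1)//=.
  set S := \sum_(_ <= _ < _) _ in IH *; set T := \sum_(_ <= _ < _) _ in IH *.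
  have -> : S + F n.+1 * (w n.+1)%:C - (T + F n.+1) * (w n.+1)%:C =
     (S - T * (w n)%:C) + T * (w n - w n.+1)%:C by rewrite rmorphB /=; ring.
  apply: le_trans (nrmD _ _) _; rewrite nrmM nrm_ge0_real; last by rewrite subr_ge0.
  have := HF n.+1; rewrite -/T => HT.
  have dw : 0 <= w n - w n.+1 by rewrite subr_ge0.
  have := ler_wpM2r dw HT; lra.
move=> H; set S := \sum_(_ <= _ < _) _ * _ in H *.
set T := \sum_(_ <= _ < _) _ in H *.
have -> : S = (S - T * (w n)%:C) + T * (w n)%:C by ring.
apply: le_trans (nrmD _ _) _; rewrite nrmM (nrm_ge0_real (w0 n)).
have := ler_wpM2r (w0 n) (HF n.+1); rewrite -/T; lra.
Qed.

(** The limit is the supremum of the lower bounds u n - e n, which gives the rate e at every n >=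
    1. *)
Lemma real_limit (u e : nat -> R) : (forall n, 0 <= e n) ->
  (forall m n, (0 < m <= n)%N -> `|u n - u m| <= e m) ->
  exists l, forall n, (0 < n)%N -> `|u n - l| <= e n.
Proof.
move=> e0 H; pose E : set R := [set z | exists2 n, (0 < n)%N & z = u n - e n]%classic.
have ub m n : (0 < m)%N -> (0 < n)%N -> u n - e n <= u m + e m.
  move=> m0 n0; have := e0 n; have := e0 m; have [mn|nm] := leqP m n.
    by have := H m n; rewrite m0 mn => /(_ isT); rewrite ler_norml => /andP[]; lra.
  by have := H n m; rewrite n0 ltnW// => /(_ isT); rewrite ler_norml => /andP[]; lra.
have E0 : (E !=set0)%classic by exists (u 1%N - e 1%N), 1%N.
have bE m : (0 < m)%N -> ubound E (u m + e m).
  by move=> m0 _ [n n0 ->]; exact: ub.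
exists (sup E) => n n0; rewrite ler_norml.
have h1 : u n - e n <= sup E.
  apply: ub_le_sup; last by exists n.
  by exists (u n + e n); exact: bE.
have h2 : sup E <= u n + e n by apply: ge_sup => //; exact: bE.
by apply/andP; split; lra.
Qed.

Definition iv n : K := (n%:R)^-1.

Lemma iv_real n : iv n = (n%:R^-1)%:C.
Proof. by rewrite fmorphV rmorph_nat. Qed.
Lemma nrm_iv n : nrm (iv n) = n%:R^-1.
Proof. by rewrite nrmV nrm_nat. Qed.
Lemma ivM m n : iv (m * n) = iv m * iv n.
Proof. by rewrite /iv natrM invfM. Qed.

Definition Lsum f x : K := \sum_(1 <= n < x.+1) iv n * f n.

Lemma Lsum_tail f C m n : (0 < m <= n)%N ->
  (forall x, (0 < x)%N -> nrm (\sum_(1 <= k < x.+1) f k) <= C * sq R x) ->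
  nrm (Lsum f n - Lsum f m) <= 4 * C * (sq R m)^-1.
Proof.
case/andP=> m0 mn HS.
pose S x := \sum_(1 <= k < x.+1) f k.
have C0 : 0 <= C.
  by have := le_trans (nrm_ge0 _) (HS 1%N isT); rewrite /sq sqrtr1 mulr1.
have S_iv x : (0 < x)%N -> nrm (S x * iv x.+1) <= C * (sq R x)^-1.
  move=> x0; rewrite nrmM nrm_iv; apply: le_trans (ler_wpM2r _ (HS _ x0)) _.
    by rewrite invr_ge0 ler0n.
  rewrite -mulrA; apply: ler_wpM2l => //.
  rewrite ler_pdivrMr ?ltr0n// ler_pdivlMl ?sq_gt0// sqK ler_nat; lia.
(* Partial summation with both boundary terms removed: each step adds [S n.+1] divided by (n + 1) (n
   + 2), and [inv_sq_diff] makes the bound telescope. *)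
have key : nrm (Lsum f n - Lsum f m - S n * iv n.+1 + S m * iv m.+1)
    <= 2 * C * ((sq R m)^-1 - (sq R n)^-1).
  elim: n mn => [|n IH]; first by lia.
  rewrite leq_eqVlt => /orP[/eqP <-|mn].
    by rewrite subrr sub0r addNr subrr nrm0 mulr0.
  have {}IH := IH mn; have n0 : (0 < n)%N by lia.
  have -> : Lsum f n.+1 - Lsum f m - S n.+1 * iv n.+2 + S m * iv m.+1 =
    (Lsum f n - Lsum f m - S n * iv n.+1 + S m * iv m.+1) + S n.+1 * (iv n.+1 - iv n.+2).
    by rewrite /Lsum /S !(big_nat_recr n.+1)//=; ring.
  apply: le_trans (nrmD _ _) _; rewrite nrmM.
  have d : (sq R n.+1 * n.+2%:R)^-1 <= 2 * ((sq R n)^-1 - (sq R n.+1)^-1).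
    apply: le_trans (inv_sq_diff R n0).
    by rewrite lef_pV2 ?posrE ?mulr_gt0 ?sq_gt0 ?ltr0n// ler_pM2l ?sq_gt0// ler_nat.
  have -> : iv n.+1 - iv n.+2 = iv (n.+1 * n.+2).
    have h1 : n.+1%:R != 0 :> K by rewrite pnatr_eq0.
    have h2 : n.+1%:R + 1 != 0 :> K by rewrite natr1 pnatr_eq0.
    rewrite /iv natrM -[n.+2%:R]natr1; move: (n.+1%:R : K) h1 h2 => a h1 h2.
    by field; rewrite h1 h2.
  rewrite nrm_iv.
  have h := HS n.+1 isT; rewrite -/(S n.+1) in h.
  have h' : nrm (S n.+1) * (n.+1 * n.+2)%:R^-1 <= C * (sq R n.+1 * n.+2%:R)^-1.
    apply: le_trans (ler_wpM2r _ h) _; first by rewrite invr_ge0 ler0n.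
    have -> : (n.+1 * n.+2)%:R^-1 = (sq R n.+1)^-1 * (sq R n.+1 * n.+2%:R)^-1.
      by rewrite natrM -(sqK _ n.+1) -invfM mulrA.
    by rewrite -mulrA mulVKf// gt_eqF// sq_gt0.
  apply: le_trans (lerD IH h') _; have := ler_wpM2l C0 d.
  move: (_ * n.+2%:R)^-1 (sq R n)^-1 (sq R n.+1)^-1 (sq R m)^-1 => x1 x2 x3 x4; lra.
have -> : Lsum f n - Lsum f m =
   (Lsum f n - Lsum f m - S n * iv n.+1 + S m * iv m.+1) + S n * iv n.+1 - S m * iv m.+1 by ring.
apply: le_trans (nrmB _ _) _.
have n0 : (0 < n)%N by lia.
have := nrmD (Lsum f n - Lsum f m - S n * iv n.+1 + S m * iv m.+1) (S n * iv n.+1).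
have := S_iv _ n0; have := S_iv _ m0.
have : C * (sq R n)^-1 <= C * (sq R m)^-1.
  by apply: ler_wpM2l => //; rewrite lef_pV2 ?posrE ?sq_gt0// sq_le.
have : 0 <= C * (sq R n)^-1 by rewrite mulr_ge0// invr_ge0 sq_ge0.
lra.
Qed.

Lemma Lsum_limit f C :
  (forall x, (0 < x)%N -> nrm (\sum_(1 <= k < x.+1) f k) <= C * sq R x) ->
  exists L, forall x, (0 < x)%N -> nrm (Lsum f x - L) <= 8 * C * (sq R x)^-1.
Proof.
move=> HS.
have C0 : 0 <= C.
  by have := le_trans (nrm_ge0 _) (HS 1%N isT); rewrite /sq sqrtr1 mulr1.
pose e n := 4 * C * (sq R n)^-1.
have e0 n : 0 <= e n by rewrite mulr_ge0 ?mulr_ge0// invr_ge0 sq_ge0.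
have [a Ha] : exists l, forall n, (0 < n)%N -> `|Re (Lsum f n) - l| <= e n.
  apply: real_limit => // m n mn; rewrite -ReB.
  exact: le_trans (nrm_Re _) (Lsum_tail mn HS).
have [b Hb] : exists l, forall n, (0 < n)%N -> `|Im (Lsum f n) - l| <= e n.
  apply: real_limit => // m n mn; rewrite -ImB.
  exact: le_trans (nrm_Im _) (Lsum_tail mn HS).
exists (a +i* b) => x x0; apply: le_trans (nrm_le _) _.
have := Ha _ x0; have := Hb _ x0; rewrite ReB ImB /= /e; lra.
Qed.

End ComplexSums.

(** * Mertens' argument for Dirichlet series of degree two *)

Section Dichotomy.
Local Open Scope complex_scope.
Variable R : realType.
Local Notation K := R[i].
Implicit Types (f g u F A B : nat -> K) (w : nat -> R) (C : R).

Definition lnK n : K := (lnn R n)%:C.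
Definition mangK n : K := (mangoldt R n)%:C.
(* s x = c * ln x + O(1) *)
Definition asym (s : nat -> K) (c : K) :=
  exists C : R, forall x, (0 < x)%N -> nrm (s x - c * lnK x) <= C.

Lemma conv_real (a b : nat -> R) n :
  conv (fun k => (a k)%:C) (fun k => (b k)%:C) n = (conv a b n)%:C.
Proof. by rewrite /conv rmorph_sum; apply: eq_bigr => d _; rewrite rmorphM. Qed.

Lemma nrm_conv f g n :
  nrm (conv f g n) <= conv (fun k => nrm (f k)) (fun k => nrm (g k)) n.
Proof.
apply: le_trans (nrm_sum _ _ _) _.
by apply: ler_sum => d _; rewrite nrmM.
Qed.

Lemma lnKM d e : (0 < d)%N -> (0 < e)%N -> lnK (d * e)%N = lnK d + lnK e.
Proof. by move=> d0 e0; rewrite /lnK lnnM// rmorphD. Qed.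

Lemma Lsum_conv f g x :
  Lsum (conv f g) x = \sum_(1 <= d < x.+1) (iv R d * f d) * Lsum g (x %/ d).
Proof.
rewrite /Lsum sum_conv; apply: eq_bigr => d _; rewrite mulr_sumr.
by apply: eq_bigr => e _; rewrite ivM; ring.
Qed.

Lemma Lsum_err u f L C D x : (0 < x)%N -> 0 <= C -> 0 <= D ->
  (forall n, (0 < n)%N -> \sum_(1 <= k < n.+1) nrm (u k) <= C * n%:R) ->
  (forall n, (0 < n)%N -> nrm (Lsum f n - L) <= D * (sq R n)^-1) ->
  nrm (\sum_(1 <= d < x.+1) (iv R d * u d) * (Lsum f (x %/ d) - L)) <= 4 * C * D.
Proof.
move=> x0 C0 D0 Hu HL; apply: le_trans (nrm_sum _ _ _) _.
apply: le_trans (_ : _ <= \sum_(1 <= d < x.+1)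
    (d%:R^-1 * nrm (u d) * 1 * (sq R (x %/ d))^-1) * D) _.
  apply: ler_sum_nat => d dx; rewrite !nrmM nrm_iv mulr1 -[X in _ <= X]mulrA.
  apply: ler_wpM2l; first by rewrite mulr_ge0 ?nrm_ge0// invr_ge0 ler0n.
  by rewrite mulrC; apply: HL; rewrite divn_gt0; lia.
rewrite -mulr_suml; apply: ler_wpM2r => //.
apply: le_trans (@sum_weight_le R (fun n => nrm (u n)) (fun=> 1) C 2 x x0 C0 _ Hu _ _ _) _ => //.
- by move=> n; exact: nrm_ge0.
- by under eq_bigr do rewrite mul1r; exact: sum_inv_sq.
lra.
Qed.

(** The weight ln (x / d) costs only a constant, as the sum of ln (x / d) / sqrt d is still O(sqrt
    x). *)
Lemma Lsum_err_ln u f C D x : (0 < x)%N -> 0 <= C -> 0 <= D ->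
  (forall n, (0 < n)%N -> \sum_(1 <= k < n.+1) nrm (u k) <= C * n%:R) ->
  (forall n, (0 < n)%N -> nrm (Lsum f n) <= D * (sq R n)^-1) ->
  nrm (\sum_(1 <= d < x.+1) (iv R d * u d) * (lnK x - lnK d) * Lsum f (x %/ d)) <= 8 * C * D.
Proof.
move=> x0 C0 D0 Hu HL; apply: le_trans (nrm_sum _ _ _) _.
have w0 n : (0 < n <= x)%N -> 0 <= lnn R x - lnn R n.
  by move=> nx; rewrite subr_ge0 lnn_le//; lia.
apply: le_trans (_ : _ <= \sum_(1 <= d < x.+1)
    (d%:R^-1 * nrm (u d) * (lnn R x - lnn R d) * (sq R (x %/ d))^-1) * D) _.
  apply: ler_sum_nat => d dx; rewrite !nrmM nrm_iv -rmorphB nrm_ge0_real ?w0//.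
  rewrite -[X in _ <= X]mulrA; apply: ler_wpM2l.
    by rewrite !mulr_ge0 ?nrm_ge0 ?w0// invr_ge0 ler0n.
  by rewrite mulrC; apply: HL; rewrite divn_gt0; lia.
rewrite -mulr_suml; apply: ler_wpM2r => //.
apply: le_trans (@sum_weight_le R (fun n => nrm (u n)) (fun n => lnn R x - lnn R n) C 4 x x0 C0 _ Hu w0 _ _) _.
- by move=> n; exact: nrm_ge0.
- by move=> n nx; rewrite lerD2l lerN2 lnn_le//; lia.
- exact: sum_lnn_inv_sq.
lra.
Qed.

(** Partial summation against the remainder E: the boundary term is at most 2 D since ln x <= 2 sqrt
    x, and the sum is at most 3 D by [sum_inv_3half]. *)
Lemma Lsum_ln_bounded f L D :  0 <= D ->
  (forall n, (0 < n)%N -> nrm (Lsum f n - L) <= D * (sq R n)^-1) ->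
  forall x, (0 < x)%N -> nrm (Lsum (fun n => lnK n * f n) x) <= 5 * D.
Proof.
move=> D0 HL x x0; pose E n := Lsum f n - L.
have -> : Lsum (fun n => lnK n * f n) x =
   lnK x * E x - \sum_(1 <= k < x) (lnK k.+1 - lnK k) * E k.
  case: x x0 => // x _; elim: x => [|x IH].
    by rewrite /Lsum big_nat1 big_nil /lnK lnn1 !mul0r mulr0 subr0.
  rewrite /Lsum (big_nat_recr x.+2)//= -/(Lsum _ _) IH.
  rewrite [X in _ = _ - X](big_nat_recr x.+1)//= /E /Lsum (big_nat_recr x.+2)//=.
  ring.
apply: le_trans (nrmB _ _) _.
have h1 : nrm (lnK x * E x) <= 2 * D.
  rewrite nrmM nrm_ge0_real ?lnn_ge0//.
  apply: le_trans (ler_pM (lnn_ge0 _ _) (nrm_ge0 _) (lnn_le_sq R x0) (HL _ x0)) _.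
  by rewrite mulrACA mulfV ?mulr1// gt_eqF// sq_gt0.
have h2 : nrm (\sum_(1 <= k < x) (lnK k.+1 - lnK k) * E k) <= 3 * D.
  apply: le_trans (nrm_sum _ _ _) _.
  apply: le_trans (_ : _ <= \sum_(1 <= k < x) (sq R k * k%:R)^-1 * D) _.
    apply: ler_sum_nat => k /andP[k0 _]; rewrite nrmM -rmorphB nrm_ge0_real; last first.
      by rewrite subr_ge0 lnn_le.
    apply: le_trans (ler_pM _ (nrm_ge0 _) (lnn_diff R k0) (HL _ k0)) _.
      by rewrite subr_ge0 lnn_le.
    by rewrite invfM [_^-1 * k%:R^-1]mulrC -mulrA [D * _]mulrC.
  rewrite -mulr_suml; apply: ler_wpM2r => //.
  by case: x x0 {h1} => // x _; exact: sum_inv_3half.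
lra.
Qed.

Lemma sum_sqext_inv x : \sum_(1 <= d < x.+1) sqext (fun=> 1) d / d%:R <= 2 :> R.
Proof.
apply: le_trans (sum_inv_sqr R x).
have -> : \sum_(1 <= d < x.+1) sqext (fun=> 1) d / d%:R =
   \sum_(1 <= d < x.+1) \sum_(1 <= k < x.+1) (if (k ^ 2 == d)%N then d%:R^-1 else 0) :> R.
  apply: eq_big_nat => d dx; rewrite /sqext mulr_suml.
  rewrite [RHS](@big_cat_nat _ _ _ d.+1)//=; last by lia.
  rewrite -[in RHS]big_mkcond /= [X in _ + X]big_nat_cond.
  rewrite [X in _ + X]big1 ?addr0; first by apply: eq_bigr => k _; rewrite mul1r.
  by move=> k kd; rewrite ifN//; nia.
rewrite exchange_big; apply: ler_sum_nat => k kx.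
rewrite -big_mkcond /= (eq_bigl (fun d => d == (k ^ 2)%N)); last by move=> d; rewrite eq_sym.
rewrite sum_eq_nat; case: ifP => _; first by rewrite natrX.
by rewrite invr_ge0 exprn_ge0 ?ler0n.
Qed.

(** As q is dominated by the indicator of the squares, its norms divided by n sum to at most 2, so
    that convolving with q preserves linear growth. *)
Lemma sum_nrm_conv_sq u q C : 0 <= C ->
  (forall n, (0 < n)%N -> \sum_(1 <= k < n.+1) nrm (u k) <= C * n%:R) ->
  (forall n, (0 < n)%N -> nrm (q n) <= sqext (fun=> 1) n) ->
  forall n, (0 < n)%N -> \sum_(1 <= k < n.+1) nrm (conv u q k) <= 2 * C * n%:R.
Proof.
move=> C0 Hu Hq x x0.
apply: le_trans (_ : _ <= \sum_(1 <= k < x.+1) 1 * conv (sqext (fun=> 1)) (fun k => nrm (u k)) k) _.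
  apply: ler_sum_nat => n /andP[n0 _]; apply: le_trans (nrm_conv _ _ _) _.
  rewrite mul1r convC /conv big_seq [X in _ <= X]big_seq; apply: ler_sum => d dn.
  apply: ler_wpM2r; first exact: nrm_ge0.
  by apply: Hq; rewrite -dvdn_divs// in dn; exact: dvdn_gt0 dn.
rewrite sum_conv.
apply: le_trans (_ : _ <= \sum_(1 <= d < x.+1) (sqext (fun=> 1) d / d%:R) * (C * x%:R)) _.
  apply: ler_sum_nat => d dx.
  have s0 : 0 <= sqext (fun=> 1) d :> R by apply: sumr_ge0.
  have d0 : 0 < d%:R :> R by rewrite ltr0n; lia.
  under eq_bigr do rewrite mul1r.
  rewrite -mulr_sumr -mulrA; apply: ler_wpM2l => //.
  apply: le_trans (Hu _ _) _; first by rewrite divn_gt0; lia.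
  rewrite mulrCA; apply: ler_wpM2l => //.
  by rewrite ler_pdivlMl// mulrC -natrM ler_nat leq_trunc_div.
rewrite -mulr_suml -mulrA; apply: ler_wpM2r; last exact: sum_sqext_inv.
by rewrite mulr_ge0 ?ler0n.
Qed.

Lemma nrm_mobius n : nrm (mobius K n) <= 1.
Proof.
rewrite /mobius; elim/big_ind: _ => [|a b ha hb|p _]; first by rewrite nrm1.
  by rewrite nrmM -[1]mulr1 ler_pM ?nrm_ge0.
by case: ifP => _; rewrite ?nrm0 ?nrmN ?nrm1.
Qed.

Lemma nrm_sqext_mobius A n : (forall k, (0 < k)%N -> nrm (A k) <= 1) -> (0 < n)%N ->
  nrm (A n * sqext (mobius K) n) <= sqext (fun=> 1) n.
Proof.
move=> HA n0; have [[k k0 nE]|[e|nsq]] := square_spec n; last 2 first.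
- by rewrite e in n0.
- by rewrite !sqext_nsq// mulr0 nrm0.
rewrite nE !sqext_sq// -nE nrmM -[1]mulr1; apply: ler_pM; rewrite ?nrm_ge0 ?nrm_mobius//.
exact: HA.
Qed.

Lemma nrm_liouville n : nrm (liouville K n) = 1.
Proof.
rewrite /liouville /cmulext; elim/big_ind: _ => [|a b ha hb|p _]; first by rewrite nrm1.
  by rewrite nrmM ha hb mulr1.
by rewrite nrmX nrmN nrm1 expr1n.
Qed.

Section TwoFactors.
Variables (A B : nat -> K) (C : R) (L : K).
Hypotheses (Ac : cmul A) (Bc : cmul B).
Hypotheses (A1 : forall n, (0 < n)%N -> nrm (A n) <= 1)
           (B1 : forall n, (0 < n)%N -> nrm (B n) <= 1).
Let f := conv A B.
Hypothesis C0 : 0 <= C.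
Hypothesis fabs : forall x, (0 < x)%N -> \sum_(1 <= k < x.+1) nrm (f k) <= C * x%:R.
Hypothesis fL : forall x, (0 < x)%N -> nrm (Lsum f x - L) <= C * (sq R x)^-1.

(* v is the coefficient sequence of - F' / F, for F the Dirichlet series of f, and g is the
   coefficient sequence of 1 / F. *)
Let v n := (A n + B n) * mangK n.
Let g := conv (conv (fun k => liouville K k * f k) (fun k => A k * sqext (mobius K) k))
              (fun k => B k * sqext (mobius K) k).

Let v_conv n : (0 < n)%N -> conv v f n = lnK n * f n.
Proof.
move=> n0.
have key D : cmul D -> forall k, (0 < k)%N ->
    conv D (fun j => D j * mangK j) k = lnK k * D k.
  move=> Dc k k0; rewrite convC.
  rewrite (eq_conv (f' := fun j => D j * mangK j) (g' := fun j => D j * (fun=> 1%:C) j)) //.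
    by rewrite conv_cmul// conv_real sum_mangoldt// mulrC.
  by move=> j _; rewrite mulr1.
rewrite convC (eq_conv (f' := f) (g' := fun k => A k * mangK k + B k * mangK k)) //; last first.
  by move=> k _; rewrite /v mulrDl.
rewrite conv_addr -(conv_deriv _ _ _ lnKM); congr (_ + _).
  by rewrite convC /f convA; apply: eq_conv => // k k0; rewrite convC key.
by rewrite /f -convA; apply: eq_conv => // k k0; rewrite key.
Qed.

Let v_sum x : (0 < x)%N -> \sum_(1 <= k < x.+1) nrm (v k) <= 8 * lnn R 2 * x%:R.
Proof.
move=> x0; apply: le_trans (_ : _ <= \sum_(1 <= k < x.+1) 2 * mangoldt R k) _.
  apply: ler_sum_nat => k /andP[k0 _]; rewrite nrmM nrm_ge0_real ?mangoldt_ge0//.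
  apply: ler_wpM2r; first exact: mangoldt_ge0.
  apply: le_trans (nrmD _ _) _; have := A1 k0; have := B1 k0; lra.
rewrite -mulr_sumr; have := chebyshev R x; lra.
Qed.

Let g_sum x : (0 < x)%N -> \sum_(1 <= k < x.+1) nrm (g k) <= 4 * C * x%:R.
Proof.
move=> x0; have -> : 4 * C = 2 * (2 * C) by ring.
have C2 : 0 <= 2 * C by rewrite mulr_ge0.
apply: (sum_nrm_conv_sq C2) => // {x0}x x0.
  apply: (sum_nrm_conv_sq C0) => // {x0}x.
    move=> x0; under eq_bigr do rewrite nrmM nrm_liouville mul1r.
    exact: fabs.
  exact: nrm_sqext_mobius.
exact: nrm_sqext_mobius.
Qed.

(** The convolution of v with f is f weighted by ln. Summed with weights 1 / n, this makes L times
    [Lsum v x] differ by O(1) from the sum of f n ln n / n, which is bounded. *)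
Lemma nonvanishing_asym : L != 0 -> asym (Lsum v) 0.
Proof.
move=> L0; have l0 : 0 < nrm L.
  by rewrite lt_neqAle nrm_ge0 andbT eq_sym; apply: contra L0 => /eqP/nrm_eq0 ->.
exists ((5 * C + 4 * (8 * lnn R 2) * C) / nrm L) => x x0.
rewrite mul0r subr0 ler_pdivlMr// -nrmM.
have h1 := Lsum_ln_bounded C0 fL x0.
have h2 := Lsum_err x0 (mulr_ge0 (ler0n _ 8) (lnn_ge0 R 2)) C0 v_sum fL.
have e : Lsum (fun n => lnK n * f n) x =
   Lsum v x * L + \sum_(1 <= d < x.+1) (iv R d * v d) * (Lsum f (x %/ d) - L).
  transitivity (Lsum (conv v f) x).
    by apply: eq_big_nat => n /andP[n0 _]; rewrite v_conv.
  rewrite Lsum_conv /Lsum mulr_suml -big_split; apply: eq_bigr => d _ /=; ring.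
have -> : Lsum v x * L = Lsum (fun n => lnK n * f n) x
   - \sum_(1 <= d < x.+1) (iv R d * v d) * (Lsum f (x %/ d) - L) by rewrite e addrK.
by apply: le_trans (nrmB _ _) _; exact: lerD.
Qed.

(** The sum of g d / d times ln (x / d) times [Lsum f (x %/ d)] is bounded because L = 0. Expanded
    by means of [conv g f = delta], it equals ln x + [Lsum v x]. That g is bounded on average makes
    the coefficient exactly - 1: a double zero would contradict it. *)
Lemma vanishing_asym : L = 0 -> asym (Lsum v) (-1).
Proof.
move=> L0; exists (8 * (4 * C) * C) => x x0.
have fL0 n : (0 < n)%N -> nrm (Lsum f n) <= C * (sq R n)^-1.
  by move=> n0; rewrite -[Lsum f n]subr0 -L0 fL.
have C4 : 0 <= 4 * C by rewrite mulr_ge0.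
have := Lsum_err_ln x0 C4 C0 g_sum fL0.
suff -> : \sum_(1 <= d < x.+1) iv R d * g d * (lnK x - lnK d) * Lsum f (x %/ d) =
   Lsum v x - -1 * lnK x by [].
have e1 n : (0 < n)%N -> conv g f n = delta K n by exact: conv_inverse.
have e2 n : (0 < n)%N -> conv (fun k => lnK k * g k) f n = - v n.
  move=> n0; have := conv_deriv g f n lnKM; rewrite e1//.
  have -> : lnK n * delta K n = 0.
    by rewrite /delta; case: eqP => [->|_]; rewrite ?mulr0// /lnK lnn1 mul0r.
  have -> : conv g (fun k => lnK k * f k) n = v n.
    rewrite (eq_conv (f' := g) (g' := conv v f))//; last by move=> k k0; rewrite v_conv.
    rewrite (eq_conv (f' := g) (g' := conv f v))//; last by move=> k k0; rewrite convC.
    by rewrite convA (eq_conv (f' := delta K) (g' := v))// convC conv_delta.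
  by move/eqP; rewrite addr_eq0 => /eqP.
have -> : \sum_(1 <= d < x.+1) iv R d * g d * (lnK x - lnK d) * Lsum f (x %/ d) =
   lnK x * Lsum (conv g f) x - Lsum (conv (fun k => lnK k * g k) f) x.
  rewrite !Lsum_conv mulr_sumr -sumrB; apply: eq_bigr => d _; ring.
have -> : Lsum (conv g f) x = 1.
  transitivity (\sum_(1 <= n < x.+1 | n == 1%N) iv R n); last first.
    by rewrite sum_eq_nat /= ltnS x0 /iv invr1.
  rewrite big_mkcond; apply: eq_big_nat => n /andP[n0 _]; rewrite e1// /delta.
  by case: eqP; rewrite ?mulr1 ?mulr0.
have -> : Lsum (conv (fun k => lnK k * g k) f) x = - Lsum v x.
  rewrite /Lsum -sumrN; apply: eq_big_nat => n /andP[n0 _].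
  by rewrite e2// mulrN.
ring.
Qed.

End TwoFactors.
End Dichotomy.

(** * Real characters *)

Section RealNonvanishing.
Local Open Scope complex_scope.
Variable R : realType.

(** The hypothesis [q p = t p - 1] says that one of the two local parameters is 1 and the other is
    [q p], whence a geometric sum. *)
Lemma three_term_pfactor (t q f : nat -> R) p k n : three_term t q f ->
  prime p -> (0 < n)%N -> ~~ (p %| n)%N -> q p = t p - 1 ->
  f (p ^ k * n)%N = (\sum_(0 <= j < k.+1) q p ^+ j) * f n.
Proof.
move=> H pp n0 pn qt; have p0 := prime_gt0 pp.
suff : f (p ^ k * n)%N = (\sum_(0 <= j < k.+1) q p ^+ j) * f n /\
  f (p ^ k.+1 * n)%N = (\sum_(0 <= j < k.+2) q p ^+ j) * f n by case.
elim: k => [|k [IH1 IH2]].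
  rewrite expn0 mul1n expn1 H// (negPf pn) !big_mkord !big_ord_recl !big_ord0 /=.
  by rewrite /bump /= add1n expr0 expr1; split; rewrite ?qt; ring.
split => //; rewrite expnS -mulnA H ?muln_gt0 ?expn_gt0 ?p0//.
rewrite expnS -mulnA dvdn_mulr// mulKn// mulnA -expnS IH1 IH2.
rewrite !(big_nat_recr k.+2)// !(big_nat_recr k.+1)//= [q p ^+ k.+2]exprS.
have -> : t p = q p + 1 by rewrite qt; ring.
ring.
Qed.

(** The factor at p is the sum of the [chi p ^+ j] for j up to the exponent k of p in n: it is never
    negative, and is at least 1 when k is even. *)
Lemma conv_real_char_ge (chi : nat -> R) : cmul chi ->
  (forall p, prime p -> [\/ chi p = 0, chi p = 1 | chi p = -1]) ->
  forall n, (0 < n)%N -> sqext (fun=> 1) n <= conv chi (fun=> 1) n.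
Proof.
move=> chc chp n; have [b] := ubnP n; elim: b n => // b IH n nb n0.
have oc : cmul (fun=> 1 : R) by split=> // *; rewrite mulr1.
have sq_ge k : 0 <= sqext (fun=> 1) k :> R by apply: sumr_ge0.
have [n1|n1] := leqP n 1.
  have -> : n = 1%N by lia.
  by rewrite conv1 chc.1 mulr1 -(exp1n 2) sqext_sq.
have pp := pdiv_prime n1; set p := pdiv n in pp.
have pn : (p %| n)%N := pdiv_dvd n.
have [n' pn' nE] := pfactor_coprime pp n0.
have k0 : (0 < logn p n)%N by rewrite logn_gt0 mem_primes pp n0.
set k := logn p n in nE k0; have p0 := prime_gt0 pp; have p1 := prime_gt1 pp.
have n'0 : (0 < n')%N by move: n0; rewrite nE muln_gt0 => /andP[].
have pn'' : ~~ (p %| n')%N by rewrite -prime_coprime.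
have pk1 : (1 < p ^ k)%N by rewrite -(exp1n k) ltn_exp2r.
have {}IH : sqext (fun=> 1) n' <= conv chi (fun=> 1) n'.
  by apply: IH => //; nia.
have -> : conv chi (fun=> 1) n = (\sum_(0 <= j < k.+1) chi p ^+ j) * conv chi (fun=> 1) n'.
  rewrite {1}nE mulnC (three_term_pfactor _ (conv_three_term chc oc) pp n'0 pn'').
    by rewrite mulr1.
  by rewrite mulr1 addrK.
set c := \sum_(_ <= _ < _) _.
have c0 : 0 <= c /\ (~~ odd k -> 1 <= c).
  rewrite /c; have [->|->|->] := chp p pp.
  - rewrite big_nat_recl//= expr0 big1 ?addr0; first by split.
    by move=> i _; rewrite expr0n.
  - under eq_bigr do rewrite expr1n.
    rewrite sumr_const_nat subn0; split=> [|_]; first exact: ler0n.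
    by rewrite ler1n.
  have -> : \sum_(0 <= j < k.+1) (-1) ^+ j = (~~ odd k)%:R :> R.
    elim: (k) => [|j IHj]; first by rewrite big_nat1.
    rewrite big_nat_recr//= IHj -signr_odd /=.
    by case: (odd j); rewrite /= ?expr0 ?expr1; ring.
  by case: (odd k); split.
have [[l l0 e]|[e|nsq]] := square_spec n; last 2 first.
- by rewrite e in n0.
- by rewrite sqext_nsq// mulr_ge0 ?(le_trans _ IH) ?c0.1.
have [l' pl' lE] := pfactor_coprime pp l0.
have kE : k = (logn p l * 2)%N by rewrite /k e lognX mulnC.
have n'E : n' = (l' ^ 2)%N.
  apply/eqP; rewrite -(@eqn_pmul2r (p ^ k)) ?expn_gt0 ?p0// -nE e {1}lE expnMn.
  by rewrite -expnM kE.
have l'0 : (0 < l')%N by move: n'0; rewrite n'E; case: (l').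
move: IH; rewrite e n'E !sqext_sq// => IH.
have c1 : 1 <= c by apply: c0.2; rewrite kE muln2 odd_double.
rewrite -[X in X <= _]mulr1; apply: ler_pM => //.
Qed.

Definition invsqsum t : R := \sum_(1 <= e < t.+1) (sq R e)^-1.

(** The difference 2 sqrt t - [invsqsum t] increases with t, by at most 1 / sqrt t - 1 / sqrt (t +
    1) at each step. *)
Lemma invsqsum_asym : exists c, forall t, (0 < t)%N ->
  `|2 * sq R t - invsqsum t - c| <= (sq R t)^-1.
Proof.
apply: real_limit => [n|m n /andP[m0 mn]]; first by rewrite invr_ge0 sq_ge0.
set u := fun t => 2 * sq R t - invsqsum t.
rewrite -/(u n) -/(u m).
suff : 0 <= u n - u m <= (sq R m)^-1 - (sq R n)^-1.
  have : 0 <= (sq R n)^-1 by rewrite invr_ge0 sq_ge0.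
  by move=> s0 /andP[h1 h2]; rewrite ger0_norm//; lra.
elim: n mn => [|n IH]; first by lia.
rewrite leq_eqVlt => /orP[/eqP <-|mn]; first by rewrite !subrr lexx.
have n0 : (0 < n)%N by lia.
have {}IH := IH mn.
have : 0 <= u n.+1 - u n <= (sq R n)^-1 - (sq R n.+1)^-1.
  rewrite /u /invsqsum (big_nat_recr n.+1)//=.
  set H := \sum_(_ <= _ < _) _.
  have a0 := sq_gt0 R n0; have b0 := @sq_gt0 R n.+1 isT.
  have := sqK R n; have := sqK R n.+1; rewrite -natr1.
  move: (sq R n) (sq R n.+1) a0 b0 => a b a0 b0 bb aa.
  have ab : a <= b by nra.
  have -> : 2 * b - (H + b^-1) - (2 * a - H) = 2 * (b - a) - b^-1 by ring.
  have h : (b - a) * (a + b) = 1 by lra.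
  have ba : 0 <= b - a by lra.
  have bi : b * b^-1 = 1 by rewrite mulfV// gt_eqF.
  have ai : a * a^-1 = 1 by rewrite mulfV// gt_eqF.
  have bi0 : 0 < b^-1 by rewrite invr_gt0.
  have ai0 : 0 < a^-1 by rewrite invr_gt0.
  apply/andP; split.
    by rewrite subr_ge0 -div1r ler_pdivrMr//; nra.
  by rewrite lerD2r -[a^-1]div1r ler_pdivlMr//; nra.
move=> /andP[h1 h2]; case/andP: IH => h3 h4; apply/andP; split; lra.
Qed.

Variables (chi : nat -> R) (M D : R).
Hypothesis chc : cmul chi.
Hypothesis chp : forall p, prime p -> [\/ chi p = 0, chi p = 1 | chi p = -1].
Hypothesis ch1 : forall n, `|chi n| <= 1.
Hypothesis chM : forall x, `|\sum_(1 <= k < x.+1) chi k| <= M.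
Hypothesis chD : forall x, (0 < x)%N ->
  `|\sum_(1 <= k < x.+1) chi k / k%:R| <= D * (sq R x)^-1.

Lemma abel_tail (w : nat -> R) y z : (forall k, (0 < k)%N -> w k.+1 <= w k) ->
  (forall k, (0 < k)%N -> 0 <= w k) ->
  `|\sum_(y.+1 <= d < z) chi d * w d| <= 2 * M * w y.+1.
Proof.
move=> wd w0; rewrite -nrm_real rmorph_sum /=.
rewrite -[y.+1]add0n big_addn.
under eq_bigr do rewrite rmorphM.
apply: (@abel_bound R (fun i => (chi (i + y.+1))%:C) (fun i => w (i + y.+1)%N)).
- move=> k; rewrite -rmorph_sum nrm_real.
  have -> : \sum_(0 <= j < k) chi (j + y.+1) =
     \sum_(1 <= j < (k + y).+1) chi j - \sum_(1 <= j < y.+1) chi j.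
    rewrite [X in X - _](@big_cat_nat _ _ _ y.+1)//=; last by lia.
    rewrite addrAC subrr add0r -[y.+1 in RHS]add0n [RHS]big_addn.
    by rewrite (_ : (k + y).+1 - y.+1 = k)%N//; lia.
  by apply: le_trans (ler_normB _ _) _; have := chM (k + y); have := chM y; lra.
- by move=> k; rewrite addSn; apply: wd; lia.
- by move=> k; apply: w0; lia.
Qed.

(** Sharpens the decay in [chD] to 1 / y: by partial summation all later partial sums lie within 2 M
    / y of this one, and they tend to 0 by [chD]. *)
Lemma chi_harmonic y : (0 < y)%N -> `|\sum_(1 <= k < y.+1) chi k / k%:R| <= 2 * M * y%:R^-1.
Proof.
move=> y0; have M0 : 0 <= M by apply: le_trans (normr_ge0 _) (chM 0).
have D0 : 0 <= D.
  by have := le_trans (normr_ge0 _) (chD (ltn0Sn 0)); rewrite (sqrtr1 R : sq R 1 = 1) invr1 mulr1.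
have tail z : (y < z)%N -> `|\sum_(1 <= k < z.+1) chi k / k%:R - \sum_(1 <= k < y.+1) chi k / k%:R|
    <= 2 * M * y%:R^-1.
  move=> yz; rewrite [X in X - _](@big_cat_nat _ _ _ y.+1)//=; last by lia.
  rewrite addrAC subrr add0r; apply: le_trans (@abel_tail (fun k => k%:R^-1) _ _ _ _) _.
  - by move=> k k0; rewrite lef_pV2 ?posrE ?ltr0n ?ler_nat//.
  - by move=> k k0; rewrite invr_ge0 ler0n.
  apply: ler_wpM2l; first by rewrite mulr_ge0.
  by rewrite lef_pV2 ?posrE ?ltr0n ?ler_nat.
rewrite leNgt; apply/negP; set F := \sum_(_ <= _ < _) _; set T := 2 * M * _ => lt.
pose e := `|F| - T; have e0 : 0 < e by rewrite /e; lra.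
(* z is so large that D / sqrt z falls below the excess e. *)
pose b := Num.bound (D / e); pose z := (b ^ 2 + y).+1.
have yz : (y < z)%N by rewrite /z; lia.
have z0 : (0 < z)%N by lia.
have be : D / e < b%:R by apply: archi_boundP; rewrite divr_ge0// ltW.
have bz : b%:R <= sq R z.
  rewrite -[b%:R]ger0_norm ?ler0n// -sqrtr_sqr ler_sqrt ?ler0n//.
  by rewrite -natrX ler_nat /z; lia.
have h1 := tail z yz; have h2 := chD z0.
have h3 : D * (sq R z)^-1 < e.
  by rewrite ltr_pdivrMr ?sq_gt0// mulrC -ltr_pdivrMr// (lt_le_trans be bz).
have := ler_normB (\sum_(1 <= k < z.+1) chi k / k%:R) (\sum_(1 <= k < z.+1) chi k / k%:R - F).
rewrite subKr -/F; move: h1 h2 h3 lt; rewrite -/F /e -/T; lra.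
Qed.

(* Hyperbola method at x = y^2: the main term is 2 y times the partial sum of chi k / k, which is
   O(1 / y) when the series vanishes. *)
Lemma weighted_sum_bounded : exists E, forall y, (0 < y)%N ->
  \sum_(1 <= n < (y ^ 2).+1) (sq R n)^-1 * conv chi (fun=> 1) n <= E.
Proof.
have M0 : 0 <= M by apply: le_trans (normr_ge0 _) (chM 0).
have [c Hc] := invsqsum_asym.
exists (4 * M + 2 * M * `|c| + 4 + 4 * M) => y y0.
set x := (y ^ 2)%N.
have x0 : (0 < x)%N by rewrite expn_gt0 y0.
have sx : sq R x = y%:R by rewrite /sq natrX sqrtr_sqr ger0_norm ?ler0n.
have yR : 0 < y%:R :> R by rewrite ltr0n.
have yx : (y <= x)%N by rewrite /x; nia.
have -> : \sum_(1 <= n < x.+1) (sq R n)^-1 * conv chi (fun=> 1) n =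
   \sum_(1 <= d < x.+1) chi d * ((sq R d)^-1 * invsqsum (x %/ d)).
  rewrite sum_conv; apply: eq_bigr => d _; rewrite /invsqsum !mulr_sumr.
  apply: eq_bigr => e _; rewrite mulr1 /sq natrM sqrtrM ?ler0n// invfM; ring.
rewrite (@big_cat_nat _ _ _ y.+1)//=.
have invsq_ge0 t : 0 <= invsqsum t by apply: sumr_ge0 => e _; rewrite invr_ge0 sq_ge0.
have invsq_mono s t : (s <= t)%N -> invsqsum s <= invsqsum t.
  move=> st; rewrite /invsqsum [X in _ <= X](@big_cat_nat _ _ _ s.+1)//= lerDl.
  by apply: sumr_ge0 => e _; rewrite invr_ge0 sq_ge0.
have tail : \sum_(y.+1 <= d < x.+1) chi d * ((sq R d)^-1 * invsqsum (x %/ d)) <= 4 * M.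
  apply: le_trans (ler_norm _) _; apply: le_trans (abel_tail _ _ _ _) _.
  - move=> k k0; apply: ler_pM; rewrite ?invr_ge0 ?sq_ge0//.
      by rewrite lef_pV2 ?posrE ?sq_gt0 ?sq_le.
    by apply: invsq_mono; apply: leq_div2l.
  - by move=> k k0; rewrite mulr_ge0// invr_ge0 sq_ge0.
  have -> : 4 * M = 2 * M * 2 by ring.
  apply: ler_wpM2l; first by rewrite mulr_ge0.
  rewrite ler_pdivrMl ?sq_gt0// mulrC.
  apply: le_trans (sum_inv_sq R _) _; rewrite ler_pM2l//.
  apply: sq_le; apply: leq_trans (_ : (y <= _)%N); last by lia.
  by rewrite -ltnS ltn_divLR// /x; nia.
have head : \sum_(1 <= d < y.+1) chi d * ((sq R d)^-1 * invsqsum (x %/ d)) <=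
   4 * M + 2 * M * `|c| + 4.
  (* Replace [invsqsum (x %/ d)] by 2 y / sqrt d - c. This leaves the main term, a constant times a
     bounded twisted sum, and an error of at most 4 / y for each of the y terms. *)
  have e : \sum_(1 <= d < y.+1) chi d * ((sq R d)^-1 * invsqsum (x %/ d)) =
    2 * y%:R * (\sum_(1 <= d < y.+1) chi d / d%:R)
    - c * (\sum_(1 <= d < y.+1) chi d * (sq R d)^-1)
    + \sum_(1 <= d < y.+1) chi d * (sq R d)^-1 * (invsqsum (x %/ d) - 2 * y%:R * (sq R d)^-1 + c).
    rewrite !mulr_sumr -sumrB -big_split; apply: eq_big_nat => d /andP[d0 _] /=.
    rewrite -[d%:R]sqK invfM; ring.
  rewrite e; apply: lerD; first apply: lerD.
  - apply: le_trans (ler_norm _) _; rewrite normrM ger0_norm; last by rewrite mulr_ge0 ?ler0n.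
    apply: le_trans (ler_wpM2l _ (chi_harmonic y0)) _; first by rewrite mulr_ge0 ?ler0n.
    rewrite le_eqVlt; apply/orP; left; apply/eqP; field; exact: lt0r_neq0.
  - apply: le_trans (ler_norm _) _; rewrite normrN normrM mulrC; apply: ler_wpM2r => //.
    apply: le_trans (abel_tail _ _ _ _) _.
    + by move=> k k0; rewrite lef_pV2 ?posrE ?sq_gt0 ?sq_le.
    + by move=> k k0; rewrite invr_ge0 sq_ge0.
    by rewrite (sqrtr1 R : sq R 1 = 1) invr1 mulr1.
  apply: le_trans (ler_norm _) _; apply: le_trans (ler_norm_sum _ _ _) _.
  apply: le_trans (_ : _ <= \sum_(1 <= d < y.+1) 4 * y%:R^-1) _; last first.
    by rewrite sumr_const_nat subn1 /= -[X in X <= _]mulr_natr divfK// lt0r_neq0.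
  apply: ler_sum_nat => d dy.
  have d0 : (0 < d)%N by lia.
  have dx : (0 < d <= x)%N by lia.
  have q0 : (0 < x %/ d)%N by rewrite divn_gt0; lia.
  have D0 := sq_gt0 R d0; have Q0 := sq_gt0 R q0.
  rewrite !normrM [`|(sq R d)^-1|]ger0_norm ?invr_ge0 ?sq_ge0//.
  apply: le_trans (_ : _ <= 1 * (sq R d)^-1 * (4 * sq R d * y%:R^-1)) _; last first.
    rewrite le_eqVlt; apply/orP; left; apply/eqP; field; by rewrite !lt0r_neq0.
  apply: ler_pM => //; first by rewrite mulr_ge0// invr_ge0 sq_ge0.
    by apply: ler_wpM2r => //; rewrite invr_ge0 sq_ge0.
  have h1 := Hc _ q0; have := inv_sq_divn R dx; rewrite sx => h2.
  have fl : 0 <= y%:R * (sq R d)^-1 - sq R (x %/ d) <= 2^-1 * (sq R (x %/ d))^-1.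
    have qK := sqK R (x %/ d); have dK := sqK R d.
    have lo : sq R (x %/ d) * sq R d <= y%:R.
      rewrite -sx /sq -sqrtrM ?ler0n// ler_sqrt ?ler0n// -natrM ler_nat leq_trunc_div//.
    have hi : y%:R * y%:R <= d%:R * ((x %/ d)%:R + 1) :> R.
      by rewrite natr1 -!natrM ler_nat; have := ltn_ceil x d0; rewrite /x; nia.
    rewrite -qK -dK in hi.
    move: (sq R (x %/ d)) (sq R d) (y%:R : R) D0 Q0 yR lo hi => q s Y s0 q0' Y0 lo hi.
    have -> : Y / s - q = (Y - q * s) / s by field; exact: lt0r_neq0.
    apply/andP; split; first by rewrite divr_ge0 ?subr_ge0// ltW.
    rewrite ler_pdivrMr//.
    rewrite -mulrA ler_pdivlMl// ler_pdivlMl//.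
    nra.
  move: h1; rewrite ler_norml => /andP[h3 h4]; case/andP: fl => f1 f2.
  have -> : 4 * sq R d / y%:R = 2 * (2 * sq R d / y%:R) by ring.
  rewrite -mulrA; rewrite ler_norml; move: (sq R (x %/ d))^-1 h2 h3 h4 f2 => q' h2 h3 h4 f2.
  apply/andP; split; move: h2 h3 h4 f1 f2;
    move: (2 * sq R d / y%:R) (y%:R / sq R d) => *; lra.
lra.
Qed.

(** The squares n = k^2 alone contribute the harmonic sum up to y, which is at least ln y and
    contradicts [weighted_sum_bounded]. *)
Lemma no_vanishing_real_character : False.
Proof.
have [E HE] := weighted_sum_bounded.
have [y [y0 Ey]] := lnn_unbounded E.
suff : lnn R y <= \sum_(1 <= n < (y ^ 2).+1) (sq R n)^-1 * conv chi (fun=> 1) n.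
  by have := HE y y0; lra.
apply: le_trans (_ : _ <= \sum_(1 <= n < (y ^ 2).+1) (sq R n)^-1 * sqext (fun=> 1) n) _;
  last first.
  apply: ler_sum_nat => n /andP[n0 _]; apply: ler_wpM2l; first by rewrite invr_ge0 sq_ge0.
  exact: conv_real_char_ge.
apply: le_trans (_ : _ <= \sum_(1 <= k < y.+1) k%:R^-1) _.
  apply: le_trans (_ : _ <= \sum_(1 <= k < y) k%:R^-1) _; last first.
    by rewrite [X in _ <= X]big_nat_recr//= lerDl invr_ge0 ler0n.
  case: y {Ey} y0 => // z _; elim: z => [|z IH]; first by rewrite big_nil lnn1.
  rewrite big_nat_recr//= -lerBlDl; apply: le_trans (@lnn_diff R z.+1 isT).
  by rewrite lerD2l lerN2.
have -> : \sum_(1 <= n < (y ^ 2).+1) (sq R n)^-1 * sqext (fun=> 1) n =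
   \sum_(1 <= n < (y ^ 2).+1) \sum_(1 <= k < (y ^ 2).+1) (if (n == k ^ 2)%N then (sq R n)^-1 else 0).
  apply: eq_big_nat => n ny; rewrite /sqext mulr_sumr.
  rewrite [RHS](@big_cat_nat _ _ _ n.+1)//=; last by lia.
  rewrite [X in _ = _ + X]big_nat_cond [X in _ = _ + X]big1 ?addr0.
    rewrite big_mkcond; apply: eq_bigr => k _; rewrite eq_sym.
    by case: ifP; rewrite ?mulr1.
  by move=> k kd; rewrite ifN//; nia.
rewrite exchange_big [X in _ <= X](@big_cat_nat _ _ _ y.+1)//=; last by nia.
rewrite -[X in X <= _]addr0; apply: lerD; last first.
  by apply: sumr_ge0 => k _; apply: sumr_ge0 => n _; case: ifP => // _; rewrite invr_ge0 sq_ge0.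
apply: ler_sum_nat => k ky; rewrite -big_mkcond sum_eq_nat ifT; last by nia.
by rewrite /sq natrX sqrtr_sqr ger0_norm ?ler0n.
Qed.

End RealNonvanishing.

(** * Roots of unity and characters of finite abelian groups *)

Lemma closed_prim_root_exists (F : closedFieldType) n :
  n%:R != 0 :> F -> exists z : F, n.-primitive_root z.
Proof.
move=> nF; have n0 : (0 < n)%N by case: n nF => //; rewrite eqxx.
have [r rE] := closed_field_poly_normal ('X^n - 1 : {poly F}).
rewrite (monicP _) ?monicXnsubC// scale1r in rE.
have ur : uniq r by rewrite -separable_prod_XsubC -rE separable_Xn_sub_1.
have sr : (n <= size r)%N by have := size_prod_XsubC r id; rewrite -rE size_XnsubC// => -[->].
have rr : all n.-unity_root r.
  by apply/allP => z zr; rewrite /root_of_unity rE root_prod_XsubC.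
by have /hasP[z _ pz] := has_prim_root n0 rr ur sr; exists z.
Qed.

(** Some irreducible character is nontrivial at g, as the kernels meet trivially. It is linear, and
    its values are powers of a primitive n-th root of unity; taking exponents makes it independent
    of the field of values. *)
Lemma abelian_hom_separates (gT : finGroupType) n (g : gT) :
  abelian [set: gT] -> (1 < n)%N -> (#|[set: gT]| %| n)%N -> g != 1%g ->
  exists h : {ffun gT -> 'Z_n},
    (forall x y, h (x * y)%g = h x + h y) /\ h g != 0.
Proof.
move=> ab n1 cn g1; have n0 : (0 < n)%N by lia.
have [i gi] : exists i : Iirr [set: gT], g \notin cfker 'chi_i.
  apply/existsP; rewrite -negb_forall; apply: contra g1 => /forallP H.
  have : g \in \bigcap_i cfker 'chi[[set: gT]]_i by apply/bigcapP => i _; exact: H.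
  by rewrite TI_cfker_irr inE.
have lin := (char_abelianP _ ab) i.
have [z zp] := C_prim_root_exists n0.
have root x : 'chi_i x ^+ n = 1.
  have /dvdnP[q ->] := dvdn_trans (order_dvdG (finset.in_setT x)) cn.
  by rewrite mulnC exprM lin_char_unity_root// expr1n.
pose k x : 'I_n := sval (prim_rootP zp (root x)).
have kE x : 'chi_i x = z ^+ k x by rewrite /k; case: prim_rootP.
exists [ffun x => (k x)%:R]; split=> [x y|].
  rewrite !ffunE -natrD; apply: ord_inj; rewrite !val_Zp_nat//.
  apply/eqP; rewrite -(eq_prim_root_expr zp) exprD -!kE.
  by rewrite lin_charM ?finset.in_setT.
rewrite ffunE; apply: contra gi => /eqP/(congr1 (@nat_of_ord _)); rewrite val_Zp_nat//= => k0.
rewrite cfkerEirr inE lin_char1// kE -(prim_order_dvd zp).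
by rewrite /dvdn k0.
Qed.

(** * Prime powers that contribute O(1) to sums of Mertens type *)

Section PrimePowers.
Variable R : realType.

Lemma sum_inv_expn_le1 p x : (1 < p)%N -> \sum_(1 <= j < x.+1) ((p ^ j)%:R : R)^-1 <= 1.
Proof.
move=> p1.
suff : \sum_(1 <= j < x.+1) ((p ^ j)%:R : R)^-1 <= 1 - ((p ^ x)%:R)^-1.
  by move/le_trans; apply; rewrite gerBl invr_ge0 ler0n.
elim: x => [|x IH]; first by rewrite big_nil expn0 invr1 subrr.
rewrite big_nat_recr//=; apply: le_trans (lerD IH (lexx _)) _.
rewrite -addrA lerD2l expnS natrM invfM.
have : 0 <= ((p ^ x)%:R : R)^-1 by rewrite invr_ge0 ler0n.
have : (p%:R : R)^-1 <= 2^-1 by rewrite lef_pV2 ?posrE ?ltr0n ?ler_nat; lia.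
move: (p%:R^-1 : R) ((p ^ x)%:R^-1 : R) => a b; nra.
Qed.

(** A majorant: any k with nonzero [mangoldt] is some p^j, and j < p^j <= x keeps j in the range of
    summation. *)
Lemma sum_prime_powers (P : pred nat) (ps : seq nat) (Q : nat -> pred nat) x :
  {in ps, forall p, prime p} -> uniq ps ->
  (forall p j, prime p -> (0 < j)%N -> (p ^ j <= x)%N -> P (p ^ j)%N -> (p \in ps) && Q p j) ->
  \sum_(1 <= k < x.+1 | P k) mangoldt R k / k%:R <=
  \sum_(p <- ps) \sum_(1 <= j < x.+1 | Q p j) lnn R p / (p ^ j)%:R.
Proof.
move=> psp psu H.
apply: le_trans (_ : _ <= \sum_(1 <= k < x.+1) \sum_(p <- ps) \sum_(1 <= j < x.+1 | Q p j)
   (if k == (p ^ j)%N then lnn R p / (p ^ j)%:R else 0)) _; last first.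
  rewrite exchange_big [X in _ <= X]big_seq [X in X <= _]big_seq /=.
  apply: ler_sum => p pps; rewrite exchange_big; apply: ler_sum => j _.
  rewrite -big_mkcond sum_eq_nat; case: ifP => // _.
  by rewrite divr_ge0 ?lnn_ge0 ?ler0n.
have t0 p k j : 0 <= (if k == (p ^ j)%N then lnn R p / (p ^ j)%:R else 0).
  by case: ifP => // _; rewrite divr_ge0 ?lnn_ge0 ?ler0n.
have s0 k (s : seq nat) : 0 <= \sum_(p <- s) \sum_(1 <= j < x.+1 | Q p j)
   (if k == (p ^ j)%N then lnn R p / (p ^ j)%:R else 0).
  by apply: sumr_ge0 => p _; apply: sumr_ge0 => j _.
rewrite big_mkcond; apply: ler_sum_nat => k kx; case: ifP => Pk //.
have [e|/mangoldt_neq0[p [j [pp j0 kE]]]] := eqVneq (mangoldt R k) 0.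
  by rewrite e mul0r.
have /andP[pps Qpj] : (p \in ps) && Q p j by apply: H => //; rewrite -kE//; lia.
have jx : (j < x.+1)%N.
  by have := ltn_expl j (prime_gt1 pp); lia.
rewrite (bigD1_seq p)//= big_mkcond (bigD1_seq j) ?iota_uniq//=; last first.
  by rewrite mem_index_iota j0.
rewrite Qpj -kE eqxx kE mangoldtX// -addrA lerDl addr_ge0//.
  by apply: sumr_ge0 => i _; case: ifP.
by apply: sumr_ge0 => q _; apply: sumr_ge0.
Qed.

Lemma sum_mangoldt_noncoprime m : (0 < m)%N -> exists C : R, forall x,
  \sum_(1 <= k < x.+1 | ~~ coprime m k) mangoldt R k / k%:R <= C.
Proof.
move=> m0; exists (\sum_(p <- primes m) lnn R p) => x.
apply: le_trans (@sum_prime_powers _ (primes m) (fun _ _ => true) x _ (primes_uniq _) _) _.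
- by move=> p; rewrite mem_primes => /andP[].
- move=> p j pp j0 _; rewrite andbT mem_primes pp m0 /=; apply: contraR => pm.
  by rewrite coprime_sym coprimeXl// prime_coprime.
rewrite big_seq [X in _ <= X]big_seq; apply: ler_sum => p pm.
rewrite -mulr_sumr -[X in _ <= X]mulr1; apply: ler_wpM2l; first exact: lnn_ge0.
by apply: sum_inv_expn_le1; apply: prime_gt1; move: pm; rewrite mem_primes => /andP[].
Qed.

(** The powers p^j with j >= 2 contribute at most 2 ln p / p^2 <= 4 p^(-3/2), and 12 is 4 times the
    bound of [sum_inv_3half]. *)
Lemma sum_mangoldt_nonprime x :
  \sum_(1 <= k < x.+1 | ~~ prime k) mangoldt R k / k%:R <= 12.
Proof.
pose ps := [seq p <- index_iota 1 x.+1 | prime p].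
apply: le_trans (@sum_prime_powers _ ps (fun _ j => (1 < j)%N) x _ _ _) _.
- by move=> p; rewrite mem_filter => /andP[].
- by rewrite filter_uniq ?iota_uniq.
- move=> p j pp j0 px np; rewrite mem_filter pp mem_index_iota prime_gt0//=.
  have j1 : (1 < j)%N by case: j j0 np {px} => [|[|j]]//; rewrite expn1 pp.
  rewrite j1 andbT ltnS (leq_trans _ px)// -{1}(expn1 p) leq_exp2l ?prime_gt1//.
rewrite big_filter big_mkcond /=.
apply: le_trans (_ : _ <= \sum_(1 <= p < x.+1) 4 * (sq R p * p%:R)^-1) _; last first.
  by rewrite -mulr_sumr; have := sum_inv_3half R x; lra.
apply: ler_sum_nat => p /andP[p0 _].
have P0 : 0 < p%:R :> R by rewrite ltr0n.
have S0 := sq_gt0 R p0.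
case: ifP => pp; last first.
  by rewrite mulr_ge0 ?invr_ge0 ?mulr_ge0 ?sq_ge0 ?ler0n.
have p1 := prime_gt1 pp.
apply: le_trans (_ : _ <= lnn R p * (2 * (p%:R ^+ 2)^-1)) _.
  rewrite -mulr_sumr; apply: ler_wpM2l; first exact: lnn_ge0.
  case: x {ps} => [|x]; first by rewrite big_nil mulr_ge0 ?invr_ge0 ?exprn_ge0 ?ler0n.
  rewrite big_mkcond big_nat_recl//= add0r.
  rewrite [X in X <= _](_ : _ = (p%:R ^+ 2)^-1 * \sum_(0 <= j < x) ((p ^ j)%:R : R)^-1).
    rewrite mulrC; apply: ler_wpM2r; first by rewrite invr_ge0 exprn_ge0 ?ler0n.
    case: x => [|x]; first by rewrite big_nil.
    rewrite big_nat_recl//= expn0 invr1.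
    have := @sum_inv_expn_le1 p x p1; rewrite big_add1 /=; lra.
  rewrite big_add1 /= mulr_sumr; apply: eq_bigr => j _.
  by rewrite -invfM -natrX -natrM -expnD.
apply: le_trans (ler_wpM2r _ (lnn_le_sq R p0)) _.
  by rewrite mulr_ge0 ?invr_ge0 ?exprn_ge0 ?ler0n.
rewrite le_eqVlt; apply/orP; left; apply/eqP; rewrite expr2 -[p%:R]sqK.
by field; rewrite !lt0r_neq0.
Qed.

End PrimePowers.

(** * Rules for main terms in ln x *)

Section Asym.
Local Open Scope complex_scope.
Variable R : realType.
Local Notation K := R[i].

(** One-sided, so that a series whose coefficient is only known to be 0 or - 1 still enters a sum
    with the bound 0. *)
Definition ubd (s : nat -> K) (c : R) :=
  exists C : R, forall x, (0 < x)%N -> Re (s x) <= c * lnn R x + C.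

Lemma ReD (x y : K) : Re (x + y) = Re x + Re y. Proof. by case: x y => ??[]. Qed.
Lemma Re_realM (x y : R) : Re (x%:C * y%:C) = x * y. Proof. by rewrite /= mulr0 subr0. Qed.

Lemma asym_ubd s (c : R) : asym s c%:C -> ubd s c.
Proof.
move=> [C HC]; exists C => x x0; have := HC x x0.
move/(le_trans (nrm_Re _)); rewrite ReB Re_realM ler_norml => /andP[_]; lra.
Qed.

Lemma ubd_sum (I : Type) (r : seq I) (P : pred I) (s : I -> nat -> K) (c : I -> R) :
  (forall i, P i -> ubd (s i) (c i)) ->
  ubd (fun x => \sum_(i <- r | P i) s i x) (\sum_(i <- r | P i) c i).
Proof.
move=> H; elim: r => [|i r [C IH]].
  by exists 0 => x _; rewrite !big_nil mul0r addr0.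
have [Pi|Pi] := boolP (P i); last first.
  by exists C => x x0; rewrite !big_cons (negPf Pi); exact: IH.
have [D HD] := H i Pi; exists (D + C) => x x0; rewrite !big_cons Pi ReD mulrDl.
have := IH x x0; have := HD x x0; lra.
Qed.

Lemma ubd_ge0 s c : ubd s c -> (forall x, (0 < x)%N -> 0 <= Re (s x)) -> 0 <= c.
Proof.
move=> [C HC] H; rewrite leNgt; apply/negP => c0.
have [x [x0 lx]] := lnn_unbounded (C / - c).
have := H x x0; have := HC x x0; move: lx; rewrite ltr_pdivrMr; last by lra.
nra.
Qed.

Lemma asym_sum (I : Type) (r : seq I) (P : pred I) (s : I -> nat -> K) (c : I -> K) :
  (forall i, P i -> asym (s i) (c i)) ->
  asym (fun x => \sum_(i <- r | P i) s i x) (\sum_(i <- r | P i) c i).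
Proof.
move=> H; elim: r => [|i r [C IH]].
  by exists 0 => x _; rewrite !big_nil mul0r subrr nrm0.
have [Pi|Pi] := boolP (P i); last first.
  by exists C => x x0; rewrite !big_cons (negPf Pi); exact: IH.
have [D HD] := H i Pi; exists (D + C) => x x0; rewrite !big_cons Pi.
rewrite mulrDl opprD addrACA; apply: le_trans (nrmD _ _) _.
by apply: lerD; [exact: HD|exact: IH].
Qed.

Lemma asymZ (s : nat -> K) (c a : K) : asym s c -> asym (fun x => a * s x) (a * c).
Proof.
move=> [C HC]; exists (nrm a * C) => x x0.
by rewrite -mulrA -mulrBr nrmM; apply: ler_wpM2l; [exact: nrm_ge0|exact: HC].
Qed.

Lemma asymD (s t : nat -> K) (c d : K) : asym s c -> asym t d -> asym (fun x => s x + t x) (c + d).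
Proof.
move=> [C HC] [D HD]; exists (C + D) => x x0.
rewrite mulrDl opprD addrACA; apply: le_trans (nrmD _ _) _.
by apply: lerD; [exact: HC|exact: HD].
Qed.

Lemma asym_ext (s t : nat -> K) (c : K) :
  (forall x, (0 < x)%N -> s x = t x) -> asym s c -> asym t c.
Proof. by move=> st [C HC]; exists C => x x0; rewrite -st//; exact: HC. Qed.

Lemma asym_conj s (c : R) : asym s c%:C -> asym (fun x => (s x)^*) c%:C.
Proof.
move=> [C HC]; exists C => x x0; rewrite /lnK -(conjc_real c) -(conjc_real (lnn R x)).
by rewrite -rmorphM -rmorphB nrm_conj; exact: HC.
Qed.

Lemma conj_Lsum (f : nat -> K) x : (Lsum f x)^* = Lsum (fun n => (f n)^*) x.
Proof.
rewrite /Lsum rmorph_sum; apply: eq_bigr => n _.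
by rewrite rmorphM /= iv_real conjc_real.
Qed.

Lemma asym_bounded_le0 s (c : R) : asym s c%:C ->
  (exists C : R, forall x, (0 < x)%N -> nrm (s x) <= C) -> c <= 0.
Proof.
move=> [C HC] [D HD]; rewrite leNgt; apply/negP => c0.
have [x [x0 lx]] := lnn_unbounded ((C + D) / c).
have h1 := le_trans (nrm_Re _) (HC x x0); have h2 := le_trans (nrm_Re _) (HD x x0).
move: h1 h2 lx; rewrite ReB Re_realM !ler_norml ltr_pdivrMr// => /andP[h1 _] /andP[_ h2].
nra.
Qed.

End Asym.

(** * Characters modulo m *)

Section Characters.
Local Open Scope complex_scope.
Variables (R : realType) (m : nat).
Hypothesis m1 : (1 < m)%N.
Local Notation K := R[i].
Local Notation U := {unit 'Z_m}.

(* Characters mod m are written additively, as maps to 'Z_N read through a primitive N-th root of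
   unity. The factor 2 makes N even, so that the quadratic characters are available. *)
Definition char_order := (2 * #|[set: U]|)%N.
Local Notation N := char_order.
Local Notation X := {ffun U -> 'Z_N}.

Implicit Types (h g : X) (u v : U).

Lemma char_order_gt1 : (1 < N)%N.
Proof.
by rewrite /char_order; have := cardG_gt0 [set: U]%G; move: #|_| => c; case: c => [|c]//; lia.
Qed.
Let N1 := char_order_gt1.

Definition hom (h : X) := [forall x, forall y, h (x * y)%g == h x + h y].

Lemma homP h : reflect (forall x y, h (x * y)%g = h x + h y) (hom h).
Proof.
apply: (iffP forallP) => H x; first by move=> y; apply/eqP; exact: (forallP (H x)).
by apply/forallP => y; rewrite H.
Qed.

Lemma hom0 : hom 0.
Proof. by apply/homP => x y; rewrite !ffunE addr0. Qed.
Lemma homD (h1 h2 : X) : hom h1 -> hom h2 -> hom (h1 + h2).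
Proof. by move=> /homP H1 /homP H2; apply/homP => x y; rewrite !ffunE H1 H2 addrACA. Qed.
Lemma homN h : hom h -> hom (- h).
Proof. by move=> /homP H; apply/homP => x y; rewrite !ffunE H opprD. Qed.
Lemma hom1 h : hom h -> h 1%g = 0.
Proof. by move=> /homP H; apply: (addrI (h 1%g)); rewrite addr0 -H mulg1. Qed.

Lemma primroot_exists : exists z : K, N.-primitive_root z.
Proof. by apply: closed_prim_root_exists; rewrite pnatr_eq0; lia. Qed.
Definition zeta : K := sval (cid primroot_exists).
Lemma zetaP : N.-primitive_root zeta. Proof. exact: svalP (cid primroot_exists). Qed.

Definition ev (h : X) (u : U) : K := zeta ^+ (h u).

Lemma zetaD (a b : 'Z_N) : zeta ^+ (a + b)%R = zeta ^+ a * zeta ^+ b.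
Proof.
have -> : a + b = (a + b)%N%:R by rewrite natrD !natr_Zp.
by rewrite -exprD val_Zp_nat// (prim_expr_mod zetaP).
Qed.

Lemma zeta_eq1 (a : 'Z_N) : (zeta ^+ a == 1) = (a == 0).
Proof.
rewrite -(prim_order_dvd zetaP) /dvdn modn_small//.
by rewrite -[X in (_ < X)%N](Zp_cast N1) ltn_ord.
Qed.

Lemma nrm_zeta : nrm zeta = 1.
Proof.
have := congr1 (@nrm R) (prim_expr_order zetaP); rewrite nrmX nrm1 => /eqP.
by rewrite pexpr_eq1 ?nrm_ge0 ?(ltnW N1)// => /eqP.
Qed.

Lemma nrm_ev h u : nrm (ev h u) = 1.
Proof. by rewrite nrmX nrm_zeta expr1n. Qed.

Lemma evM h u v : hom h -> ev h (u * v)%g = ev h u * ev h v.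
Proof. by move/homP=> H; rewrite /ev H zetaD. Qed.
Lemma ev1 h : hom h -> ev h 1%g = 1.
Proof. by move/hom1; rewrite /ev => ->. Qed.
Lemma evD (h1 h2 : X) u : ev (h1 + h2) u = ev h1 u * ev h2 u.
Proof. by rewrite /ev ffunE zetaD. Qed.
Lemma ev_conj h u : (ev h u)^* = ev (- h) u.
Proof.
have e : ev h u * ev (- h) u = 1 by rewrite -evD subrr /ev ffunE.
have e' : ev h u * (ev h u)^* = 1 by rewrite -sqr_normc -nrmE nrm_ev expr1n.
have n0 : ev h u != 0.
  by apply/eqP => n0; move/eqP: e; rewrite n0 mul0r eq_sym oner_eq0.
by apply: (mulfI n0); rewrite e e'.
Qed.

Lemma sum_ev_hom u : \sum_(h | hom h) ev h u = if u == 1%g then #|hom|%:R else 0.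
Proof.
case: eqP => [->|/eqP u1].
  by rewrite (eq_bigr (fun=> 1)) ?sumr_const// => h Hh; rewrite ev1.
have ab : abelian [set: U] by apply: units_Zp_abelian.
have [h0 [Hh0 h0u]] := abelian_hom_separates ab N1 (dvdn_mull 2 (dvdnn _)) u1.
have hh0 : hom h0 by apply/homP.
set S := \sum_(h | _) _.
have e : S = ev h0 u * S.
  rewrite /S mulr_sumr (reindex_inj (addrI h0)) /=; apply: eq_big => h.
    apply/idP/idP => [Hh|Hh]; last exact: homD.
    by rewrite -[h](addKr h0) homD// homN.
  by rewrite evD.
have : (1 - ev h0 u) * S = 0 by rewrite mulrBl mul1r -e subrr.
move/eqP; rewrite mulf_eq0 subr_eq0 eq_sym zeta_eq1 (negPf h0u) /=.
by move/eqP.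
Qed.

(** At k not coprime to m the value is the default 1, which [chi] masks by 0. *)
Definition toU k : U := insubd (1%g : U) (k%:R : 'Z_m).

Lemma val_toU k : coprime m k -> val (toU k) = k%:R.
Proof. by move=> mk; rewrite insubdK// -topredE /= unitZpE. Qed.

Lemma toUM k l : coprime m k -> coprime m l -> toU (k * l) = (toU k * toU l)%g.
Proof.
move=> mk ml; apply: val_inj; rewrite FinRing.val_unitM !val_toU ?natrM//.
by rewrite coprimeMr mk.
Qed.

Lemma toU_eq k l : coprime m k -> coprime m l ->
  (toU k == toU l) = (k == l %[mod m]).
Proof.
move=> mk ml; rewrite -val_eqE !val_toU//.
by rewrite -(inj_eq (@ord_inj _)) !val_Zp_nat.
Qed.

Lemma toU_surj u : exists2 k, coprime m k & u = toU k.
Proof.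
have e : (val u : nat)%:R = val u by rewrite natr_Zp.
have c : coprime m (val u : nat) by rewrite -unitZpE// e (valP u).
by exists (val u : nat) => //; apply: val_inj; rewrite val_toU.
Qed.

Definition chi (h : X) k : K := if coprime m k then ev h (toU k) else 0.

Lemma chiM h k l : hom h -> chi h (k * l) = chi h k * chi h l.
Proof.
move=> hh; rewrite /chi coprimeMr; case mk: (coprime m k) => /=; last by rewrite mul0r.
by case ml: (coprime m l); rewrite ?mulr0// toUM// evM.
Qed.

Lemma chi_cmul h : hom h -> cmul (chi h).
Proof.
move=> hh; split=> [|k l _ _]; last exact: chiM.
rewrite /chi coprimen1 (_ : toU 1 = 1%g) ?ev1//.
by apply: val_inj; rewrite val_toU ?coprimen1.
Qed.

Lemma nrm_chi h k : nrm (chi h k) <= 1.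
Proof. by rewrite /chi; case: ifP => _; rewrite ?nrm_ev ?nrm0. Qed.

Lemma chi_mod h k : chi h (k %% m) = chi h k.
Proof.
rewrite /chi coprime_modr; case: ifP => // mk; congr (ev h _).
by apply/eqP; rewrite toU_eq ?coprime_modr// modn_mod.
Qed.

Lemma chi_conj h k : (chi h k)^* = chi (- h) k.
Proof. by rewrite /chi; case: ifP => _; rewrite ?ev_conj ?conjc0. Qed.

Lemma chiD (h1 h2 : X) k : chi (h1 + h2) k = chi h1 k * chi h2 k.
Proof. by rewrite /chi; case: ifP => _; rewrite ?evD ?mulr0. Qed.

Lemma chi_orth c k : coprime m c ->
  \sum_(h | hom h) (chi h c)^* * chi h k = if k == c %[mod m] then #|hom|%:R else 0.
Proof.
move=> mc; have [mk|mk] := boolP (coprime m k); last first.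
  rewrite big1; last by move=> h _; rewrite /chi (negPf mk) mulr0.
  case: eqP => // e; move: mk; rewrite -coprime_modr e coprime_modr.
  by rewrite mc.
transitivity (\sum_(h | hom h) ev h ((toU c)^-1 * toU k)%g).
  apply: eq_bigr => h hh; rewrite /chi mc mk evM//; congr (_ * _).
  have : ev h (toU c) * ev h (toU c)^-1%g = ev h (toU c) * (ev h (toU c))^*.
    by rewrite -evM// mulgV ev1// -sqr_normc -nrmE nrm_ev expr1n.
  move/mulfI => ->//; apply/eqP => e0; have := nrm_ev h (toU c).
  by rewrite e0 nrm0 => /eqP; rewrite eq_sym oner_eq0.
rewrite sum_ev_hom -(toU_eq mk mc); congr (if _ then _ else _).
by rewrite -eq_mulVg1 eq_sym.
Qed.

Lemma sum_chi_period h : hom h -> h != 0 -> \sum_(0 <= k < m) chi h k = 0.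
Proof.
move=> hh h0.
have [u0 hu0] : exists u, h u != 0.
  apply/existsP; rewrite -negb_forall; apply: contra h0 => /forallP H.
  by apply/eqP/ffunP => u; rewrite ffunE; apply/eqP.
have [k0 mk0 u0E] := toU_surj u0.
have -> : \sum_(0 <= k < m) chi h k = \sum_(k : 'Z_m) chi h k.
  by rewrite -{1}(Zp_cast m1) big_mkord.
set S := \sum_k _.
have e : S = chi h k0 * S.
  have iu : injective (fun k : 'Z_m => k0%:R * k) by apply: mulrI; rewrite unitZpE.
  rewrite /S mulr_sumr (reindex_inj iu); apply: eq_bigr => k _.
  have vE : nat_of_ord (k0%:R * k : 'Z_m) = (k0 * k %% m)%N.
    by rewrite -[k in LHS]natr_Zp -natrM val_Zp_nat.
  by rewrite -chiM// -[in RHS]chi_mod -vE.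
have : (1 - chi h k0) * S = 0 by rewrite mulrBl mul1r -e subrr.
move/eqP; rewrite mulf_eq0 subr_eq0 eq_sym /chi mk0 zeta_eq1 -u0E (negPf hu0) /=.
by move/eqP.
Qed.

Lemma sum_chi_le h x : hom h -> h != 0 -> nrm (\sum_(1 <= k < x.+1) chi h k) <= m%:R.
Proof.
move=> hh h0.
have chi0 : chi h 0 = 0.
  by rewrite /chi /coprime gcdn0 (_ : m == 1%N = false)//; lia.
have -> : \sum_(1 <= k < x.+1) chi h k = \sum_(0 <= k < x.+1) chi h k.
  by rewrite [RHS]big_nat_recl// chi0 add0r big_add1.
have period q : \sum_(0 <= k < q * m) chi h k = 0.
  elim: q => [|q IH]; first by rewrite big_nil.
  rewrite mulSn addnC (@big_cat_nat _ _ _ (q * m))//= ?leq_addr// IH add0r.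
  rewrite -{1}[(q * m)%N]add0n big_addn addKn -[RHS](sum_chi_period hh h0).
  by apply: eq_bigr => k _; rewrite -chi_mod addnC modnMDl chi_mod.
rewrite {1}(divn_eq x.+1 m) (@big_cat_nat _ _ _ (x.+1 %/ m * m))//= ?leq_addr//.
rewrite period add0r; apply: le_trans (nrm_sum _ _ _) _.
apply: le_trans (ler_sum _ (fun k _ => nrm_chi h k)) _.
by rewrite sumr_const_nat addKn ler_nat ltnW// ltn_mod; lia.
Qed.

Definition Ssum h := Lsum (fun k => chi h k * mangK R k).

Lemma asym_Ssum0 : asym (Ssum 0) 1.
Proof.
have [C HC] := sum_mangoldt_noncoprime R (ltnW m1).
exists (C + 1 + 4 * lnn R 2) => x x0.
have e : Ssum 0 x = (\sum_(1 <= d < x.+1) mangoldt R d / d%:R)%:C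
    - (\sum_(1 <= k < x.+1 | ~~ coprime m k) mangoldt R k / k%:R)%:C.
  rewrite [X in _ = X%:C - _](bigID (coprime m)) /= rmorphD /= addrK.
  rewrite /Ssum /Lsum rmorph_sum /= [RHS]big_mkcond; apply: eq_bigr => k _.
  rewrite /chi; case: ifP => _; last by rewrite mul0r mulr0.
  by rewrite /ev ffunE expr0 mul1r iv_real rmorphM /= mulrC.
rewrite e mul1r addrAC; apply: le_trans (nrmB _ _) _.
rewrite -rmorphB !nrm_real.
have s0 : 0 <= \sum_(1 <= k < x.+1 | ~~ coprime m k) mangoldt R k / k%:R.
  by apply: sumr_ge0 => k _; rewrite divr_ge0 ?mangoldt_ge0 ?ler0n.
rewrite (ger0_norm s0).
have /andP[h1 h2] := mertens R x0; have h3 := HC x.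
have h4 : `|\sum_(1 <= d < x.+1) mangoldt R d / d%:R - lnn R x| <= 1 + 4 * lnn R 2.
  have l2 := lnn_ge0 R 2; rewrite ler_norml.
  set T := \sum_(1 <= d < x.+1) _ in h1 h2 *.
  by apply/andP; split; lra.
by apply: le_trans (lerD h4 h3) _; lra.
Qed.

Lemma delta_cmul : cmul (delta K).
Proof.
split=> // a b a0 b0; rewrite /delta muln_eq1.
by case: (a == 1)%N (b == 1)%N => [] []; rewrite ?mulr1 ?mulr0.
Qed.

(** Degree one is treated as degree two with second factor [delta], whose Dirichlet series is 1.
    This adds nothing to the sum, since [mangoldt] vanishes at 1. *)
Lemma chi_dichotomy h : hom h -> h != 0 ->
  asym (Ssum h) 0 \/ asym (Ssum h) (-1) /\
  exists D : R, forall x, (0 < x)%N -> nrm (Lsum (chi h) x) <= D * (sq R x)^-1.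
Proof.
move=> hh h0; have cc := chi_cmul hh.
have fE n : (0 < n)%N -> conv (chi h) (delta K) n = chi h n by exact: conv_delta.
have sE x : \sum_(1 <= k < x.+1) conv (chi h) (delta K) k = \sum_(1 <= k < x.+1) chi h k.
  by apply: eq_big_nat => k /andP[k0 _]; exact: fE.
have [L HL] : exists L, forall x, (0 < x)%N ->
    nrm (Lsum (conv (chi h) (delta K)) x - L) <= 8 * m%:R * (sq R x)^-1.
  apply: Lsum_limit => x x0; rewrite sE; apply: le_trans (sum_chi_le _ hh h0) _.
  by rewrite -{1}[m%:R]mulr1; apply: ler_wpM2l; rewrite ?ler0n// sq_ge1.
have C0 : 0 <= 8 * m%:R :> R by rewrite mulr_ge0 ?ler0n.
have A1 n : (0 < n)%N -> nrm (chi h n) <= 1 by move=> _; exact: nrm_chi.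
have B1 n : (0 < n)%N -> nrm (delta K n) <= 1.
  by move=> _; rewrite /delta; case: eqP; rewrite ?nrm1 ?nrm0.
have fabs x : (0 < x)%N -> \sum_(1 <= k < x.+1) nrm (conv (chi h) (delta K) k) <= 8 * m%:R * x%:R.
  move=> x0; apply: le_trans (_ : _ <= \sum_(1 <= k < x.+1) 1) _.
    by apply: ler_sum_nat => k /andP[k0 _]; rewrite fE// nrm_chi.
  by rewrite sumr_const_nat subn1 /= -!natrM ler_nat; nia.
have vE x : (0 < x)%N -> Lsum (fun n => (chi h n + delta K n) * mangK R n) x = Ssum h x.
  move=> x0; apply: eq_bigr => n _; congr (_ * _); rewrite mulrDl /delta.
  case: (n =P 1%N) => [->|_]; last by rewrite mul0r addr0.
  by rewrite (_ : mangK R 1 = 0) ?mulr0 ?addr0.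
have [L0|L0] := eqVneq L 0.
  right; split; first by apply: asym_ext vE _; exact: (vanishing_asym cc delta_cmul A1 B1 C0 fabs HL L0).
  exists (8 * m%:R) => x x0; have := HL x x0; rewrite L0 subr0.
  rewrite (_ : Lsum (conv (chi h) (delta K)) x = Lsum (chi h) x)//.
  by apply: eq_big_nat => k /andP[k0 _]; rewrite fE.
by left; apply: asym_ext vE _; exact: (nonvanishing_asym cc delta_cmul A1 B1 C0 HL L0).
Qed.

(** If the series vanishes for h, conjugation makes it vanish for - h. When these differ, the sum of
    [Ssum] over all characters has main term at most (1 - 2) ln x, although orthogonality turns it
    into a sum of nonnegative terms. When they agree, [no_vanishing_real_character] applies. *)
Lemma asym_Ssum h : hom h -> h != 0 -> asym (Ssum h) 0.
Proof.
move=> hh h0; have [//|[Sh [D HD]]] := chi_dichotomy hh h0.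
have SNh : asym (Ssum (- h)) (-1).
  have S1 : asym (Ssum h) (-1)%:C by rewrite rmorphN1.
  have := asym_conj S1; rewrite rmorphN1; apply: asym_ext => x x0.
  rewrite conj_Lsum; apply: eq_bigr => n _; congr (_ * _).
  by rewrite rmorphM; congr (_ * _); [exact: chi_conj|exact: conjc_real].
have [hr|hr] := eqVneq (- h) h; exfalso.
  have real k : (Re (chi h k))%:C = chi h k.
    have := chi_conj h k; rewrite hr; case: (chi h k) => a b /= [] e.
    by rewrite (_ : b = 0)//; lra.
  apply: (@no_vanishing_real_character R (fun k => Re (chi h k)) m%:R D).
  - have [c1 cM] := chi_cmul hh; split; first by rewrite c1.
    by move=> a b a0 b0; apply: complexI; rewrite rmorphM /= !real cM.
  - move=> p pp; have := real p; rewrite /chi; case: ifP => _; last by constructor 1.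
    have := nrm_ev h (toU p); case: (ev h (toU p)) => a b /= + [] b0.
    rewrite -b0 -/(a%:C) nrm_real => a1.
    have [a0|a0] := lerP 0 a; first by constructor 2; rewrite /= -a1 ger0_norm.
    by constructor 3; rewrite /= -a1 ltr0_norm// opprK.
  - by move=> n; exact: le_trans (nrm_Re _) (nrm_chi _ _).
  - move=> x; rewrite -nrm_real rmorph_sum /=; under eq_bigr do rewrite real.
    exact: sum_chi_le.
  - move=> x x0; rewrite -nrm_real rmorph_sum /=; apply: le_trans (HD x x0).
    rewrite le_eqVlt; apply/orP; left; apply/eqP; congr nrm; apply: eq_bigr => k _.
    by rewrite rmorphM /= real iv_real mulrC.
pose c (g : X) : R := if g == 0 then 1 else if (g == h) || (g == - h) then -1 else 0.
have cs : \sum_(g | hom g) c g = -1.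
  have Nh0 : - h != 0 by rewrite oppr_eq0.
  rewrite (bigD1 (0 : X)) ?hom0//= (bigD1 h) ?hh ?h0//= (bigD1 (- h)) ?homN ?Nh0 ?hr//=.
  rewrite big1 ?addr0; first by rewrite /c !eqxx (negPf h0) (negPf Nh0) /= orbT; ring.
  by move=> g /andP[/andP[/andP[_ g0] gh] gNh]; rewrite /c (negPf g0) (negPf gh) (negPf gNh).
have U : ubd (fun x => \sum_(g | hom g) Ssum g x) (\sum_(g | hom g) c g).
  apply: ubd_sum => g hg; rewrite /c; case: eqP => [->|/eqP g0].
    by apply: asym_ubd; exact: asym_Ssum0.
  case: ifP => [/orP[/eqP ->|/eqP ->]|_].
  - by apply: asym_ubd; rewrite rmorphN1.
  - by apply: asym_ubd; rewrite rmorphN1.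
  have [Sg|[Sg _]] := chi_dichotomy hg g0; first by apply: asym_ubd.
  have : ubd (Ssum g) (-1) by apply: asym_ubd; rewrite rmorphN1.
  by case=> C HC; exists C => x x0; have := HC x x0; have := lnn_ge0 R x; lra.
rewrite cs in U; have := ubd_ge0 U; suff H : forall x, (0 < x)%N -> 0 <= Re (\sum_(g | hom g) Ssum g x).
  by move/(_ H); lra.
move=> x x0; rewrite exchange_big /=.
rewrite (eq_bigr (fun k => ((k == 1 %[mod m])%N%:R * #|hom|%:R * (mangoldt R k / k%:R))%:C)).
  rewrite -rmorph_sum /=; apply: sumr_ge0 => k _.
  by rewrite !mulr_ge0 ?ler0n// ?mangoldt_ge0// invr_ge0 ler0n.
move=> k _; rewrite -mulr_sumr -mulr_suml.
have -> : \sum_(h0 | hom h0) chi h0 k = if k == 1 %[mod m] then #|hom|%:R else 0.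
  rewrite -(chi_orth k (coprimen1 m)); apply: eq_bigr => g hg.
  by rewrite (chi_cmul hg).1 rmorph1 mul1r.
rewrite iv_real /mangK; case: ifP => _; last by rewrite !mul0r mulr0.
by rewrite !rmorphM !rmorph_nat mul1r [LHS]mulrC -mulrA.
Qed.

End Characters.

(** * Gaussian integers and the quartic Jacobi sum *)

Record gi := GI { gre : int; gim : int }.

Definition gi_pair (x : gi) := (gre x, gim x).
Definition pair_gi (x : int * int) := GI x.1 x.2.
Lemma gi_pairK : cancel gi_pair pair_gi. Proof. by case. Qed.
HB.instance Definition _ := Equality.copy gi (can_type gi_pairK).
HB.instance Definition _ := Choice.copy gi (can_type gi_pairK).

Definition addgi x y := GI (gre x + gre y) (gim x + gim y).
Definition oppgi x := GI (- gre x) (- gim x).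
Definition mulgi x y := GI (gre x * gre y - gim x * gim y) (gre x * gim y + gim x * gre y).

Lemma giP x y : gre x = gre y -> gim x = gim y -> x = y.
Proof. by case: x y => ??[]?? /= -> ->. Qed.

Lemma addgiA : associative addgi. Proof. by move=> ? ? ?; apply: giP => /=; ring. Qed.
Lemma addgiC : commutative addgi. Proof. by move=> ? ?; apply: giP => /=; ring. Qed.
Lemma add0gi : left_id (GI 0 0) addgi. Proof. by move=> ?; apply: giP => /=; ring. Qed.
Lemma addNgi : left_inverse (GI 0 0) oppgi addgi. Proof. by move=> ?; apply: giP => /=; ring. Qed.
HB.instance Definition _ := GRing.isZmodule.Build gi addgiA addgiC add0gi addNgi.

Lemma mulgiA : associative mulgi. Proof. by move=> ? ? ?; apply: giP => /=; ring. Qed.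
Lemma mulgiC : commutative mulgi. Proof. by move=> ? ?; apply: giP => /=; ring. Qed.
Lemma mul1gi : left_id (GI 1 0) mulgi. Proof. by move=> ?; apply: giP => /=; ring. Qed.
Lemma mulgiDl : left_distributive mulgi addgi. Proof. by move=> ? ? ?; apply: giP => /=; ring. Qed.
Lemma gi1_neq0 : GI 1 0 != 0 :> gi. Proof. by []. Qed.
HB.instance Definition _ := GRing.Zmodule_isComNzRing.Build gi mulgiA mulgiC mul1gi mulgiDl gi1_neq0.

Definition conjgi x := GI (gre x) (- gim x).
Lemma conjgi_additive : {morph conjgi : x y / x - y}.
Proof. by move=> x y; apply: giP => /=; ring. Qed.
Lemma conjgi_mult : GRing.monoid_morphism conjgi.
Proof. by split; [exact: giP|move=> x y; apply: giP => /=; ring]. Qed.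
HB.instance Definition _ := GRing.isZmodMorphism.Build gi gi conjgi conjgi_additive.
HB.instance Definition _ := GRing.isMonoidMorphism.Build gi gi conjgi conjgi_mult.

Definition ig : gi := GI 0 1.
Lemma ig2 : ig ^+ 2 = -1. Proof. by []. Qed.
Lemma ig4 : ig ^+ 4 = 1. Proof. by []. Qed.

Lemma gre_nat n : gre n%:R = n%:R.
Proof. by elim: n => // n IH; rewrite -!natr1 /= IH. Qed.
Lemma gim_nat n : gim n%:R = 0.
Proof. by elim: n => // n IH; rewrite -natr1 /= IH. Qed.
Lemma greD x y : gre (x + y) = gre x + gre y. Proof. by []. Qed.
Lemma gimD x y : gim (x + y) = gim x + gim y. Proof. by []. Qed.
Lemma greM x y : gre (x * y) = gre x * gre y - gim x * gim y. Proof. by []. Qed.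
Lemma gimM x y : gim (x * y) = gre x * gim y + gim x * gre y. Proof. by []. Qed.

Lemma gi_torsion_free (n : nat) (x : gi) : n%:R * x = 0 -> (0 < n)%N -> x = 0.
Proof.
move=> e n0; have := congr1 gre e; have := congr1 gim e.
rewrite greM gimM gre_nat gim_nat !mul0r subr0 addr0 => /eqP e1 /eqP e2.
by apply: giP; apply/eqP; move: e1 e2; rewrite !mulf_eq0 pnatr_eq0 eqn0Ngt n0.
Qed.

Section InvariantSums.
Variables (T : finType) (R : comNzRingType) (phi : T -> R) (s : T -> T).
Hypothesis phis : forall x, phi (s x) = phi x.

(** Every orbit other than {a} has two elements and is represented by the one that comes first in
    the enumeration of T. The next lemma treats orbits of three elements alike. *)
Lemma sum_involution a : involutive s -> (forall x, (s x == x) = (x == a)) ->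
  exists y, \sum_x phi x = phi a + 2%:R * y.
Proof.
move=> sK sa.
pose mn x := (enum_rank x < enum_rank (s x))%N.
exists (\sum_(x | mn x) phi x).
rewrite (bigD1 a)//=; congr (_ + _).
rewrite mulr_natl mulr2n.
rewrite [X in _ = _ + X](reindex_inj (inv_inj sK)) /=.
under [X in _ = _ + X]eq_bigr do rewrite phis.
rewrite [X in _ = X + _]big_mkcond [X in _ = _ + X]big_mkcond -big_split /= big_mkcond.
apply: eq_bigr => x _; rewrite /mn sK.
have [->|xa] := eqVneq x a.
  have /eqP -> : s a == a by rewrite sa.
  by rewrite ltnn addr0.
have : (enum_rank x : nat) != enum_rank (s x).
  by apply: contra xa => /eqP/ord_inj/enum_rank_inj e; rewrite -sa -e.
by case: ltngtP => //; rewrite ?addr0 ?add0r.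
Qed.

Lemma sum_order3 a : (forall x, s (s (s x)) = x) -> (forall x, (s x == x) = (x == a)) ->
  exists y, \sum_x phi x = phi a + 3%:R * y.
Proof.
move=> sK sa.
pose rk (x : T) : nat := enum_rank x.
pose mn x := (rk x < rk (s x))%N && (rk x < rk (s (s x)))%N.
have si : injective s by apply: (can_inj (g := fun x => s (s x))) => x; exact: sK.
exists (\sum_(x | mn x) phi x).
rewrite (bigD1 a)//=; congr (_ + _).
have h1 : \sum_(x | mn x) phi x = \sum_(x | mn (s x)) phi x.
  by rewrite (reindex_inj si); apply: eq_bigr => x _.
have h2 : \sum_(x | mn x) phi x = \sum_(x | mn (s (s x))) phi x.
  by rewrite h1 (reindex_inj si); apply: eq_bigr => x _.
rewrite mulr_natl 2!mulrS {2}h1 {2}h2 [LHS]big_mkcond.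
rewrite [X in _ = X + _]big_mkcond [X in _ = _ + (X + _)]big_mkcond [X in _ = _ + (_ + X)]big_mkcond.
rewrite -!big_split /=.
apply: eq_bigr => x _; rewrite /mn !sK.
have [->|xa] := eqVneq x a.
  have /eqP e : s a == a by rewrite sa.
  by rewrite !e ltnn !addr0.
have ne y : y != a -> rk y <> rk (s y).
  move=> ya /ord_inj/enum_rank_inj e; case/negP: ya; rewrite -sa; apply/eqP.
  exact: esym.
have nsa y : y != a -> s y != a.
  by move=> ya; rewrite -(sa (s y)) (inj_eq si) sa.
have n1 := ne _ xa; have n2 := ne _ (nsa _ xa); have n3 := ne _ (nsa _ (nsa _ xa)).
rewrite sK in n3.
move: (rk x) (rk (s x)) (rk (s (s x))) n1 n2 n3 => i j k n1 n2 n3.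
by do ![case: ifP => ?]; rewrite /= ?addr0 ?add0r//; lia.
Qed.

End InvariantSums.

Section JacobiSum.
Variable p : nat.
Hypotheses (pp : prime p) (p4 : (p %% 4 = 1)%N).
Local Notation F := 'F_p.

Lemma Fp_fermat (x : F) : x != 0 -> x ^+ p.-1 = 1.
Proof.
move=> x0; apply: (mulfI x0); rewrite -exprS (prednK (prime_gt0 pp)) mulr1.
by have := expf_card x; rewrite card_Fp.
Qed.

Lemma primitive_root_Fp : exists g : F, p.-1.-primitive_root g.
Proof.
have cF := card_Fp pp.
have p0 : (0 < p.-1)%N by have := prime_gt1 pp; lia.
pose rs := [seq x <- enum F | x != 0].
have r1 : all p.-1.-unity_root rs.
  apply/allP => x; rewrite mem_filter => /andP[x0 _].
  by rewrite unity_rootE Fp_fermat.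
have sz : (p.-1 <= size rs)%N.
  have -> : size rs = #|predC1 (0 : F)|.
    by rewrite cardE /enum_mem size_filter /rs size_filter enumT; apply: eq_count => x.
  by rewrite cardC1 cF.
have ur : uniq rs by rewrite filter_uniq ?enum_uniq.
by have /hasP[g _ gp] := has_prim_root p0 r1 ur sz; exists g.
Qed.

Variable g : F.
Hypothesis gp : p.-1.-primitive_root g.

Definition dlog (x : F) : nat := if [pick k : 'I_p.-1 | x == g ^+ k] is Some k then k else 0%N.
(** The quartic character of F_p that sends g to i; [rho] below is its square, the quadratic
    character. *)
Definition ch (x : F) : gi := if x == 0 then 0 else ig ^+ dlog x.

Let g0 : g != 0.
Proof.
apply/eqP => g0; have := prim_expr_order gp; rewrite g0 expr0n.
by have := prime_gt1 pp; case: (p.-1) (prim_order_gt0 gp).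
Qed.

Lemma dlogP x : x != 0 -> x = g ^+ dlog x.
Proof.
move=> x0; have [k kE] := prim_rootP gp (Fp_fermat x0).
by rewrite /dlog; case: pickP => [j /eqP//|/(_ k)]; rewrite -kE eqxx.
Qed.

Let d4 : (4 %| p.-1)%N.
Proof. by have := prime_gt1 pp; lia. Qed.

Lemma ch_exp k : ch (g ^+ k) = ig ^+ k.
Proof.
have gk0 : g ^+ k != 0 by rewrite expf_neq0.
rewrite /ch (negPf gk0); have /eqP := dlogP gk0.
rewrite (eq_prim_root_expr gp) => /eqP e.
rewrite -(expr_mod _ ig4) -[RHS](expr_mod _ ig4); congr (_ ^+ _).
by rewrite -(modn_dvdm _ d4) -e modn_dvdm.
Qed.

Lemma ch0 : ch 0 = 0. Proof. by rewrite /ch eqxx. Qed.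
Lemma ch1 : ch 1 = 1. Proof. by rewrite -(expr0 g) ch_exp. Qed.
Lemma chM x y : ch (x * y) = ch x * ch y.
Proof.
have [->|x0] := eqVneq x 0; first by rewrite mul0r ch0 mul0r.
have [->|y0] := eqVneq y 0; first by rewrite mulr0 ch0 mulr0.
by rewrite (dlogP x0) (dlogP y0) -exprD !ch_exp exprD.
Qed.
Lemma chX x k : ch (x ^+ k) = ch x ^+ k.
Proof. by elim: k => [|k IH]; rewrite ?expr0 ?ch1// !exprS chM IH. Qed.
Lemma ch4 x : x != 0 -> ch x ^+ 4 = 1.
Proof. by move=> x0; rewrite (dlogP x0) ch_exp -exprM mulnC exprM ig4 expr1n. Qed.
Lemma ch_conj x : x != 0 -> conjgi (ch x) = ch x^-1.
Proof.
move=> x0.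
have e : ch x * ch x^-1 = 1 by rewrite -chM mulfV// ch1.
have e' : conjgi (ch x) * ch x = 1.
  rewrite (dlogP x0) ch_exp rmorphXn -exprMn (_ : conjgi ig * ig = 1) ?expr1n//.
by rewrite -[LHS]mulr1 -e mulrA e' mul1r.
Qed.

Definition rho x : gi := ch x ^+ 2.
Lemma rhoM x y : rho (x * y) = rho x * rho y. Proof. by rewrite /rho chM exprMn. Qed.
Lemma rho0 : rho 0 = 0. Proof. by rewrite /rho ch0 expr0n. Qed.
Lemma rho1 : rho 1 = 1. Proof. by rewrite /rho ch1 expr1n. Qed.
Lemma rho_sq x : x != 0 -> rho x * rho x = 1.
Proof. by move=> x0; rewrite /rho -exprD ch4. Qed.
Lemma rho_inv x : rho x^-1 = rho x.
Proof.
have [->|x0] := eqVneq x 0; first by rewrite invr0.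
have e : rho x * rho x^-1 = 1 by rewrite -rhoM mulfV// rho1.
by rewrite -[LHS]mul1r -(rho_sq x0) -mulrA e mulr1.
Qed.
Lemma rho_pm x : x != 0 -> rho x = 1 \/ rho x = -1.
Proof.
move=> x0; rewrite (dlogP x0) /rho ch_exp -exprM mulnC exprM ig2 -signr_odd.
by case: odd; rewrite ?expr0 ?expr1; [right|left].
Qed.
Lemma rho_conj x : conjgi (rho x) = rho x.
Proof.
have [->|x0] := eqVneq x 0; first by rewrite rho0 rmorph0.
by rewrite -[in RHS]rho_inv /rho -ch_conj// rmorphXn.
Qed.

Lemma sum_ch : \sum_x ch x = 0.
Proof.
have e : \sum_x ch x = ig * \sum_x ch x.
  rewrite mulr_sumr [LHS](reindex_inj (mulfI g0)); apply: eq_bigr => x _ /=.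
  by rewrite chM -{1}(expr1 g) ch_exp.
apply: (@gi_torsion_free 2) => //; rewrite mulr_natl mulr2n.
have : (1 - ig) * \sum_x ch x = 0 by rewrite mulrBl mul1r -e subrr.
move/(congr1 (fun y => (1 + ig) * y)); rewrite mulr0 mulrA.
by rewrite (_ : (1 + ig) * (1 - ig) = 2%:R) // mulr_natl mulr2n.
Qed.

Lemma sum_rho : \sum_x rho x = 0.
Proof.
have e : \sum_x rho x = - \sum_x rho x.
  rewrite -mulN1r mulr_sumr [LHS](reindex_inj (mulfI g0)); apply: eq_bigr => x _ /=.
  by rewrite rhoM /rho -{1}(expr1 g) ch_exp expr1 ig2.
by apply: (@gi_torsion_free 2) => //; rewrite mulr_natl mulr2n {1}e addNr.
Qed.

Let two0 : 2%:R != 0 :> F.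
Proof.
have p2 : (2 < p)%N by have := prime_gt1 pp; lia.
by rewrite -(dvdn_pcharf (pchar_Fp pp)) gtnNdvd.
Qed.

Lemma card_sqrt w : (#|[pred z : F | z ^+ 2 == w]|)%:R = 1 + rho w :> gi.
Proof.
have [->|w0] := eqVneq w 0.
  rewrite rho0 addr0 (eq_card (B := pred1 0)) ?card1// => z.
  by rewrite !inE expf_eq0.
have [k kE] : exists k, w = g ^+ k by exists (dlog w); exact: dlogP.
have [ko|ke] := boolP (odd k); last first.
  have [z zE] : exists z, w = z ^+ 2.
    by exists (g ^+ k./2); rewrite -exprM muln2 even_halfK.
  have z0 : z != 0 by apply: contra w0 => /eqP z0; rewrite zE z0 expr0n.
  rewrite (eq_card (B := pred2 z (- z))); last first.
    by move=> y; rewrite !inE zE eqf_sqr.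
  rewrite card2 zE.
  have -> : z != - z.
    by apply: contra z0; rewrite -addr_eq0 -mulr2n -mulr_natr mulf_eq0 (negPf two0) orbF.
  by rewrite /rho chX -exprM ch4.
rewrite kE /rho ch_exp -exprM mulnC exprM ig2 -signr_odd ko expr1 subrr.
rewrite eq_card0// => z; rewrite !inE; apply/negP => /eqP zk.
have z0 : z != 0 by apply: contra w0 => /eqP z0; rewrite kE -zk z0 expr0n.
move: zk; rewrite (dlogP z0) -exprM => /eqP; rewrite (eq_prim_root_expr gp) => /eqP e.
have : odd (dlog z * 2 %% p.-1) = odd (k %% p.-1) by rewrite e.
have ev : ~~ odd p.-1 by have := prime_gt1 pp; lia.
rewrite !odd_mod ?(negPf ev)// ko muln2 odd_double//.
Qed.

Lemma sum_squares (phi : F -> gi) :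
  \sum_z phi (z ^+ 2) = \sum_w phi w * (1 + rho w).
Proof.
rewrite (partition_big (fun z : F => z ^+ 2) xpredT) //=; apply: eq_bigr => w _.
rewrite (eq_bigr (fun=> phi w)); last by move=> z /eqP ->.
by rewrite sumr_const -card_sqrt mulr_natr.
Qed.

Definition jacobi := \sum_x ch x * ch (1 - x).
Definition jacobi_quad := \sum_x ch x * rho (1 - x).

(** The substitution x = (1 + z) / 2 turns 4 x (1 - x) into 1 - z^2, and each w is the square of 1 +
    rho w elements z. *)
Lemma jacobi_quadE : ch 4%:R * jacobi = jacobi_quad.
Proof.
have four : 4%:R = 2%:R * 2%:R :> F by rewrite -natrM.
pose f (z : F) := (1 + z) / 2%:R.
have fi : injective f.
  by move=> y z /(mulIf (invr_neq0 two0))/addrI.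
rewrite /jacobi mulr_sumr (reindex_inj fi) /=.
transitivity (\sum_z ch (1 - z ^+ 2)).
  apply: eq_bigr => z _; rewrite -!chM; congr ch; rewrite /f four.
  by field; rewrite ?two0.
rewrite (sum_squares (fun w => ch (1 - w))).
under eq_bigr do rewrite mulrDr mulr1.
have si : injective (fun x : F => 1 - x) by move=> y z /addrI/oppr_inj.
have s0 : \sum_w ch (1 - w) = 0 by rewrite -[RHS]sum_ch [RHS](reindex_inj si).
rewrite big_split /= s0 add0r /jacobi_quad [RHS](reindex_inj si) /=.
by apply: eq_bigr => w _; rewrite subKr mulrC.
Qed.

(** Group by t, the sum of the first two entries. For t nonzero, scaling by t gives rho t times the
    Jacobi sum; for t = 0 the inner sum is a multiple of the sum of rho, which is 0. *)
Lemma sum_ch3 : \sum_(u : F * F) ch u.1 * ch u.2 * ch (1 - u.1 - u.2) = jacobi_quad * jacobi.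
Proof.
transitivity (\sum_x \sum_y ch x * ch y * ch (1 - x - y)).
  by rewrite pair_big.
transitivity (\sum_x \sum_t ch x * ch (t - x) * ch (1 - t)).
  apply: eq_bigr => x _; rewrite (reindex_inj (addIr (- x))) /=.
  by apply: eq_bigr => t _; congr (_ * ch _); ring.
rewrite exchange_big /= /jacobi_quad mulr_suml [RHS](reindex_inj (_ : injective (fun x : F => 1 - x))); last first.
  by move=> y z /addrI/oppr_inj.
apply: eq_bigr => t _; rewrite subKr -mulr_suml -mulrA [RHS]mulrC; congr (_ * _).
have [->|t0] := eqVneq t 0.
  rewrite rho0 mul0r (eq_bigr (fun x => ch (-1) * rho x)); last first.
    by move=> x _; rewrite sub0r -[- x]mulN1r chM /rho; ring.
  by rewrite -mulr_sumr sum_rho mulr0.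
rewrite (reindex_inj (mulfI t0)) /= /jacobi mulr_sumr; apply: eq_bigr => x _.
by rewrite -{2}[t]mulr1 -mulrBr !chM /rho; ring.
Qed.

Let three0 : 3%:R != 0 :> F.
Proof.
have p3 : (3 < p)%N by have := prime_gt1 pp; lia.
by rewrite -(dvdn_pcharf (pchar_Fp pp)) gtnNdvd.
Qed.

(* The cyclic shift of the triples of sum 1 preserves the summand of sum_ch3 and fixes only
   (1/3, 1/3, 1/3). *)
Lemma jacobi_sq_mod3 : exists y, jacobi ^+ 2 = ch 12%:R + 3%:R * y.
Proof.
pose phi (u : F * F) := ch u.1 * ch u.2 * ch (1 - u.1 - u.2).
pose s (u : F * F) := (u.2, 1 - u.1 - u.2).
pose a : F * F := (3%:R^-1, 3%:R^-1).
have ph u : phi (s u) = phi u.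
  by rewrite /phi /s /= (_ : 1 - u.2 - (1 - u.1 - u.2) = u.1); ring.
have s3 u : s (s (s u)) = u.
  by case: u => x y; rewrite /s /=; congr pair; ring.
have sa u : (s u == u) = (u == a).
  case: u => x y; rewrite /s /a /=; apply/eqP/eqP => [[e1 e2]|[-> ->]].
    rewrite e1 in e2 *.
    have e3 : 3%:R * x = 1.
      transitivity (x + (x + x)); first by ring.
      by rewrite -{1}e2; ring.
    by rewrite -[x](mulKf three0) e3 mulr1.
  by congr pair; field.
have [y Hy] := sum_order3 ph s3 sa; rewrite sum_ch3 in Hy.
have pa : phi a = ch 3%:R.
  rewrite /phi /a /= (_ : 1 - 3%:R^-1 - 3%:R^-1 = 3%:R^-1 :> F); last by field.
  have e : ch 3%:R * ch 3%:R^-1 = 1 by rewrite -chM mulfV// ch1.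
  have e4 := ch4 (invr_neq0 three0).
  by rewrite -[LHS]mul1r -e -[RHS]mulr1 -e4; ring.
have four0 : 4%:R != 0 :> F by rewrite -[4%N]/(2 * 2)%N natrM mulf_neq0.
have c42 : ch 4%:R * ch 4%:R = 1.
  by rewrite -[4%N]/(2 * 2)%N natrM !chM -[RHS](ch4 two0); ring.
(* The factor chi 4, whose square is 1, turns [jacobi_quad] into [jacobi] and the value chi 3 at the
   fixed point into chi 12. *)
exists (ch 4%:R * y); rewrite -[12%N]/(4 * 3)%N natrM chM -pa.
transitivity (ch 4%:R * (jacobi_quad * jacobi)); last by rewrite Hy mulrDr [_ * (3%:R * y)]mulrCA.
by rewrite -jacobi_quadE mulrA mulrA c42 mul1r expr2.
Qed.

(* The only fixed point of x |-> 1 - x is 1/2. *)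
Lemma jacobi_mod2 : exists y, jacobi = 1 + 2%:R * y.
Proof.
pose phi x := ch x * ch (1 - x).
have ph x : phi (1 - x) = phi x by rewrite /phi subKr mulrC.
have sK : involutive (fun x : F => 1 - x) by move=> x; rewrite subKr.
have sa (x : F) : (1 - x == x) = (x == 2%:R^-1).
  apply/eqP/eqP => [e|->]; last by field.
  have e2 : 2%:R * x = 1.
    transitivity (x + x); first by ring.
    by rewrite -{1}e; ring.
  by rewrite -[x](mulKf two0) e2 mulr1.
have [y Hy] := sum_involution ph sK sa.
have pa : phi 2%:R^-1 = rho 2%:R^-1.
  by rewrite /phi (_ : 1 - 2%:R^-1 = 2%:R^-1 :> F) -?expr2//; field.
rewrite pa in Hy; have [e|e] := rho_pm (invr_neq0 two0); rewrite e in Hy.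
  by exists y.
exists (y - 1); rewrite [jacobi]Hy; ring.
Qed.

Lemma sum_rho_quad t : \sum_y rho (1 - t * y) * rho (1 - y) = (t == 1)%:R * p%:R - rho t.
Proof.
have si : injective (fun x : F => 1 - x) by move=> y z /addrI/oppr_inj.
have [->|t1] := eqVneq t 1.
  rewrite mul1r rho1 (bigD1 1)//= subrr rho0 mulr0 add0r.
  rewrite (eq_bigr (fun=> 1)); last first.
    by move=> y y1; rewrite mul1r rho_sq// subr_eq0 eq_sym.
  rewrite sumr_const cardC1 card_Fp//.
  by rewrite -{2}(prednK (prime_gt0 pp)) -natr1 addrK.
rewrite mul0r sub0r.
(* This is y -> (1 - t y) / (1 - y). As the inverse of 0 is 0, y = 1 is sent to t, the one value
   that the quotient misses. *)
have vi : injective (fun y : F => t + (1 - t) * (1 - y)^-1).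
  move=> y z /addrI/(mulfI (_ : 1 - t != 0)); rewrite subr_eq0 eq_sym t1.
  by move=> /(_ isT)/invr_inj/si.
have := sum_rho; rewrite (reindex_inj vi) /= (bigD1 1)//= subrr invr0 mulr0 addr0.
move/eqP; rewrite addrC addr_eq0 => /eqP <-.
rewrite (bigD1 1)//= subrr rho0 mulr0 add0r; apply: eq_bigr => y y1.
have y0 : 1 - y != 0 by rewrite subr_eq0 eq_sym.
have -> : t + (1 - t) * (1 - y)^-1 = (1 - t * y) * (1 - y)^-1 by field.
by rewrite rhoM rho_inv.
Qed.

(** Passing to [jacobi_quad] keeps the norm and makes conjugation act on ch alone. With x = t y the
    inner sum over y is that of [sum_rho_quad], and only t = 1 survives. *)
Lemma jacobi_norm : jacobi * conjgi jacobi = p%:R.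
Proof.
have four0 : 4%:R != 0 :> F by rewrite -[4%N]/(2 * 2)%N natrM mulf_neq0.
have chc x : x != 0 -> ch x * conjgi (ch x) = 1.
  by move=> x0; rewrite ch_conj// -chM mulfV// ch1.
have -> : jacobi * conjgi jacobi = jacobi_quad * conjgi jacobi_quad.
  by rewrite -jacobi_quadE rmorphM /= mulrACA chc// mul1r.
have -> : jacobi_quad * conjgi jacobi_quad =
    \sum_y \sum_t (if y == 0 then 0 else ch t * (rho (1 - t * y) * rho (1 - y))).
  rewrite /jacobi_quad rmorph_sum mulr_sumr; apply: eq_bigr => y _.
  rewrite rmorphM /= rho_conj; case: eqVneq => [->|y0].
    by rewrite ch0 rmorph0 mul0r mulr0 big1.
  rewrite mulr_suml (reindex_inj (mulIf y0)) /=; apply: eq_bigr => t _.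
  rewrite chM -[RHS]mul1r -(chc _ y0); ring.
rewrite exchange_big /=.
transitivity (\sum_t ch t * ((t == 1)%:R * p%:R - rho t - 1)).
  apply: eq_bigr => t _; rewrite -sum_rho_quad (bigD1 0)//= ?eqxx add0r.
  rewrite [X in _ = _ * (X - _)](bigD1 0)//= mulr0 subr0 rho1 mulr1 addrAC subrr add0r.
  by rewrite mulr_sumr; apply: eq_bigr => y /negPf ->.
under eq_bigr do rewrite !mulrBr mulr1.
rewrite !sumrB sum_ch subr0.
have -> : \sum_t ch t * rho t = 0.
  transitivity (conjgi (\sum_t ch t)); last by rewrite sum_ch rmorph0.
  rewrite rmorph_sum; apply: eq_bigr => t _ /=; rewrite /rho.
  have [->|t0] := eqVneq t 0; first by rewrite ch0 mul0r rmorph0.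
  by rewrite -[LHS]mulr1 -(chc _ t0) mulrA -exprS -exprSr ch4// mul1r.
rewrite subr0 (bigD1 1)//= ?eqxx ch1 !mul1r big1 ?addr0// => t /negPf ->.
by rewrite mul0r mulr0.
Qed.

End JacobiSum.

Lemma jacobi_sum (p : nat) : prime p -> (p %% 4 = 1)%N ->
  exists a b : int, [/\ a ^+ 2 + b ^+ 2 = p%:Z, (2 %| a - 1)%Z, (2 %| b)%Z &
    (exists z : 'F_p, z ^+ 4 = 12%:R) -> (3 %| a ^+ 2 - b ^+ 2 - 1)%Z && (3 %| 2 * a * b)%Z].
Proof.
move=> pp p4; have [g gp] := primitive_root_Fp pp p4.
have [y Hy] := jacobi_mod2 pp p4 gp; have [w Hw] := jacobi_sq_mod3 pp p4 gp.
have HN := jacobi_norm pp p4 gp; set j := jacobi g in Hy Hw HN.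
exists (gre j), (gim j); split.
- by rewrite -[RHS]natz -gre_nat -HN greM /=; ring.
- apply/dvdzP; exists (gre y); rewrite Hy greD greM gre_nat gim_nat /=; ring.
- apply/dvdzP; exists (gim y); rewrite Hy gimD gimM gre_nat gim_nat /=; ring.
case=> z zE; have c1 : ch g 12%:R = 1.
  rewrite -zE (chX pp p4 gp) (ch4 pp p4 gp)//; apply/eqP => z0.
  move/eqP: zE; rewrite z0 expr0n eq_sym -(dvdn_pcharf (pchar_Fp pp)).
  rewrite -[12%N]/(2 ^ 2 * 3)%N Euclid_dvdM// Euclid_dvdX// andbT.
  by rewrite !dvdn_prime2// => /orP[] /eqP p23; move: p4; rewrite p23.
apply/andP; split; apply/dvdzP.
  exists (gre w); have := congr1 gre Hw; rewrite c1 expr2 greD !greM gre_nat gim_nat.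
  by rewrite -!expr2 => ->; rewrite /=; ring.
exists (gim w); have := congr1 gim Hw; rewrite c1 expr2 gimD !gimM gre_nat gim_nat.
move=> e; transitivity (gre j * gim j + gim j * gre j); first by ring.
by rewrite e /=; ring.
Qed.

(** * The Hecke character *)

(* eps is the character of the units mod 2, with value -1 at i, and sqr3 a is the unit congruent
   to a^2 mod 3. Both send i to -1, hence their product psig is a function of ideals. *)
Definition eps (x y : int) : gi :=
  if (x %% 2 == 0)%Z then (if (y %% 2 == 0)%Z then 0 else -1)
  else (if (y %% 2 == 0)%Z then 1 else 0).

Definition sqr3 (x y : int) : gi :=
  if (x %% 3 == 0)%Z then (if (y %% 3 == 0)%Z then 0 else -1)
  else if (y %% 3 == 0)%Z then 1 else if (x %% 3 == y %% 3)%Z then - ig else ig.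

Definition psig (a : gi) : gi := eps (gre a) (gim a) * sqr3 (gre a) (gim a).

Lemma mod2_case (x : int) : (x %% 2)%Z = 0 \/ (x %% 2)%Z = 1. Proof. lia. Qed.
Lemma mod3_case (x : int) : [\/ (x %% 3)%Z = 0, (x %% 3)%Z = 1 | (x %% 3)%Z = 2].
Proof.
have : (x %% 3)%Z = 0 \/ (x %% 3)%Z = 1 \/ (x %% 3)%Z = 2 by lia.
by case=> [|[]]; [constructor 1|constructor 2|constructor 3].
Qed.

Lemma eps_mod x y : eps x y = eps (x %% 2)%Z (y %% 2)%Z.
Proof. by rewrite /eps !modz_mod. Qed.
Lemma sqr3_mod x y : sqr3 x y = sqr3 (x %% 3)%Z (y %% 3)%Z.
Proof. by rewrite /sqr3 !modz_mod. Qed.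

Lemma modzMD d (x y u v : int) :
  ((x * u + y * v) %% d = ((x %% d)%Z * (u %% d)%Z + (y %% d)%Z * (v %% d)%Z) %% d)%Z.
Proof. by rewrite -[in RHS]modzDm !modzMm modzDm. Qed.
Lemma modzMB d (x y u v : int) :
  ((x * u - y * v) %% d = ((x %% d)%Z * (u %% d)%Z - (y %% d)%Z * (v %% d)%Z) %% d)%Z.
Proof. by rewrite -[in RHS]modzDm -[in RHS]modzNm !modzMm modzNm modzDm. Qed.

Lemma epsM (x y u v : int) : eps (x * u - y * v) (x * v + y * u) = eps x y * eps u v.
Proof.
rewrite eps_mod modzMB modzMD -eps_mod [eps x y]eps_mod [eps u v]eps_mod.
by case: (mod2_case x) (mod2_case y) (mod2_case u) (mod2_case v) => -> [] -> [] -> [] ->.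
Qed.
Lemma sqr3M (x y u v : int) : sqr3 (x * u - y * v) (x * v + y * u) = sqr3 x y * sqr3 u v.
Proof.
rewrite sqr3_mod modzMB modzMD -sqr3_mod [sqr3 x y]sqr3_mod [sqr3 u v]sqr3_mod.
by case: (mod3_case x) (mod3_case y) (mod3_case u) (mod3_case v) => -> [] -> [] -> [] ->.
Qed.

Lemma psigM a b : psig (a * b) = psig a * psig b.
Proof. by rewrite /psig greM gimM epsM sqr3M mulrACA. Qed.

Lemma psig_mod (a b : gi) : (gre a = gre b %[mod 6])%Z -> (gim a = gim b %[mod 6])%Z ->
  psig a = psig b.
Proof.
move=> h1 h2; rewrite /psig eps_mod sqr3_mod [eps (gre b) _]eps_mod [sqr3 (gre b) _]sqr3_mod.
have m2 (x y : int) : (x = y %[mod 6])%Z -> (x %% 2 = y %% 2)%Z /\ (x %% 3 = y %% 3)%Z by lia.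
by have [-> ->] := m2 _ _ h1; have [-> ->] := m2 _ _ h2.
Qed.

Definition gnorm (a : gi) : int := gre a ^+ 2 + gim a ^+ 2.
Lemma gnormM a b : gnorm (a * b) = gnorm a * gnorm b.
Proof. by rewrite /gnorm greM gimM; ring. Qed.
Lemma gnorm_conj a : gnorm (conjgi a) = gnorm a.
Proof. by rewrite /gnorm /=; ring. Qed.

Definition mu4 : seq gi := [:: 1; -1; ig; -ig].

Lemma psig_mu4 a : psig a = 0 \/ psig a \in mu4.
Proof.
rewrite /psig eps_mod sqr3_mod.
case: (mod2_case (gre a)) (mod2_case (gim a)) (mod3_case (gre a)) (mod3_case (gim a))
  => -> [] -> [] -> [] ->; (by left) || (by right).
Qed.

Lemma psig_conj a : psig (conjgi a) = conjgi (psig a).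
Proof.
rewrite /psig /= [LHS](congr2 _ (eps_mod _ _) (sqr3_mod _ _)) [in RHS]eps_mod [in RHS]sqr3_mod.
rewrite -!(modzNm (gim a)).
case: (mod2_case (gre a)) (mod2_case (gim a)) (mod3_case (gre a)) (mod3_case (gim a))
  => -> [] -> [] -> [] ->; by [].
Qed.

Lemma Euclid_dvdzM (p : nat) (x y : int) : prime p ->
  (p %| x * y)%Z = (p %| x)%Z || (p %| y)%Z.
Proof. by move=> pp; rewrite !dvdzE abszM Euclid_dvdM. Qed.

Definition zrange (n : nat) : seq int := [seq i%:Z - n%:Z | i <- iota 0 (2 * n).+1].

Lemma mem_zrange n z : (z \in zrange n) = (`|z| <= n)%N.
Proof.
apply/mapP/idP => [[k]|zn]; first by rewrite mem_iota => /andP[_ k2] ->; lia.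
by exists (absz (z + n%:Z)%R); [rewrite mem_iota; lia|lia].
Qed.

Lemma zrange_uniq n : uniq (zrange n).
Proof. by rewrite map_inj_uniq ?iota_uniq// => i j; lia. Qed.

Definition reps n := [seq a <- [seq GI x y | x <- zrange n, y <- zrange n] | gnorm a == n%:Z].

Lemma mem_reps n a : (a \in reps n) = (gnorm a == n%:Z).
Proof.
rewrite mem_filter; case: eqP => [e|_]; rewrite ?andbF// andTb.
apply/allpairsPdep; exists (gre a), (gim a); rewrite !mem_zrange.
move: e; rewrite /gnorm !expr2 => e; split; [nia|nia|by case: (a)].
Qed.

Lemma reps_uniq n : uniq (reps n).
Proof.
rewrite filter_uniq// allpairs_uniq ?zrange_uniq//.
by move=> [x y] [u v] _ _ /= [-> ->].
Qed.

Lemma gi_mulI (a : gi) : gnorm a != 0 -> injective (fun b => a * b).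
Proof.
move=> a0 b c e; have : conjgi a * (a * b) = conjgi a * (a * c) by rewrite e.
rewrite !mulrA.
have -> : conjgi a * a = GI (gnorm a) 0 by apply: giP => /=; rewrite /gnorm; ring.
move=> {}e; have := congr1 gre e; have := congr1 gim e.
rewrite !greM !gimM ![gre (GI _ _)]/= ![gim (GI _ _)]/= !mul0r !subr0 ?addr0.
move=> /(mulfI a0) h1 /(mulfI a0) h2.
exact: giP.
Qed.

Lemma map_reps_uniq a n : gnorm a != 0 -> uniq [seq a * b | b <- reps n].
Proof. by move=> a0; rewrite map_inj_uniq ?reps_uniq//; exact: gi_mulI. Qed.

Lemma perm_reps_ig n : perm_eq [seq ig * a | a <- reps n] (reps n).
Proof.
apply: uniq_perm; rewrite ?map_reps_uniq ?reps_uniq// => a.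
rewrite mem_reps; apply/mapP/eqP => [[b]|e].
  by rewrite mem_reps => /eqP <- ->; rewrite gnormM mul1r.
exists (- ig * a); last by rewrite mulrA (_ : ig * - ig = 1) ?mul1r.
by rewrite mem_reps gnormM e mul1r.
Qed.

Section Psi.
Variable R : realType.
Local Notation K := R[i].

Definition tok (a : gi) : K := Complex (gre a)%:~R (gim a)%:~R.
Lemma tokM a b : tok (a * b) = tok a * tok b.
Proof. by rewrite /tok greM gimM !rmorphB !rmorphD !rmorphM. Qed.
Lemma tok1 : tok 1 = 1. Proof. by []. Qed.
Lemma tokN a : tok (- a) = - tok a.
Proof. by rewrite /tok /= !rmorphN. Qed.

Definition psi a : K := tok (psig a).
Lemma psiM a b : psi (a * b) = psi a * psi b.
Proof. by rewrite /psi psigM tokM. Qed.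
Lemma psi1 : psi 1 = 1. Proof. by []. Qed.
Lemma psi_ig : psi ig = 1. Proof. by []. Qed.
Lemma nrm_psi a : nrm (psi a) <= 1.
Proof.
rewrite /psi; have [->|] := psig_mu4 a; first by rewrite /nrm (_ : tok 0 = 0) ?normr0.
rewrite !inE => /or4P[] /eqP ->.
- by rewrite tok1 nrm1.
- by rewrite tokN tok1 nrmN nrm1.
- by rewrite (_ : tok ig = Complex 0 1) ?nrm_i.
- by rewrite tokN (_ : tok ig = Complex 0 1) ?nrmN ?nrm_i.
Qed.

Definition rsum n : K := \sum_(a <- reps n) psi a.
Definition qsum n : K := \sum_(1 <= x < n.+1) \sum_(0 <= y < n.+1 | (x ^ 2 + y ^ 2 == n)%N)
   psi (GI x%:Z y%:Z).
Definition quad (a : gi) := (0 < gre a) && (0 <= gim a).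

(** psi takes the same value at the four associates of a nonzero element, and [quad] contains
    exactly one of them. *)
Lemma rsumE n : (0 < n)%N -> rsum n = 4%:R * qsum n.
Proof.
move=> n0.
pose Q := \sum_(a <- reps n | quad a) psi a.
have shift (P : pred gi) : \sum_(a <- reps n | P (ig * a)) psi a = \sum_(a <- reps n | P a) psi a.
  rewrite -[RHS](perm_big _ (perm_reps_ig n)) big_map; apply: eq_bigr => a _.
  by rewrite psiM psi_ig mul1r.
have s1 : Q = \sum_(a <- reps n | quad (ig * a)) psi a by rewrite shift.
have s2 : Q = \sum_(a <- reps n | quad (ig * (ig * a))) psi a.
  by rewrite s1 -(shift (fun a => quad (ig * a))).
have s3 : Q = \sum_(a <- reps n | quad (ig * (ig * (ig * a)))) psi a.
  by rewrite s2 -(shift (fun a => quad (ig * (ig * a)))).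
have e : rsum n = Q + Q + Q + Q.
  rewrite {2}s1 {2}s2 {2}s3 /Q (big_mkcond quad) (big_mkcond (fun a => quad (ig * a))).
  rewrite (big_mkcond (fun a => quad (ig * (ig * a)))).
  rewrite (big_mkcond (fun a => quad (ig * (ig * (ig * a))))).
  rewrite -!big_split /rsum [LHS]big_seq [RHS]big_seq.
  apply: eq_bigr => a; rewrite mem_reps /gnorm => /eqP aE.
  rewrite /quad !greM !gimM /= !mul0r !mul1r !sub0r !add0r.
  have : (gre a != 0) || (gim a != 0).
    by move: aE; case: eqP => [->|]//=; case: eqP => [->|]//=; rewrite !expr2; lia.
  move: (gre a) (gim a) => x y xy.
  by do 4![case: ifP => ?]; rewrite ?addr0 ?add0r//; lia.
have -> : qsum n = Q; last by rewrite e; ring.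
rewrite /Q -big_filter.
transitivity (\sum_(a <- [seq GI x%:Z y%:Z | x <- index_iota 1 n.+1, y <- index_iota 0 n.+1]
    | gnorm a == n%:Z) psi a).
  rewrite [RHS]big_mkcond big_allpairs_dep; apply: eq_bigr => x _.
  rewrite [LHS]big_mkcond; apply: eq_bigr => y _; congr (if _ then _ else _).
rewrite -[LHS]big_filter; apply: perm_big; apply: uniq_perm.
- rewrite filter_uniq// allpairs_uniq ?iota_uniq//.
  by move=> [x y] [u v] _ _ /= [-> ->].
- by rewrite filter_uniq ?reps_uniq.
move=> a; rewrite [LHS]mem_filter [RHS]mem_filter mem_reps; case: eqP => [aE|_]; last by rewrite andbF.
rewrite andbT andTb; apply/allpairsPdep/andP => [[x [y []]]|[a1 a2]].
  by rewrite !mem_index_iota => x1 y1 ->; rewrite /=; lia.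
exists `|gre a|%N, `|gim a|%N; rewrite !mem_index_iota.
move: aE; rewrite /gnorm !expr2 => aE.
split; [nia|nia|]; apply: giP => /=; lia.
Qed.

End Psi.

Lemma psig_norm2 a : (2 %| gnorm a)%Z -> psig a = 0.
Proof.
rewrite /gnorm !expr2 => /dvdz_mod0P; rewrite modzMD /psig eps_mod.
by case: (mod2_case (gre a)) (mod2_case (gim a)) => -> [] ->; rewrite ?mul0r.
Qed.

Lemma psig_norm3 a : (3 %| gnorm a)%Z -> psig a = 0.
Proof.
rewrite /gnorm !expr2 => /dvdz_mod0P; rewrite modzMD /psig sqr3_mod.
by case: (mod3_case (gre a)) (mod3_case (gim a)) => -> [] ->; rewrite ?mulr0.
Qed.

Lemma psig_real (n : nat) : odd n -> ~~ (3 %| n)%N -> psig n%:R = 1.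
Proof.
move=> on n3; rewrite /psig gre_nat gim_nat natz /eps /sqr3.
have -> : (n %% 2)%Z = 1 by lia.
have -> : ((n %% 3)%Z == 0) = false by lia.
by rewrite mod0z.
Qed.

(** Otherwise - 1 would be a square mod p, and raising to the odd power (p - 1) / 2 would contradict
    Fermat. *)
Lemma inert_dvd (p : nat) (x y : int) : prime p -> (p %% 4 = 3)%N ->
  (p %| x ^+ 2 + y ^+ 2)%Z -> (p %| x)%Z && (p %| y)%Z.
Proof.
move=> pp p4; have cF := pchar_Fp pp.
rewrite !(dvdz_pcharf cF) rmorphD !rmorphXn /=.
move: (x%:~R : 'F_p) (y%:~R : 'F_p) => {}x {}y.
have [->|x0] := eqVneq x 0; first by rewrite expr0n add0r expf_eq0.
rewrite addr_eq0 => /eqP e; exfalso.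
have y0 : y != 0.
  by apply: contra x0 => /eqP y0; move/eqP: e; rewrite y0 expr0n oppr0 expf_eq0.
have fermat := Fp_fermat pp.
have pE : (p.-1 = 2 * p.-1./2)%N by have := prime_gt1 pp; lia.
have od : odd p.-1./2 by lia.
have := fermat _ x0; rewrite {1}pE exprM e exprNn -signr_odd od expr1 -exprM -pE.
rewrite (fermat _ y0) mulr1 => /eqP; rewrite eq_sym -addr_eq0 -(natrD _ 1 1).
by rewrite -(dvdn_pcharf cF) dvdn_prime2// => /eqP p2; rewrite p2 in p4.
Qed.

(** Divisibility of a by pi when pi has norm p: [a * conjgi pi] is then p times the quotient a /
    pi. *)
Definition gdvd (p : nat) (pi a : gi) :=
  (p %| gre (a * conjgi pi))%Z && (p %| gim (a * conjgi pi))%Z.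

Lemma conj_norm (a : gi) : a * conjgi a = GI (gnorm a) 0.
Proof. by apply: giP => /=; rewrite /gnorm; ring. Qed.

Lemma gi_scale (x : int) (a : gi) : GI x 0 * a = GI (x * gre a) (x * gim a).
Proof. by apply: giP => /=; ring. Qed.

Section SplitPrime.
Variables (p n : nat) (pi : gi).
Hypotheses (pp : prime p) (n0 : (0 < n)%N) (piN : gnorm pi = p%:Z) (p2 : (2 < p)%N).

Let p0 : p%:Z != 0. Proof. by have := prime_gt0 pp; lia. Qed.

Lemma perm_reps_gdvd :
  perm_eq [seq a <- reps (p * n) | gdvd p pi a] [seq pi * b | b <- reps n].
Proof.
apply: uniq_perm; rewrite ?(filter_uniq _ (reps_uniq _))// ?map_reps_uniq ?piN//.
move=> a; rewrite mem_filter mem_reps.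
apply/andP/mapP => [[/andP[/dvdzP[x xE] /dvdzP[y yE]] /eqP aN]|[b]].
  have aE : a = pi * GI x y.
    apply: (@gi_mulI (GI p%:Z 0)); first by rewrite /gnorm /= expr0n addr0 expf_neq0.
    transitivity (pi * (a * conjgi pi)).
      by rewrite -piN -conj_norm -mulrA [conjgi pi * a]mulrC.
    rewrite [RHS]mulrCA; congr (_ * _).
    by rewrite gi_scale; apply: giP; rewrite ?xE ?yE mulrC.
  exists (GI x y) => //; rewrite mem_reps; apply/eqP.
  by move: aN; rewrite aE gnormM piN PoszM => /(mulfI p0).
rewrite mem_reps => /eqP bN ->; rewrite gnormM piN bN -PoszM eqxx; split=> //.
by rewrite /gdvd mulrAC conj_norm piN gi_scale !dvdz_mulr.
Qed.

Let pu : ~~ (p %| gre pi)%Z.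
Proof.
apply/negP => h1; have h2 : (p %| gim pi)%Z.
  have : (p %| gim pi * gim pi)%Z.
    have -> : gim pi * gim pi = p%:Z - gre pi * gre pi by rewrite -piN /gnorm; ring.
    by rewrite rpredB// dvdz_mulr.
  by rewrite Euclid_dvdzM// orbb.
case/dvdzP: h1 => x xE; case/dvdzP: h2 => y yE.
move: piN; rewrite /gnorm xE yE !expr2 => e.
have : (x * x + y * y) * p%:Z = 1.
  by apply: (@mulIf _ p%:Z); [lia|rewrite mul1r -[RHS]e; ring].
move=> h; have : (p %| (1 : int))%Z by apply/dvdzP; exists (x * x + y * y).
by rewrite dvdz1 /=; lia.
Qed.

(** The product (x u + y v) (x u - y v) = x^2 p - v^2 (x^2 + y^2) is divisible by p, and the factor
    that p divides decides between pi and its conjugate. *)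
Lemma gdvd_or a : gnorm a = (p * n)%N%:Z -> gdvd p pi a || gdvd p (conjgi pi) a.
Proof.
move=> aN; rewrite /gdvd /= !opprK.
have pa : (p %| gre a ^+ 2 + gim a ^+ 2)%Z by rewrite -/(gnorm a) aN PoszM dvdz_mulr.
have pn : gre pi ^+ 2 + gim pi ^+ 2 = p by [].
move: (gre a) (gim a) (gre pi) (gim pi) pu pa pn => x y u v pu' pa pn.
have h : (p %| (x * u + y * v) * (x * u - y * v))%Z.
  have -> : (x * u + y * v) * (x * u - y * v) = x ^+ 2 * p - v ^+ 2 * (x ^+ 2 + y ^+ 2).
    by rewrite -pn; ring.
  by rewrite rpredB// dvdz_mull.
have key (s t : int) : (p %| u * s - t * p)%Z -> (p %| s)%Z.
  move=> h1; have : (p %| u * s)%Z.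
    by rewrite -[u * s](subrK (t * p)) rpredD// dvdz_mull.
  by rewrite Euclid_dvdzM// (negPf pu').
rewrite !mulrN !opprK.
move: h; rewrite Euclid_dvdzM// => /orP[h|h]; apply/orP; [left|right]; rewrite h /=.
  apply: (key _ y).
  have -> : u * (- (x * v) + y * u) - y * p = - v * (x * u + y * v) by rewrite -pn; ring.
  by rewrite dvdz_mull.
apply: (key _ y).
have -> : u * (x * v + y * u) - y * p = v * (x * u - y * v) by rewrite -pn; ring.
by rewrite dvdz_mull.
Qed.

(** With a = x + i y and u the real part of pi, adding the two conditions leaves 2 x u and 2 y u,
    where p divides neither 2 nor u. *)
Lemma gdvd_both a : gdvd p pi a && gdvd p (conjgi pi) a = (p %| gre a)%Z && (p %| gim a)%Z.
Proof.
rewrite /gdvd /= !opprK.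
move: (gre a) (gim a) (gre pi) (gim pi) pu => x y u v pu'.
rewrite !mulrN !opprK.
apply/idP/idP => [/andP[/andP[h1 h2] /andP[h3 h4]]|/andP[h1 h2]]; last first.
  by rewrite !(rpredD, rpredB, rpredN, dvdz_mulr)// !dvdz_mulr.
have p2' : ~~ (p %| 2%:Z)%Z.
  by apply/negP; rewrite dvdzE /= => /dvdn_leq; lia.
have key (s : int) : (p %| 2%:Z * (s * u))%Z -> (p %| s)%Z.
  by rewrite !Euclid_dvdzM// (negPf p2') (negPf pu') orbF.
apply/andP; split; apply: key.
  have -> : 2%:Z * (x * u) = (x * u + y * v) + (x * u - y * v) by ring.
  exact: rpredD.
have -> : 2%:Z * (y * u) = (- (x * v) + y * u) + (x * v + y * u) by ring.
exact: rpredD.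
Qed.

End SplitPrime.

Lemma perm_reps_scale (p n : nat) : prime p -> (0 < n)%N ->
  perm_eq [seq a <- reps (p * (p * n)) | (p %| gre a)%Z && (p %| gim a)%Z]
          [seq p%:R * b | b <- reps n].
Proof.
move=> pp n0; have p0 : p%:Z != 0 by have := prime_gt0 pp; lia.
have pE : p%:R = GI p%:Z 0 by apply: giP; rewrite ?gre_nat ?gim_nat ?natz.
have pN : gnorm p%:R = p%:Z * p%:Z by rewrite pE /gnorm /= expr0n addr0 expr2.
apply: uniq_perm; rewrite ?(filter_uniq _ (reps_uniq _))// ?map_reps_uniq ?pN ?mulf_neq0//.
move=> a; rewrite mem_filter mem_reps.
apply/andP/mapP => [[/andP[/dvdzP[x xE] /dvdzP[y yE]] /eqP aN]|[b]].
  have aE : a = p%:R * GI x y.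
    by rewrite pE gi_scale; apply: giP; rewrite ?xE ?yE mulrC.
  exists (GI x y) => //; rewrite mem_reps; apply/eqP.
  by move: aN; rewrite aE gnormM pN !PoszM mulrA => /(mulfI (mulf_neq0 p0 p0)).
rewrite mem_reps => /eqP bN ->; rewrite gnormM pN bN !PoszM mulrA eqxx; split=> //.
by rewrite pE gi_scale !dvdz_mulr.
Qed.

Lemma reps_scale_dvd (p n : nat) a : prime p -> a \in reps (p * n) ->
  (p %| gre a)%Z && (p %| gim a)%Z -> (p %| n)%N.
Proof.
move=> pp; rewrite mem_reps => /eqP aN /andP[/dvdzP[x xE] /dvdzP[y yE]].
have p0 : p%:Z != 0 by have := prime_gt0 pp; lia.
move: aN; rewrite /gnorm xE yE PoszM !expr2 => e.
have -> : (p %| n)%N = (p %| n%:Z)%Z by rewrite dvdzE.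
apply/dvdzP; exists (x * x + y * y); apply: (mulfI p0); rewrite -e; ring.
Qed.

Section ThreeTerm.
Variable R : realType.
Local Notation K := R[i].

(* For p = 1 mod 4 the element gprime p is a prime above p with psig = 1 as soon as 12 is a fourth
   power mod p. *)
Definition gprime_spec (p : nat) (a : gi) : Prop :=
  [/\ gnorm a = p%:Z, (2 %| gre a - 1)%Z, (2 %| gim a)%Z &
  (exists z : 'F_p, z ^+ 4 = 12%:R) ->
    (3 %| gre a ^+ 2 - gim a ^+ 2 - 1)%Z && (3 %| 2 * gre a * gim a)%Z].
Definition gprime p : gi := xget 0 [set a | gprime_spec p a]%classic.
Lemma gprimeP p : prime p -> (p %% 4 = 1)%N -> gprime_spec p (gprime p).
Proof.
move=> pp p4; apply: (@xgetPex _ 0 [set a | gprime_spec p a]%classic).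
by have [a [b [h1 h2 h3 h4]]] := jacobi_sum pp p4; exists (GI a b); split.
Qed.

(** With [Bval], the local parameters of the Euler product: psi of the two primes above a split p; 1
    and - 1 for an inert p > 3, where psi p = 1 makes the local factor 1 / (1 - X^2); and 0 for 2
    and 3. *)
Definition Aval p : K :=
  if (p %% 4 == 1)%N then psi R (gprime p) else if (p <= 3)%N then 0 else 1.
Definition Bval p : K :=
  if (p %% 4 == 1)%N then psi R (conjgi (gprime p)) else if (p <= 3)%N then 0 else -1.

Lemma psi_psig0 a : psig a = 0 -> psi R a = 0.
Proof. by rewrite /psi => ->. Qed.

(** For split p, inclusion and exclusion over the multiples of pi and of its conjugate. For inert p
    > 3, every element of norm p n is a multiple of p. For p <= 3, psi vanishes on norms divisible
    by p. *)
Lemma rsum_three_term :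
  three_term (fun p => Aval p + Bval p) (fun p => Aval p * Bval p) (@rsum R).
Proof.
move=> p n pp n0; have p1 := prime_gt1 pp.
have p0' : (0 < p)%N by lia.
rewrite /Aval /Bval; case: eqP => p4.
  have [piN _ _ _] := gprimeP pp p4; set pi := gprime p in piN *.
  have p2 : (2 < p)%N by lia.
  have piN' : gnorm (conjgi pi) = p%:Z by rewrite gnorm_conj.
  rewrite {1}/rsum (big_incl_excl _ (P := gdvd p pi) (Q := gdvd p (conjgi pi))); last first.
    by move=> a; rewrite mem_reps => /eqP aN; apply: (gdvd_or pp n0 piN p2).
  rewrite -[X in X + _ - _]big_filter (perm_big _ (perm_reps_gdvd pp n0 piN p2)) big_map.
  rewrite -[X in _ + X - _]big_filter (perm_big _ (perm_reps_gdvd pp n0 piN' p2)) big_map.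
  rewrite mulrDl; congr (_ + _ - _).
  - by rewrite mulr_sumr; apply: eq_bigr => a _; rewrite psiM.
  - by rewrite mulr_sumr; apply: eq_bigr => a _; rewrite psiM.
  rewrite (eq_bigl (fun a => (p %| gre a)%Z && (p %| gim a)%Z)); last first.
    by move=> a; exact: (gdvd_both pp n0 piN p2).
  case: ifP => pn; last first.
    rewrite big_seq_cond big1// => a /andP[ra /andP[h1 h2]].
    by rewrite (reps_scale_dvd pp ra) ?h1 in pn.
  have np0 : (0 < n %/ p)%N by rewrite divn_gt0// dvdn_leq.
  rewrite -{1}(divnK pn) [(n %/ p * p)%N]mulnC -big_filter.
  rewrite (perm_big _ (perm_reps_scale pp np0)) big_map /rsum mulr_sumr.
  apply: eq_bigr => a _; rewrite psiM; congr (_ * _); rewrite -psiM; congr psi.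
  by rewrite conj_norm piN; apply: giP; rewrite ?gre_nat ?gim_nat ?natz.
have [p3|p3] := leqP p 3.
  rewrite addr0 !mul0r if_same subr0 /rsum big_seq big1// => a; rewrite mem_reps => /eqP aN.
  apply: psi_psig0.
  have [e|e] : p = 2%N \/ p = 3%N by lia.
    by apply: psig_norm2; rewrite aN e PoszM dvdz_mulr.
  by apply: psig_norm3; rewrite aN e PoszM dvdz_mulr.
have op : odd p by case: (even_prime pp) => // e; rewrite e in p3.
have p43 : (p %% 4 = 3)%N by lia.
rewrite addrN mul0r sub0r mul1r.
have dv a : a \in reps (p * n) -> (p %| gre a)%Z && (p %| gim a)%Z.
  by rewrite mem_reps => /eqP aN; apply: inert_dvd => //; rewrite -/(gnorm a) aN PoszM dvdz_mulr.
case: ifP => pn; last first.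
  rewrite oppr0 /rsum big_seq big1// => a ra.
  by rewrite (reps_scale_dvd pp ra (dv a ra)) in pn.
have np0 : (0 < n %/ p)%N by rewrite divn_gt0// dvdn_leq.
rewrite mulN1r opprK -{1}(divnK pn) [(n %/ p * p)%N]mulnC /rsum.
transitivity (\sum_(a <- reps (p * (p * (n %/ p))) | (p %| gre a)%Z && (p %| gim a)%Z) psi R a).
  rewrite [LHS]big_seq [RHS]big_seq_cond; apply: eq_bigl => a.
  case ra: (a \in _) => //=; rewrite dv//.
  by move: ra; rewrite [(p * (n %/ p))%N]mulnC divnK.
rewrite -big_filter (perm_big _ (perm_reps_scale pp np0)) big_map.
apply: eq_bigr => a _; rewrite psiM {1}/psi psig_real//; first by rewrite tok1 mul1r.
by rewrite dvdn_prime2//; apply/eqP; lia.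
Qed.

Lemma qsum_conv n : (0 < n)%N -> qsum R n = conv (cmulext Aval) (cmulext Bval) n.
Proof.
move: n; apply: (@three_term_uniq _ (fun p => Aval p + Bval p) (fun p => Aval p * Bval p)).
- move=> p n pp n0; have p0 := prime_gt0 pp.
  have f0 : 4%:R != 0 :> K by rewrite pnatr_eq0.
  apply: (mulfI f0); rewrite -rsumE ?muln_gt0 ?p0// rsum_three_term// mulrBr.
  rewrite (rsumE R n0) [in LHS]mulrCA; congr (_ - _).
  case: ifP => pn; last by rewrite mulr0.
  have np0 : (0 < n %/ p)%N by rewrite divn_gt0// dvdn_leq.
  by rewrite (rsumE R np0) [LHS]mulrCA.
- move=> p n pp n0.
  rewrite conv_three_term ?cmulext_prime//; exact: cmulext_cmul.
rewrite conv1 (cmulext_cmul _).1 (cmulext_cmul _).1 mulr1 /qsum big_nat1.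
rewrite big_mkcond big_nat_recl// big_nat1 /= addr0.
exact: psi1.
Qed.

End ThreeTerm.

(** * Lattice points in the quarter disc and the O(sqrt x) bound *)

Definition isq (y : nat) : nat := PeanoNat.Nat.sqrt y.
Lemma isqP y : (isq y * isq y <= y < (isq y).+1 * (isq y).+1)%N.
Proof.
have [h1 h2] := PeanoNat.Nat.sqrt_spec y (PeanoNat.Nat.le_0_l y).
by rewrite /isq; move: (PeanoNat.Nat.sqrt y) h1 h2 => s h1 h2; apply/andP; split; lia.
Qed.

Lemma isq_mono x y : (x <= y)%N -> (isq x <= isq y)%N.
Proof. by move=> xy; have := isqP x; have := isqP y; nia. Qed.

Lemma sum_quarter_disc (V : nmodType) (f : nat -> nat -> nat -> V) x :
  \sum_(1 <= n < x.+1) \sum_(1 <= a < n.+1) \sum_(0 <= b < n.+1 | (a ^ 2 + b ^ 2 == n)%N) f n a b =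
  \sum_(1 <= a < (isq x).+1) \sum_(0 <= b < (isq (x - a ^ 2)).+1) f (a ^ 2 + b ^ 2)%N a b.
Proof.
have zero (i j : nat) (P : pred nat) (F : nat -> V) :
    (forall k, (i <= k < j)%N -> P k -> F k = 0) -> \sum_(i <= k < j | P k) F k = 0.
  by move=> H; rewrite big_nat_cond big1// => k /andP[]; exact: H.
transitivity (\sum_(1 <= n < x.+1) \sum_(1 <= a < x.+1) \sum_(0 <= b < x.+1)
    (if (n == a ^ 2 + b ^ 2)%N then f n a b else 0)).
  apply: eq_big_nat => n /andP[n0 nx].
  rewrite [RHS](@big_cat_nat _ _ _ n.+1)//= [X in _ = _ + X]zero ?addr0; last first.
    by move=> a an _; apply: (zero _ _ _ _) => b _ _; case: ifP => //; nia.
  apply: eq_big_nat => a an.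
  rewrite [RHS](@big_cat_nat _ _ _ n.+1)//= [X in _ = _ + X]zero ?addr0; last first.
    by move=> b bn _; case: ifP => //; nia.
  by rewrite big_mkcond; apply: eq_bigr => b _; rewrite eq_sym.
rewrite exchange_big /=.
have sx : (isq x <= x)%N by have := isqP x; nia.
rewrite (@big_cat_nat _ _ _ (isq x).+1)//= [X in _ + X]zero ?addr0; last first.
  move=> a ax _; apply: (zero _ _ _ _) => n nx _; apply: (zero _ _ _ _) => b _ _; case: ifP => //.
  by have := isqP x; nia.
apply: eq_big_nat => a ax; rewrite exchange_big /=.
have a2 : (a ^ 2 <= x)%N by have := isqP x; nia.
have sy := isqP (x - a ^ 2); set y := isq (x - a ^ 2) in sy *.
rewrite (@big_cat_nat _ _ _ y.+1)//=; last by nia.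
rewrite [X in _ + X]zero ?addr0; last first.
  by move=> b bx _; apply: (zero _ _ _ _) => n nx _; case: ifP => //; nia.
apply: eq_big_nat => b bx; rewrite -big_mkcond /=.
rewrite big_mkcond (bigD1_seq (a ^ 2 + b ^ 2)%N) ?iota_uniq//=; last first.
  by rewrite mem_index_iota; nia.
by rewrite eqxx big1 ?addr0// => n /negPf ->.
Qed.

Section Periodic.
Variable R : realType.
Local Notation K := R[i].

Lemma periodic_sum (F : nat -> K) m n : (0 < m)%N -> (forall k, F (k + m)%N = F k) ->
  \sum_(0 <= k < n) F k = (n %/ m)%:R * (\sum_(0 <= k < m) F k) + \sum_(0 <= k < n %% m) F k.
Proof.
move=> m0 per.
have perq q k : F (q * m + k)%N = F k.
  by elim: q => [|q IH]; rewrite ?mul0n ?add0n// mulSn -addnA addnC per.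
have full q : \sum_(0 <= k < q * m) F k = q%:R * \sum_(0 <= k < m) F k.
  elim: q => [|q IH]; first by rewrite big_nil mul0r.
  rewrite mulSn addnC (@big_cat_nat _ _ _ (q * m))//= ?leq_addr// IH.
  rewrite -{1}[(q * m)%N]add0n big_addn addKn -natr1 mulrDl mul1r; congr (_ + _).
  by apply: eq_bigr => k _; rewrite addnC perq.
rewrite {1}(divn_eq n m) (@big_cat_nat _ _ _ (n %/ m * m))//= ?leq_addr// full.
congr (_ + _); rewrite -{1}[(n %/ m * m)%N]add0n big_addn addKn.
by apply: eq_bigr => k _; rewrite addnC perq.
Qed.

Lemma nrm_sum_le (F : nat -> K) (B : R) n : (forall k, nrm (F k) <= B) ->
  nrm (\sum_(0 <= k < n) F k) <= n%:R * B.
Proof.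
move=> H; apply: le_trans (nrm_sum _ _ _) _.
apply: le_trans (ler_sum _ (fun k _ => H k)) _.
by rewrite sumr_const_nat subn0 mulr_natl.
Qed.

End Periodic.

Section Idempotent.
Variable m : nat.
Hypothesis m1 : (1 < m)%N.

(** The idempotent of Z/m that is 1 on the 3-part of m and 0 on its complement; it permits a change
    at the prime 3 alone. *)
Lemma idempotent3 : (12 %| m)%N ->
  exists e : nat, [/\ (e %% 4 = 0)%N, (e %% 3 = 1)%N & (e ^ 2 = e %[mod m])].
Proof.
move=> m12; have m0 : (0 < m)%N := ltnW m1.
have p3 : prime 3 by [].
have [m' c3 mE] := pfactor_coprime p3 m0.
set k := logn 3 m in mE.
have k0 : (0 < k)%N by rewrite logn_gt0 mem_primes p3 m0 /=; apply: dvdn_trans m12.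
have cop : coprime (3 ^ k) m' by rewrite coprimeXl.
have m'4 : (4 %| m')%N.
  have : (4 %| m' * 3 ^ k)%N by rewrite -mE; apply: dvdn_trans m12.
  by rewrite Gauss_dvdl// coprimeXr.
exists (chinese (3 ^ k) m' 1 0).
set e := chinese _ _ _ _.
have e1 : e = 1 %[mod 3 ^ k] := chinese_modl cop 1 0.
have e0 : e = 0 %[mod m'] := chinese_modr cop 1 0.
split.
- by rewrite -(modn_dvdm _ m'4) e0 mod0n.
- have d3 : (3 %| 3 ^ k)%N by rewrite dvdn_exp.
  by rewrite -(modn_dvdm _ d3) e1 modn_dvdm.
apply/eqP; have := chinese_remainder cop (e ^ 2) e; rewrite mulnC -mE => ->.
apply/andP; split; apply/eqP.
  by rewrite -modnXm e1 modnXm exp1n.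
by rewrite -modnXm e0 modnXm exp0n.
Qed.

Lemma val_Zp_int (x : 'Z_m) (z : int) : x = z%:~R -> ((x : nat)%:Z = z %[mod m%:Z])%Z.
Proof.
move=> xz; apply/eqP; rewrite eqz_mod_dvd.
have e : ((x : nat)%:Z - z)%:~R = 0 :> 'Z_m.
  by rewrite rmorphB /= -pmulrn natr_Zp xz subrr.
move: e; case: ((x : nat)%:Z - z) => k.
  by rewrite -pmulrn => /(congr1 (@nat_of_ord _)); rewrite val_Zp_nat//= => k0; rewrite dvdzE /= /dvdn k0.
rewrite NegzE mulrNz -pmulrn => /eqP; rewrite oppr_eq0 => /eqP.
by move=> /(congr1 (@nat_of_ord _)); rewrite val_Zp_nat//= => k0; rewrite dvdzE abszN /= /dvdn k0.
Qed.

End Idempotent.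

Section Lattice.
Variables (R : realType) (m : nat).
Hypothesis m1 : (1 < m)%N.
Hypothesis m12 : (12 %| m)%N.
Let m6 : (6 %| m)%N. Proof. exact: dvdn_trans m12. Qed.
Local Notation K := R[i].
Variable h : {ffun {unit 'Z_m} -> 'Z_(char_order m)}.
Hypothesis hh : hom h.

Definition latt (a b : nat) : K := psi R (GI a%:Z b%:Z) * chi R m1 h (a ^ 2 + b ^ 2).

Lemma latt_mod a b a' b' : a = a' %[mod m] -> b = b' %[mod m] -> latt a b = latt a' b'.
Proof.
move=> ha hb; rewrite /latt; congr (_ * _).
  rewrite /psi; congr tok; apply: psig_mod => /=.
    by move/(congr1 (fun x => x %% 6)%N): ha; rewrite !modn_dvdm//; lia.
  by move/(congr1 (fun x => x %% 6)%N): hb; rewrite !modn_dvdm//; lia.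
rewrite -chi_mod// -[RHS]chi_mod//; congr (chi R m1 h _).
by rewrite -modnDm -modnXm ha modnXm -(modnXm _ _ b) hb modnXm modnDm.
Qed.

Lemma nrm_latt a b : nrm (latt a b) <= 1.
Proof.
rewrite nrmM -[1]mulr1; apply: ler_pM; rewrite ?nrm_ge0 ?nrm_psi//.
exact: nrm_chi.
Qed.

(* Multiplication by an element congruent to i mod the 3-part of m and to 1 mod its complement
   preserves the norm mod m and changes the sign of psi. *)
Lemma latt_period : \sum_(0 <= a < m) \sum_(0 <= b < m) latt a b = 0.
Proof.
have [e [e2 e3 ee]] := idempotent3 m1 m12.
have -> : \sum_(0 <= a < m) \sum_(0 <= b < m) latt a b =
   \sum_(u : 'Z_m * 'Z_m) latt u.1 u.2.
  rewrite -(pair_big xpredT xpredT (fun a b : 'Z_m => latt a b)) /=.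
  rewrite -{1}(Zp_cast m1) big_mkord; apply: eq_bigr => a _.
  by rewrite -{1}(Zp_cast m1) big_mkord.
pose E : 'Z_m := e%:R.
have EE : E * E = E.
  by rewrite /E -natrM; apply: ord_inj; rewrite !val_Zp_nat// mulnn.
(* Multiplication by 1 - E + i E, whose norm 1 - 2 E + 2 E^2 is 1 because E is idempotent; the
   inverse is multiplication by the conjugate. *)
pose f (u : 'Z_m * 'Z_m) := ((1 - E) * u.1 - E * u.2, (1 - E) * u.2 + E * u.1).
have fi : injective f.
  apply: (can_inj (g := fun u => ((1 - E) * u.1 + E * u.2, (1 - E) * u.2 - E * u.1))).
  move=> [x y]; rewrite /f /=; congr pair.
    have -> : (1 - E) * ((1 - E) * x - E * y) + E * ((1 - E) * y + E * x) =
       x + 2%:R * (E * E - E) * x by ring.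
    by rewrite EE subrr mulr0 mul0r addr0.
  have -> : (1 - E) * ((1 - E) * y + E * x) - E * ((1 - E) * x - E * y) =
     y + 2%:R * (E * E - E) * y by ring.
  by rewrite EE subrr mulr0 mul0r addr0.
set S := \sum_u _.
have SN : S = - S.
  rewrite {1}/S (reindex_inj fi) /S -sumrN; apply: eq_bigr => -[x y] _.
  pose x' : 'Z_m := (1 - E) * x - E * y; pose y' : 'Z_m := (1 - E) * y + E * x.
  change (latt x' y' = - latt x y).
  have n1 : x' * x' + y' * y' = x * x + y * y.
    have -> : x' * x' + y' * y' = (x * x + y * y) * (1 + 2%:R * (E * E - E)).
      by rewrite /x' /y'; ring.
    by rewrite EE subrr mulr0 addr0 mulr1.
  rewrite /latt -mulNr; congr (_ * _); last first.
    rewrite -chi_mod// -[RHS]chi_mod//; congr (chi R m1 h _).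
    have : ((x' : nat) ^ 2 + (y' : nat) ^ 2)%N%:R = ((x : nat) ^ 2 + (y : nat) ^ 2)%N%:R :> 'Z_m.
      by rewrite !natrD !natrX !natr_Zp.
    by move/(congr1 (@nat_of_ord _)); rewrite !val_Zp_nat.
  have -> : - psi R (GI (x : nat)%:Z (y : nat)%:Z) =
     psi R (GI (1 - e%:Z) e%:Z * GI (x : nat)%:Z (y : nat)%:Z).
    rewrite psiM -mulN1r; congr (_ * _); rewrite /psi.
    have -> : psig (GI (1 - e%:Z) e%:Z) = -1.
      rewrite /psig /= eps_mod sqr3_mod.
      have -> : ((1 - e%:Z) %% 2)%Z = 1 by lia.
      have -> : (e%:Z %% 2)%Z = 0 by lia.
      have -> : ((1 - e%:Z) %% 3)%Z = 0 by lia.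
      have -> : (e%:Z %% 3)%Z = 1 by lia.
      by [].
    by rewrite tokN tok1.
  rewrite /psi; congr tok.
  have m6' (u v : int) : (u = v %[mod m%:Z])%Z -> (u = v %[mod 6])%Z.
    move/eqP; rewrite eqz_mod_dvd => duv; apply/eqP; rewrite eqz_mod_dvd.
    by apply: dvdz_trans duv; rewrite dvdzE.
  apply: psig_mod; apply: m6'; rewrite ?greM ?gimM; cbn [gre gim].
    apply: (val_Zp_int m1); rewrite rmorphB !rmorphM rmorphB /= -!pmulrn !natr_Zp.
    by [].
  apply: (val_Zp_int m1); rewrite rmorphD !rmorphM rmorphB /= -!pmulrn !natr_Zp.
  by [].
have : 2%:R * S = 0 by rewrite mulr_natl mulr2n {1}SN addNr.
by move/eqP; rewrite mulf_eq0 pnatr_eq0 /= => /eqP.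
Qed.

Definition lrow a := \sum_(0 <= b < m) latt a b.

Lemma lrow_period a : lrow (a + m) = lrow a.
Proof. by apply: eq_bigr => b _; apply: latt_mod => //; rewrite modnDr. Qed.

Lemma nrm_lrow a : nrm (lrow a) <= m%:R.
Proof.
by apply: le_trans (nrm_sum_le _ (fun b => nrm_latt a b)) _; rewrite mulr1.
Qed.

Let m0 : (0 < m)%N := ltnW m1.

Lemma lrow_sum k : nrm (\sum_(0 <= j < k) lrow j.+1) <= m%:R * m%:R + m%:R.
Proof.
have -> : \sum_(0 <= j < k) lrow j.+1 = \sum_(0 <= a < k.+1) lrow a - lrow 0.
  by rewrite big_nat_recl// addrC addKr.
apply: le_trans (nrmB _ _) _; apply: lerD; last exact: nrm_lrow.
rewrite (periodic_sum _ m0 lrow_period) latt_period mulr0 add0r.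
apply: le_trans (nrm_sum_le _ nrm_lrow) _; apply: ler_wpM2r; first exact: ler0n.
by rewrite ler_nat ltnW// ltn_mod.
Qed.

Lemma isq_le_sq x : (isq x)%:R <= sq R x.
Proof.
rewrite -[_%:R]ger0_norm ?ler0n// -sqrtr_sqr ler_sqrt ?ler0n//.
by rewrite -natrX ler_nat; have := isqP x; nia.
Qed.

(** Each row a <= sqrt x consists of W a / m full periods and a remainder of fewer than m terms. The
    remainders cost m sqrt x. The number of full periods decreases with a while the partial sums of
    [lrow] stay bounded thanks to [latt_period], so that Abel summation leaves O(sqrt x). *)
Lemma lattice_bound x : (0 < x)%N ->
  nrm (\sum_(1 <= n < x.+1) chi R m1 h n * qsum R n) <= (2 * (m%:R * m%:R + m%:R) + m%:R) * sq R x.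
Proof.
move=> x0; set s := isq x.
have -> : \sum_(1 <= n < x.+1) chi R m1 h n * qsum R n =
   \sum_(1 <= a < s.+1) \sum_(0 <= b < (isq (x - a ^ 2)).+1) latt a b.
  rewrite -(sum_quarter_disc (fun n a b => psi R (GI a%:Z b%:Z) * chi R m1 h n)).
  apply: eq_bigr => n _; rewrite /qsum mulr_sumr; apply: eq_bigr => a _.
  by rewrite mulr_sumr; apply: eq_bigr => b _; rewrite mulrC.
pose W a := (isq (x - a ^ 2)).+1.
pose rest a := \sum_(0 <= b < W a %% m) latt a b.
have rowE a : \sum_(0 <= b < (isq (x - a ^ 2)).+1) latt a b =
   lrow a * ((W a %/ m)%:R : R)%:C%C + rest a.
  have per b : latt a (b + m) = latt a b by apply: latt_mod => //; rewrite modnDr.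
  by rewrite (periodic_sum _ m0 per) rmorph_nat mulrC.
under eq_bigr do rewrite rowE.
rewrite big_split /= !big_add1 /=; apply: le_trans (nrmD _ _) _; rewrite mulrDl; apply: lerD.
  apply: le_trans (@abel_bound R (fun j => lrow j.+1) (fun j => (W j.+1 %/ m)%:R) _ _ lrow_sum _ _) _.
  - move=> k; rewrite ler_nat; apply: leq_div2r; rewrite ltnS; apply: isq_mono; nia.
  - by move=> k; exact: ler0n.
  rewrite [2 * _]mulrC -mulrA; apply: ler_wpM2l; first by rewrite addr_ge0 ?mulr_ge0 ?ler0n.
  apply: le_trans (_ : _ <= (W 1%N)%:R) _; first by rewrite ler_nat leq_div.
  rewrite /W -natr1.
  have h1 := isq_le_sq (x - 1 ^ 2); have h2 : sq R (x - 1 ^ 2) <= sq R x by apply: sq_le; lia.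
  have h3 := sq_ge1 R x0; lra.
apply: le_trans (nrm_sum _ _ _) _.
apply: le_trans (_ : _ <= \sum_(0 <= j < s) m%:R) _.
  apply: ler_sum => j _; apply: le_trans (nrm_sum_le _ (fun b => nrm_latt j.+1 b)) _.
  by rewrite mulr1 ler_nat ltnW// ltn_mod.
rewrite sumr_const_nat subn0 -[X in X <= _]mulr_natr; apply: ler_wpM2l; first exact: ler0n.
exact: isq_le_sq.
Qed.

End Lattice.

Section QsumAbs.
Variable R : realType.

Lemma sum_nrm_qsum x : (0 < x)%N -> \sum_(1 <= n < x.+1) nrm (qsum R n) <= 2 * x%:R.
Proof.
move=> x0; set s := isq x.
apply: le_trans (_ : _ <= \sum_(1 <= n < x.+1) \sum_(1 <= a < n.+1)
   \sum_(0 <= b < n.+1 | (a ^ 2 + b ^ 2 == n)%N) 1) _.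
  apply: ler_sum => n _; apply: le_trans (nrm_sum _ _ _) _; apply: ler_sum => a _.
  by apply: le_trans (nrm_sum _ _ _) _; apply: ler_sum => b _; exact: nrm_psi.
rewrite (sum_quarter_disc (fun _ _ _ => 1 : R)).
apply: le_trans (_ : _ <= \sum_(1 <= a < s.+1) s.+1%:R) _.
  apply: ler_sum_nat => a _; rewrite sumr_const_nat subn0 ler_nat ltnS.
  by apply: isq_mono; lia.
rewrite sumr_const_nat subn1 /= -[X in X <= _]mulr_natr -!natrM ler_nat.
by have := isqP x; rewrite -/s; nia.
Qed.

End QsumAbs.

(** Modulo 3, an element of norm 1 is a power of i, with square 1 or - 1; an element of norm 2 is 1
    + i up to such a power, with square i or - i. *)
Lemma psig_conj3 (a : gi) :
  ((gnorm a %% 3)%Z = 1 -> conjgi (psig a) = psig a) /\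
  ((gnorm a %% 3)%Z = 2 -> conjgi (psig a) = - psig a).
Proof.
rewrite /gnorm !expr2 modzMD /psig eps_mod sqr3_mod.
case: (mod2_case (gre a)) (mod2_case (gim a)) (mod3_case (gre a)) (mod3_case (gim a))
  => -> [] -> [] -> [] ->; by split.
Qed.

(** * Nonvanishing of the twisted series *)

Section Twisted.
Variables (R : realType) (m : nat).
Hypothesis m1 : (1 < m)%N.
Hypothesis m12 : (12 %| m)%N.
Local Notation K := R[i].
Local Notation U := {unit 'Z_m}.
Local Notation N := (char_order m).
Local Notation X := {ffun U -> 'Z_N}.
Local Notation chim := (chi R m1).
Local Notation Ssumm := (Ssum R m1).

Definition half : 'Z_N := #|[set: U]|%:R.
Let N1 : (1 < N)%N := char_order_gt1 m1.

Lemma half_double : half + half = 0.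
Proof. by rewrite /half -natrD addnn -mul2n pchar_Zp. Qed.

Lemma half_neq0 : half != 0.
Proof.
apply/eqP => /(congr1 (@nat_of_ord _)); rewrite val_Zp_nat//= modn_small.
  by have := cardG_gt0 [set: U]%G => /[swap] ->.
by rewrite /char_order; have := cardG_gt0 [set: U]%G; move: #|_| => c; case: c => // c; lia.
Qed.

Lemma zeta_half : zeta R m1 ^+ half = -1.
Proof.
have e : (zeta R m1 ^+ half) ^+ 2 = 1 by rewrite expr2 -zetaD half_double.
have /eqP := e; rewrite sqrf_eq1 => /orP[|/eqP//].
by rewrite zeta_eq1 (negPf half_neq0).
Qed.

Section Sign.
Variables (d : nat) (s : nat -> bool).
Hypothesis dm : (d %| m)%N.
Hypothesis smod : forall k, s (k %% d) = s k.
Hypothesis sM : forall k l, coprime d k -> coprime d l -> s (k * l) = s k (+) s l.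

(** The quadratic character mod d with sign function s, read modulo m. *)
Definition hsign : X := [ffun u => if s (val u : 'Z_m) then half else 0].

Lemma coprime_val u : coprime d (val (u : U) : 'Z_m).
Proof.
have [k mk ->] := toU_surj m1 u.
rewrite (coprime_dvdl dm)// val_toU// val_Zp_nat// coprime_modr//.
Qed.

Lemma s_natZ k : s ((k%:R : 'Z_m) : nat) = s k.
Proof. by rewrite val_Zp_nat// -smod modn_dvdm// smod. Qed.

Lemma hsign_hom : hom hsign.
Proof.
apply/homP => u v; rewrite !ffunE.
have -> : s (val (u * v)%g : 'Z_m) = s (val u : 'Z_m) (+) s (val v : 'Z_m).
  rewrite -sM ?coprime_val// -[RHS]s_natZ natrM !natr_Zp.
  by rewrite FinRing.val_unitM.
by case: (s (val u : 'Z_m)); case: (s (val v : 'Z_m)); rewrite /= ?add0r ?addr0 ?half_double.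
Qed.

Lemma hsignE k : coprime m k -> hsign (toU m k) = if s k then half else 0.
Proof. by move=> mk; rewrite ffunE val_toU// s_natZ. Qed.

Lemma chi_hsign k : coprime m k -> chim hsign k = (-1) ^+ s k.
Proof.
move=> mk; rewrite /chi mk /ev hsignE//.
by case: (s k); rewrite ?zeta_half ?expr1 ?expr0.
Qed.
End Sign.

Definition s4 (k : nat) := (k %% 4 == 3)%N.
Definition s3 (k : nat) := (k %% 3 == 2)%N.
Definition h4 := hsign s4.
Definition h3 := hsign s3.

Let d4 : (4 %| m)%N. Proof. exact: dvdn_trans m12. Qed.
Let d3 : (3 %| m)%N. Proof. exact: dvdn_trans m12. Qed.

Lemma s4mod k : s4 (k %% 4) = s4 k. Proof. by rewrite /s4 modn_mod. Qed.
Lemma s3mod k : s3 (k %% 3) = s3 k. Proof. by rewrite /s3 modn_mod. Qed.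
Lemma s4M k l : coprime 4 k -> coprime 4 l -> s4 (k * l) = s4 k (+) s4 l.
Proof.
rewrite -(coprime_modr 4 k) -(coprime_modr 4 l) /s4 -modnMm.
have : (k %% 4 < 4)%N by rewrite ltn_mod.
have : (l %% 4 < 4)%N by rewrite ltn_mod.
by move: (k %% 4)%N (l %% 4)%N => [|[|[|[|a]]]] [|[|[|[|b]]]].
Qed.
Lemma s3M k l : coprime 3 k -> coprime 3 l -> s3 (k * l) = s3 k (+) s3 l.
Proof.
rewrite -(coprime_modr 3 k) -(coprime_modr 3 l) /s3 -modnMm.
have : (k %% 3 < 3)%N by rewrite ltn_mod.
have : (l %% 3 < 3)%N by rewrite ltn_mod.
by move: (k %% 3)%N (l %% 3)%N => [|[|[|a]]] [|[|[|b]]].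
Qed.

Definition h4_hom : hom h4 := hsign_hom d4 s4mod s4M.
Definition h3_hom : hom h3 := hsign_hom d3 s3mod s3M.

(* u is -1 mod the 3-part of m and 1 mod its complement: it shows that neither h3 nor h3 - h4 is
   the double of a character. *)
Lemma involution3 : exists u : U, [/\ (u * u)%g = 1%g, h3 u = half & h4 u = 0].
Proof.
have [e [e4 e3 ee]] := idempotent3 m1 m12.
pose E : 'Z_m := e%:R.
have EE : E * E = E.
  by rewrite /E -natrM; apply: ord_inj; rewrite !val_Zp_nat// mulnn.
pose w : 'Z_m := 1 - 2%:R * E.
have ww : w * w = 1.
  have -> : w * w = 1 + 4%:R * (E * E - E) by rewrite /w; ring.
  by rewrite EE subrr mulr0 addr0.
have wu : w \is a GRing.unit by apply/unitrP; exists w.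
have wz := @val_Zp_int m m1 w (1 - 2 * e%:Z).
have {wz} wz : ((w : nat)%:Z = 1 - 2 * e%:Z %[mod m%:Z])%Z.
  by apply: wz; rewrite rmorphB rmorphM /= -!pmulrn.
have w12 : ((w : nat)%:Z = 1 - 2 * e%:Z %[mod 12])%Z.
  move/eqP: wz; rewrite eqz_mod_dvd => duv; apply/eqP; rewrite eqz_mod_dvd.
  by apply: dvdz_trans duv; rewrite dvdzE.
exists (FinRing.unit 'Z_m wu); split.
- by apply: val_inj; rewrite FinRing.val_unitM.
- rewrite ffunE /= (_ : s3 w)// /s3; move: w12; move: (w : nat) => k; lia.
- rewrite ffunE /= (_ : s4 w = false)// /s4; move: w12; move: (w : nat) => k; lia.
Qed.

Lemma h4_neq0 : h4 != 0.
Proof.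
apply/eqP => /ffunP/(_ (toU m m.-1)); rewrite [RHS]ffunE /h4.
have cm : coprime m m.-1 by rewrite coprime_sym coprimePn; lia.
rewrite (hsignE d4 s4mod cm) (_ : s4 m.-1); last by rewrite /s4; lia.
by move/eqP; rewrite (negPf half_neq0).
Qed.

Lemma double_neq h g : hom h -> (g = h3 \/ g = h3 - h4) -> h + h != g.
Proof.
move=> hh gE; have [u [uu u3 u4]] := involution3.
apply/eqP => /ffunP/(_ u); rewrite ffunE -((homP _ hh) u u) uu hom1//.
have -> : g u = half.
  case: gE => ->; first exact: u3.
  have -> : (h3 - h4) u = h3 u - h4 u by rewrite !ffunE.
  by rewrite u3 u4 subr0.
by move/eqP; rewrite eq_sym (negPf half_neq0).
Qed.

(* tv (p ^ k) is the sum of the k-th powers of the two Satake parameters of psi at p. *)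
Definition Aext := cmulext (Aval R).
Definition Bext := cmulext (Bval R).
Definition tv n : K := Aext n + Bext n.
Definition Tsum (h : X) := Lsum (fun n => chim h n * (tv n * mangK R n)).

Lemma nrm_cmulext (a : nat -> K) n : (forall p, nrm (a p) <= 1) -> nrm (cmulext a n) <= 1.
Proof.
move=> H; rewrite /cmulext; elim/big_ind: _ => [|x y hx hy|p _]; first by rewrite nrm1.
  by rewrite nrmM -[1]mulr1 ler_pM ?nrm_ge0.
by rewrite nrmX exprn_ile1 ?nrm_ge0.
Qed.

Lemma nrm_Aval p : nrm (Aval R p) <= 1.
Proof.
by rewrite /Aval; case: ifP => _; [exact: nrm_psi|case: ifP; rewrite ?nrm0 ?nrm1].
Qed.
Lemma nrm_Bval p : nrm (Bval R p) <= 1.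
Proof.
by rewrite /Bval; case: ifP => _; [exact: nrm_psi|case: ifP; rewrite ?nrm0 ?nrmN ?nrm1].
Qed.

Lemma nrm_tv n : nrm (tv n) <= 2.
Proof.
apply: le_trans (nrmD _ _) _.
have := nrm_cmulext n nrm_Aval; have := nrm_cmulext n nrm_Bval; rewrite -/Aext -/Bext; lra.
Qed.

(** The convolution is chi times [qsum], whose absolute values are bounded on average by counting
    lattice points; the bound by the number of divisors would lose a logarithm. *)
Lemma Tsum_dichotomy h : hom h -> asym (Tsum h) 0 \/ asym (Tsum h) (-1).
Proof.
move=> hh; pose A n := chim h n * Aext n; pose B n := chim h n * Bext n.
have cc := chi_cmul R m1 hh.
have cmulM (f g : nat -> K) : cmul f -> cmul g -> cmul (fun n => f n * g n).
  move=> [f1 fM] [g1 gM]; split; first by rewrite f1 g1 mulr1.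
  by move=> a b a0 b0; rewrite fM// gM// mulrACA.
have Ac : cmul A by apply: cmulM => //; exact: cmulext_cmul.
have Bc : cmul B by apply: cmulM => //; exact: cmulext_cmul.
have A1 n : (0 < n)%N -> nrm (A n) <= 1.
  move=> _; rewrite nrmM -[1]mulr1; apply: ler_pM; rewrite ?nrm_ge0 ?nrm_chi//.
  exact: nrm_cmulext nrm_Aval.
have B1 n : (0 < n)%N -> nrm (B n) <= 1.
  move=> _; rewrite nrmM -[1]mulr1; apply: ler_pM; rewrite ?nrm_ge0 ?nrm_chi//.
  exact: nrm_cmulext nrm_Bval.
have fE n : (0 < n)%N -> conv A B n = chim h n * qsum R n.
  by move=> n0; rewrite conv_cmul// qsum_conv.
pose M : R := 2 * (m%:R * m%:R + m%:R) + m%:R.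
have M0 : 0 <= M by rewrite /M !addr_ge0 ?mulr_ge0 ?addr_ge0 ?mulr_ge0 ?ler0n.
have M2 : 2 <= 8 * M.
  rewrite /M -!natrM -!natrD -!natrM -!natrD -!natrM ler_nat; nia.
have [L HL] : exists L, forall x, (0 < x)%N ->
    nrm (Lsum (conv A B) x - L) <= 8 * M * (sq R x)^-1.
  apply: Lsum_limit => x x0; rewrite (eq_big_nat _ _ (F2 := fun n => chim h n * qsum R n)).
    exact: lattice_bound.
  by move=> n /andP[n0 _]; exact: fE.
have C0 : 0 <= 8 * M by rewrite mulr_ge0.
have fabs x : (0 < x)%N -> \sum_(1 <= k < x.+1) nrm (conv A B k) <= 8 * M * x%:R.
  move=> x0; apply: le_trans (_ : _ <= 2 * x%:R) _; last by rewrite ler_wpM2r ?ler0n.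
  apply: le_trans (sum_nrm_qsum R x0); apply: ler_sum_nat => k /andP[k0 _].
  rewrite fE// nrmM -[X in _ <= X]mul1r; apply: ler_wpM2r; first exact: nrm_ge0.
  exact: nrm_chi.
have vE x : (0 < x)%N -> Lsum (fun n => (A n + B n) * mangK R n) x = Tsum h x.
  move=> x0; apply: eq_bigr => n _; congr (_ * _).
  by rewrite /A /B /tv; ring.
have [L0|L0] := eqVneq L 0.
  by right; apply: asym_ext vE _; exact: (vanishing_asym Ac Bc A1 B1 C0 fabs HL L0).
by left; apply: asym_ext vE _; exact: (nonvanishing_asym Ac Bc A1 B1 C0 HL L0).
Qed.

Lemma tvX p k : prime p -> tv (p ^ k) = Aval R p ^+ k + Bval R p ^+ k.
Proof.
move=> pp; have p0 := prime_gt0 pp.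
rewrite /tv /Aext /Bext !cmulX//; try exact: cmulext_cmul.
by rewrite !cmulext_prime.
Qed.

Lemma coprime_m_prime p k : prime p -> (0 < k)%N -> coprime m (p ^ k) -> (3 < p)%N.
Proof.
move=> pp k0; rewrite coprime_sym coprime_pexpl// => cp.
have : coprime p 12 by apply: coprime_dvdr cp.
rewrite prime_coprime// -[12%N]/(2 ^ 2 * 3)%N Euclid_dvdM// Euclid_dvdX// andbT.
by have := prime_gt1 pp; case: p pp {cp} => [|[|[|[|p]]]].
Qed.

Lemma inert_tv p k : prime p -> (3 < p)%N -> (p %% 4 != 1)%N ->
  tv (p ^ k) = if odd k then 0 else 2%:R.
Proof.
move=> pp p3 p4; rewrite tvX// /Aval /Bval (negPf p4) leqNgt p3 /= expr1n -signr_odd.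
by case: (odd k); rewrite ?expr1 ?expr0 ?subrr// -(natrD _ 1 1).
Qed.

Lemma sign_expn (d : nat) (s : nat -> bool) p k : (1 < d)%N -> coprime d p ->
  s 1%N = false -> (forall k l, coprime d k -> coprime d l -> s (k * l)%N = s k (+) s l) ->
  s (p ^ k)%N = odd k && s p.
Proof.
move=> d1 dp s1 sM; elim: k => [|k IH]; first by rewrite expn0 s1.
rewrite expnS sM ?coprimeXr// IH /=.
by case: (odd k); case: (s p).
Qed.

(** Where the character mod 4 is - 1, namely at the odd powers of a prime p = 3 mod 4, tv
    vanishes. *)
Lemma tv_chi4 n : coprime m n -> chim h4 n * (tv n * mangK R n) = tv n * mangK R n.
Proof.
move=> mn; have [mn0|/mangoldt_neq0[p [k [pp k0 nE]]]] := eqVneq (mangoldt R n) 0.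
  by rewrite /mangK mn0 !mulr0.
rewrite nE in mn *; have p3 := coprime_m_prime pp k0 mn.
rewrite (chi_hsign d4 s4mod mn).
have op : odd p by case: (even_prime pp) => // e; rewrite e in p3.
have cp : coprime 4 p by rewrite -[4%N]/(2 ^ 2)%N coprimeXl// coprime2n.
rewrite (@sign_expn 4 s4 p k)//; last exact: s4M.
have [p4|p4] := boolP (p %% 4 == 1)%N.
  have -> : s4 p = false by rewrite /s4 (eqP p4).
  by rewrite andbF expr0 mul1r.
rewrite inert_tv//; case: (odd k); first by rewrite !mul0r mulr0.
by rewrite expr0 mul1r.
Qed.

Lemma conj_psi (a : gi) : conjc (psi R a) = psi R (conjgi a).
Proof. by rewrite /psi psig_conj /tok /= rmorphN. Qed.

Lemma conj_psi3 (a : gi) (p : nat) : gnorm a = p%:Z -> coprime 3 p ->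
  conjc (psi R a) = (-1) ^+ s3 p * psi R a.
Proof.
move=> aN cp; have [h1 h2] := psig_conj3 a; rewrite aN in h1 h2.
have e : conjc (psi R a) = tok R (conjgi (psig a)) by rewrite /psi /tok /= rmorphN.
have [p1|p2] : (p %% 3 = 1)%N \/ (p %% 3 = 2)%N.
  have : ~~ (3 %| p)%N by rewrite -prime_coprime.
  lia.
  by rewrite e h1 /s3 ?p1 ?mul1r//; lia.
rewrite e h2 /s3 ?p2 ?tokN ?mulN1r//; lia.
Qed.

(** Conjugation multiplies psi a by the character mod 3 of the norm of a. In this form it leads from
    h to - h + h3, which never equals h, whereas - h may. *)
Lemma tv_conj n : coprime m n ->
  conjc (tv n * mangK R n) = chim h3 n * (tv n * mangK R n).
Proof.
move=> mn; have [mn0|/mangoldt_neq0[p [k [pp k0 nE]]]] := eqVneq (mangoldt R n) 0.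
  by rewrite /mangK mn0 !mulr0 rmorph0.
rewrite rmorphM mulrA; congr (_ * _); last exact: conjc_real.
rewrite nE in mn *; have p3 := coprime_m_prime pp k0 mn.
rewrite (chi_hsign d3 s3mod mn).
have cp : coprime 3 p by rewrite prime_coprime// dvdn_prime2//; lia.
rewrite (@sign_expn 3 s3 p k)//; last exact: s3M.
have [p4|p4] := boolP (p %% 4 == 1)%N; last first.
  rewrite inert_tv//; case: (odd k); first by rewrite rmorph0 mulr0.
  by rewrite rmorph_nat expr0 mul1r.
have [piN _ _ _] := gprimeP pp (eqP p4).
have -> : (-1 : K) ^+ (odd k && s3 p) = ((-1) ^+ s3 p) ^+ k.
  by rewrite -exprM mulnC -signr_odd oddM; case: (s3 p); rewrite ?andbT ?andbF.
rewrite tvX// rmorphD !rmorphXn /= mulrDr -!exprMn /Aval /Bval p4.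
by rewrite -!(conj_psi3 _ cp) ?gnorm_conj.
Qed.

Lemma Tsum_h4 h x : Tsum (h + h4) x = Tsum h x.
Proof.
apply: eq_bigr => n _; congr (_ * _); rewrite chiD.
have [mn|mn] := boolP (coprime m n); last by rewrite /chi (negPf mn) !mul0r.
by rewrite -mulrA tv_chi4.
Qed.

Lemma Tsum_conj h x : conjc (Tsum h x) = Tsum (- h + h3) x.
Proof.
rewrite conj_Lsum; apply: eq_bigr => n _; congr (_ * _); rewrite rmorphM chiD /=.
rewrite chi_conj.
have [mn|mn] := boolP (coprime m n); last by rewrite /chi (negPf mn) !mul0r.
by rewrite tv_conj// -[RHS]mulrA.
Qed.

(* If the series twisted by h vanishes at 1, so do those twisted by h + h4 and h3 - h, and these
   three characters are distinct. Since 2 + tv >= 0, summing 2 * Ssum + Tsum over all characters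
   gives a nonnegative quantity, of main term at most (2 - 3) ln x. *)
Lemma asym_Tsum h : hom h -> asym (Tsum h) 0.
Proof.
move=> hh; have [//|Th] := Tsum_dichotomy hh; exfalso.
have T1 : asym (Tsum h) (-1 : R)%:C%C by rewrite rmorphN1.
have T4 : asym (Tsum (h + h4)) (-1 : R)%:C%C.
  by apply: asym_ext T1 => x _; rewrite Tsum_h4.
have T3 : asym (Tsum (- h + h3)) (-1 : R)%:C%C.
  by apply: asym_ext (asym_conj T1) => x _; rewrite Tsum_conj.
have hh4 : hom (h + h4) by apply: homD => //; exact: h4_hom.
have hh3 : hom (- h + h3) by apply: homD; [exact: homN|exact: h3_hom].
have n1 : h + h4 != h by rewrite -subr_eq0 addrAC subrr add0r h4_neq0.
have n2 : - h + h3 != h.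
  have := double_neq hh (or_introl (erefl h3)); apply: contra => /eqP e.
  by rewrite -{2}e addrA subrr add0r.
have n3 : - h + h3 != h + h4.
  have := double_neq hh (or_intror (erefl (h3 - h4))); apply: contra => /eqP e.
  by rewrite -(inj_eq (addIr h4)) subrK -addrA -e addrA subrr add0r.
pose c (g : X) : R := if g \in [:: h; h + h4; - h + h3] then -1 else 0.
have cs : \sum_(g | hom g) c g = -3.
  rewrite (bigD1 h)//= (bigD1 (h + h4)) ?hh4 ?n1//= (bigD1 (- h + h3)) ?hh3 ?n2 ?n3//=.
  rewrite big1 ?addr0; first by rewrite /c !inE !eqxx !orbT /=; ring.
  move=> g /andP[/andP[/andP[_ g1] g2] g3].
  by rewrite /c !inE (negPf g1) (negPf g2) (negPf g3).
have UT : ubd (fun x => \sum_(g | hom g) Tsum g x) (\sum_(g | hom g) c g).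
  apply: ubd_sum => g hg; rewrite /c; case: ifP => [|_].
    by rewrite !inE => /or3P[] /eqP ->; apply: asym_ubd.
  have [Tg|Tg] := Tsum_dichotomy hg; first by apply: asym_ubd.
  have : ubd (Tsum g) (-1) by apply: asym_ubd; rewrite rmorphN1.
  by case=> C HC; exists C => x x0; have := HC x x0; have := lnn_ge0 R x; lra.
pose c0 (g : X) : R := (g == 0)%:R.
have US : ubd (fun x => \sum_(g | hom g) Ssumm g x) (\sum_(g | hom g) c0 g).
  apply: ubd_sum => g hg; rewrite /c0; apply: asym_ubd; case: eqP => [->|/eqP g0].
    exact: asym_Ssum0.
  exact: asym_Ssum.
have cS : \sum_(g | hom g) c0 g = 1.
  rewrite (bigD1 (0 : X)) ?hom0//= /c0 eqxx big1 ?addr0// => g /andP[_ g0].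
  by rewrite /c0 (negPf g0).
rewrite cs in UT; rewrite cS in US.
have UU : ubd (fun x => 2%:R * (\sum_(g | hom g) Ssumm g x) + \sum_(g | hom g) Tsum g x) (-1).
  have [C HC] := UT; have [D HD] := US; exists (2 * D + C) => x x0.
  have -> : 2%:R = (2 : R)%:C%C by rewrite rmorph_nat.
  have Re2 (z : K) : Re ((2 : R)%:C%C * z) = 2 * Re z by case: z => a b /=; rewrite mul0r subr0.
  rewrite ReD Re2; have := HC x x0; have := HD x x0; lra.
have := ubd_ge0 UU; suff H : forall x, (0 < x)%N ->
    0 <= Re (2%:R * (\sum_(g | hom g) Ssumm g x) + \sum_(g | hom g) Tsum g x).
  by move/(_ H); lra.
move=> x x0.
have chi1 k : \sum_(g | hom g) chim g k = if k == 1 %[mod m] then #|hom (m := m)|%:R else 0.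
  rewrite -(chi_orth R m1 k (coprimen1 m)); apply: eq_bigr => g hg.
  by rewrite (chi_cmul R m1 hg).1 rmorph1 mul1r.
have -> : 2%:R * (\sum_(g | hom g) Ssumm g x) + \sum_(g | hom g) Tsum g x =
   \sum_(1 <= k < x.+1) (((k == 1 %[mod m])%:R * #|hom (m := m)|%:R * (mangoldt R k / k%:R)) : R)%:C%C
     * (2%:R + tv k).
  rewrite /Ssum /Tsum /Lsum exchange_big [X in _ + X]exchange_big /= mulr_sumr -big_split.
  apply: eq_bigr => k _ /=; rewrite -!mulr_sumr -!mulr_suml chi1.
  rewrite iv_real /mangK; case: ifP => _; last by rewrite !(mul0r, mulr0, addr0, rmorph0).
  rewrite !rmorphM !rmorph_nat /= mul1r; ring.
have ReS (F : nat -> K) : Re (\sum_(1 <= k < x.+1) F k) = \sum_(1 <= k < x.+1) Re (F k).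
  by elim/big_rec2: _ => // i y1 y2 _ <-; rewrite ReD.
rewrite ReS; apply: sumr_ge0 => k _.
have Rem (a : R) (z : K) : Re (a%:C%C * z) = a * Re z by case: z => u v /=; rewrite mul0r subr0.
rewrite Rem mulr_ge0//; first by rewrite !mulr_ge0 ?ler0n ?mangoldt_ge0// invr_ge0 ler0n.
rewrite ReD -[2%:R](rmorph_nat (real_complex R)) /=.
have := le_trans (nrm_Re _) (nrm_tv k); rewrite ler_norml => /andP[]; lra.
Qed.

End Twisted.

(** * Solutions modulo p *)

Lemma Fp_nat_neq0 (p n : nat) : prime p -> ~~ (p %| n)%N -> n%:R != 0 :> 'F_p.
Proof. by move=> pp; rewrite (dvdn_pcharf (pchar_Fp pp)). Qed.

(** With s = x^2 + 3 = 2 r one has s^2 = 12 and (r - 1)^2 = 4 - s, whence s (r - 1)^2 = 4 s - 12 = 4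
    x^2. Thus s is a square and 12 a fourth power. *)
Lemma Vp_fourth_power p : prime p -> odd p -> Vp p != 0%N -> exists z : 'F_p, z ^+ 4 = 12%:R.
Proof.
move=> pp op; rewrite -lt0n card_gt0 => /set0Pn[[x y]]; rewrite inE /= => /andP[/eqP ex _].
have two0 : 2%:R != 0 :> 'F_p.
  by apply: Fp_nat_neq0 => //; rewrite dvdn_prime2//; apply: contraL op => /eqP ->.
pose s := x ^+ 2 + 3%:R; pose r := s / 2%:R.
have ss : s * s = 12%:R.
  have -> : s * s = (x ^+ 4 + 6%:R * x ^+ 2 - 3%:R) + 12%:R by rewrite /s; ring.
  by rewrite ex add0r.
have sE : s = 2%:R * r by rewrite /r mulrC divfK.
have rr : r * r = 3%:R.
  apply: (mulfI two0); apply: (mulfI two0); rewrite (_ : 2%:R * (2%:R * (r * r)) = s * s).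
    by rewrite ss -!natrM.
  by rewrite sE; ring.
have r1 : r - 1 != 0.
  rewrite subr_eq0; apply/eqP => e; move/eqP: rr; rewrite e mulr1 eq_sym -subr_eq0.
  by rewrite -(natrB _ (_ : 1 <= 3)%N)// (negPf two0).
pose t := 2%:R * x / (r - 1).
have tt : t ^+ 2 = s.
  have h : s * (r - 1) ^+ 2 = (2%:R * x) ^+ 2.
    have -> : (r - 1) ^+ 2 = r * r - 2%:R * r + 1 by ring.
    rewrite rr -sE (_ : s * (3%:R - s + 1) = 4%:R * s - s * s); last by ring.
    by rewrite ss /s; ring.
  by rewrite /t expr_div_n -h mulfK// expf_neq0.
by exists t; rewrite -[4%N]/(2 * 2)%N exprM tt expr2.
Qed.

Section VanishingPrimes.
Let R : realType := Rdefinitions.R.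
Local Notation K := R[i].

Lemma psig_one (a : gi) : (2 %| gre a - 1)%Z -> (2 %| gim a)%Z ->
  (3 %| gre a ^+ 2 - gim a ^+ 2 - 1)%Z -> (3 %| 2 * gre a * gim a)%Z -> psig a = 1.
Proof.
move=> h1 h2 h3 h4.
have e2 : (gre a %% 2)%Z = 1 by lia.
have e3 : (gim a %% 2)%Z = 0 by lia.
have h5 : ((gre a * gre a - gim a * gim a) %% 3)%Z = 1 by move: h3; rewrite !expr2; lia.
have h6 : ((gre a * gim a + gim a * gre a) %% 3)%Z = 0.
  have -> : gre a * gim a + gim a * gre a = 2 * gre a * gim a by ring.
  exact/dvdz_mod0P.
rewrite /psig eps_mod sqr3_mod e2 e3; move: h5 h6; rewrite modzMB modzMD.
by case: (mod3_case (gre a)) (mod3_case (gim a)) => -> [] ->.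
Qed.

Lemma prime_class_Vp0 (m c : nat) : (1 < m)%N -> (12 %| m)%N -> coprime m c ->
  (c %% 12 = 1)%N -> exists p, [/\ prime p, p = c %[mod m] & Vp p = 0%N].
Proof.
move=> m1 m12 mc c1; apply: contrapT => none.
have Vpos p : prime p -> p = c %[mod m] -> Vp p != 0%N.
  by move=> pp pc; apply/eqP => V0; apply: none; exists p.
have tv2 p : prime p -> p = c %[mod m] -> tv R p = 2%:R.
  move=> pp pc.
  have p12 : (p %% 12 = 1)%N.
    by move/(congr1 (fun x => x %% 12)%N): pc; rewrite !modn_dvdm// c1.
  have p4 : (p %% 4 = 1)%N by lia.
  have op : odd p by lia.
  have [_ h1 h2 h3] := gprimeP pp p4.
  have /andP[h4 h5] := h3 (Vp_fourth_power pp op (Vpos p pp pc)).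
  have e := psig_one h1 h2 h4 h5.
  rewrite -{1}(expn1 p) tvX// !expr1 /Aval /Bval p4 /=.
  by rewrite -conj_psi /psi e tok1 rmorph1 -(natrD _ 1 1).
pose W x : K := \sum_(h | hom (m := m) h) conjc (chi R m1 h c) *
   (2%:R * Ssum R m1 h x - Tsum R m1 h x).
have aW : asym W (2 : R)%:C%C.
  have -> : (2 : R)%:C%C = \sum_(h | hom (m := m) h) conjc (chi R m1 h c) *
      (2%:R * (h == 0)%:R + -1 * 0).
    rewrite (bigD1 (0 : {ffun {unit 'Z_m} -> 'Z_(char_order m)})) ?hom0//= eqxx big1 ?addr0.
      by rewrite /chi mc /ev ffunE expr0 rmorph1 mul1r mulr1 mulr0 addr0 rmorph_nat.
    by move=> h /andP[_ /negPf ->]; rewrite !mulr0 addr0 mulr0.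
  apply: asym_sum => h hh; apply: asymZ.
  apply: (@asym_ext R (fun x => 2%:R * Ssum R m1 h x + -1 * Tsum R m1 h x)).
    by move=> x _; rewrite mulN1r.
  apply: asymD; apply: asymZ; last exact: asym_Tsum.
  case: eqP => [->|/eqP h0]; first exact: asym_Ssum0.
  exact: asym_Ssum.
have WE x : W x = #|hom (m := m)|%:R *
    \sum_(1 <= k < x.+1 | k == c %[mod m]) iv R k * ((2%:R - tv R k) * mangK R k).
  rewrite /W mulr_sumr [RHS]big_mkcond /=.
  transitivity (\sum_(h | hom (m := m) h) \sum_(1 <= k < x.+1)
     conjc (chi R m1 h c) * chi R m1 h k * (iv R k * ((2%:R - tv R k) * mangK R k))).
    apply: eq_bigr => h hh; rewrite /Ssum /Tsum /Lsum mulr_sumr -sumrB mulr_sumr.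
    by apply: eq_bigr => k _; ring.
  rewrite exchange_big; apply: eq_bigr => k _ /=.
  rewrite -mulr_suml chi_orth//; case: ifP => _ //; by rewrite mul0r.
have : (2 : R) <= 0.
  (* At the primes k = c mod m the factor 2 - tv k is 0 by assumption; elsewhere its norm is at most
     4, and 12 bounds the sum over the proper prime powers. *)
  apply: (asym_bounded_le0 aW); exists (#|hom (m := m)|%:R * (4 * 12)) => x x0.
  rewrite WE nrmM nrm_nat; apply: ler_wpM2l; first exact: ler0n.
  apply: le_trans (nrm_sum _ _ _) _.
  apply: le_trans (_ : _ <= 4 * \sum_(1 <= k < x.+1 | ~~ prime k) mangoldt R k / k%:R) _; last first.
    by rewrite ler_pM2l// sum_mangoldt_nonprime.
  rewrite mulr_sumr big_mkcond [X in _ <= X]big_mkcond /=; apply: ler_sum => k _.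
  have b0 : 0 <= 4 * (mangoldt R k / k%:R) by rewrite mulr_ge0// divr_ge0 ?mangoldt_ge0 ?ler0n.
  case: ifP => [kc|_]; last by case: ifP.
  case: ifP => [_|/negbFE kp]; last first.
    by rewrite tv2//; [rewrite subrr mul0r mulr0 nrm0|exact/eqP].
  rewrite !nrmM nrm_iv nrm_ge0_real ?mangoldt_ge0//.
  rewrite mulrC -mulrA; apply: ler_pM; rewrite ?nrm_ge0//.
    by rewrite mulr_ge0 ?mangoldt_ge0 ?invr_ge0 ?ler0n.
  apply: le_trans (nrmB _ _) _; rewrite nrm_nat.
  have := nrm_tv R k; lra.
by rewrite leNgt ltr0n.
Qed.
End VanishingPrimes.

(* polP n + i polQ n = (n - i)^8 + 6 (n - i)^4 - 3 *)
Definition polP (n : int) : int := n ^+ 8 - 28 * n ^+ 6 + 76 * n ^+ 4 - 64 * n ^+ 2 + 4.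
Definition polQ (n : int) : int := 8 * n * (- n ^+ 6 + 7 * n ^+ 4 - 10 * n ^+ 2 + 4).

(* Euclid's algorithm; the resultant has only the prime factors 2, 3, 11 and 1201. *)
Lemma no_common_root (F : fieldType) (u : F) :
  u ^+ 4 - 28%:R * u ^+ 3 + 76%:R * u ^+ 2 - 64%:R * u + 4%:R = 0 ->
  - u ^+ 3 + 7%:R * u ^+ 2 - 10%:R * u + 4%:R = 0 ->
  2%:R != 0 :> F -> 3%:R != 0 :> F -> 11%:R != 0 :> F -> 1201%:R != 0 :> F -> False.
Proof.
set P := (X in X = 0 -> _) => P0; set Q := (X in X = 0 -> _) => Q0.
move=> nz2 nz3 nz11 nz1201.
pose r := 81%:R * u ^+ 2 - 150%:R * u + 80%:R.
have r0 : r = 0.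
  rewrite (_ : r = - P - u * Q + 21%:R * Q); first by rewrite P0 Q0; ring.
  by rewrite /r /P /Q; ring.
pose a : F := 36%:R * 95%:R; pose b : F := 12%:R * 593%:R.
have ab : a * u - b = 0.
  rewrite (_ : a * u - b = 81%:R * (81%:R * Q + u * r) - 417%:R * r).
    by rewrite Q0 r0; ring.
  by rewrite /a /b /Q /r; ring.
suff : 2%:R ^+ 4 * 3%:R ^+ 8 * 11%:R * 1201%:R = 0 :> F.
  by apply/eqP; do 3 (apply: mulf_neq0 => //); exact: expf_neq0.
rewrite (_ : _ * 1201%:R = a ^+ 2 * r - (81%:R * (a * u + b) - 150%:R * a) * (a * u - b)).
  by rewrite r0 ab; ring.
by rewrite /r /a /b; ring.
Qed.

Lemma sqrt3_of_root (F : fieldType) (w : F) : 2%:R != 0 :> F ->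
  w ^+ 8 + 6%:R * w ^+ 4 - 3%:R = 0 -> ((w ^+ 4 + 3%:R) / 2%:R) ^+ 2 = 3%:R.
Proof.
move=> two0 w8; rewrite expr_div_n.
rewrite (_ : (w ^+ 4 + 3%:R) ^+ 2 = (w ^+ 8 + 6%:R * w ^+ 4 - 3%:R) + 12%:R); last by ring.
by rewrite w8 add0r (_ : 12%:R = 3%:R * 2%:R ^+ 2) ?mulfK ?expf_neq0//; ring.
Qed.

(* The solution is x = w^2, y = i w (r - 1). *)
Lemma Vp_gt0_of_roots p (i w : 'F_p) : i ^+ 2 = -1 -> w ^+ 8 + 6%:R * w ^+ 4 - 3%:R = 0 ->
  2%:R != 0 :> 'F_p -> (0 < Vp p)%N.
Proof.
move=> i2 w8 two0; rewrite card_gt0; apply/set0Pn.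
pose r := (w ^+ 4 + 3%:R) / 2%:R.
have rE : 2%:R * r = w ^+ 4 + 3%:R by rewrite /r mulrC divfK.
have rr : r ^+ 2 = 3%:R by exact: sqrt3_of_root.
exists (w ^+ 2, i * w * (r - 1)); rewrite inE /=; apply/andP; split; apply/eqP.
  by rewrite -[RHS]w8; ring.
have -> : (i * w * (r - 1)) ^+ 2 = i ^+ 2 * w ^+ 2 * (r ^+ 2 - 2%:R * r + 1) by ring.
by rewrite i2 rr rE; ring.
Qed.

(** A square root of - 1 excludes p = 3 mod 4, and (s - 1) / 2 is a primitive cube root of unity,
    which excludes p = 2 mod 3. *)
Lemma prime_mod12 p (i s : 'F_p) : prime p -> (3 < p)%N -> i ^+ 2 = -1 -> s ^+ 2 = - 3%:R ->
  (p %% 12 = 1)%N.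
Proof.
move=> pp p3 i2 s2.
have nd n : (0 < n < p)%N -> n%:R != 0 :> 'F_p.
  by case/andP=> n0 np; apply: Fp_nat_neq0 => //; rewrite gtnNdvd.
have two0 : 2%:R != 0 :> 'F_p by apply: nd; lia.
have three0 : 3%:R != 0 :> 'F_p by apply: nd; lia.
have fermat := Fp_fermat pp.
have op : odd p by case: (even_prime pp) => // e; rewrite e in p3.
have p4 : (p %% 4 = 1)%N.
  have [//|p43] : (p %% 4 = 1)%N \/ (p %% 4 = 3)%N by lia.
  have i0 : i != 0.
    by apply/eqP => i0; move/eqP: i2; rewrite i0 expr0n eq_sym oppr_eq0 oner_eq0.
  have pE : (p.-1 = 2 * p.-1./2)%N by lia.
  have od : odd p.-1./2 by lia.
  have := fermat _ i0; rewrite {1}pE exprM i2 -signr_odd od expr1 => /eqP.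
  by rewrite eq_sym -addr_eq0 -(natrD _ 1 1) (negPf two0).
pose w := (s - 1) / 2%:R.
have wE : w ^+ 2 + w + 1 = 0.
  apply: (mulfI (mulf_neq0 two0 two0)); rewrite mulr0.
  have e : 2%:R * w = s - 1 by rewrite /w mulrC divfK.
  have -> : 2%:R * 2%:R * (w ^+ 2 + w + 1) = (2%:R * w) ^+ 2 + 2%:R * (2%:R * w) + 4%:R by ring.
  rewrite e (_ : _ + 4%:R = s ^+ 2 + 3%:R); last by ring.
  by rewrite s2 addNr.
have w1 : w != 1.
  by apply/eqP => w1; move/eqP: wE; rewrite w1 expr1n -(natrD _ 1 1) -(natrD _ 2 1) (negPf three0).
have w3 : w ^+ 3 = 1.
  apply/eqP; rewrite -subr_eq0 (_ : w ^+ 3 - 1 = (w - 1) * (w ^+ 2 + w + 1)); last by ring.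
  by rewrite wE mulr0.
have w0 : w != 0.
  by apply/eqP => w0; move/eqP: wE; rewrite w0 expr0n !add0r oner_eq0.
have p31 : (p %% 3 = 1)%N.
  have [//|p32] : (p %% 3 = 1)%N \/ (p %% 3 = 2)%N.
    have : ~~ (3 %| p)%N by rewrite dvdn_prime2//; lia.
    lia.
  have := fermat _ w0; rewrite -(expr_mod _ w3) (_ : p.-1 %% 3 = 1)%N; last by lia.
  by rewrite expr1 => /eqP; rewrite (negPf w1).
lia.
Qed.

Lemma int_mulD4_neq0 (n q : int) : 16 <= n -> n * q + 4 != 0.
Proof.
move=> n16; apply/eqP => e.
have [q0|[q1|q1]] : q = 0 \/ (1 <= q \/ q <= -1) by lia.
- by rewrite q0 mulr0 in e.
- nia.
- nia.
Qed.

Lemma sum_sq_gt16 (a n d : int) : 16 <= n -> d != 0 -> 16 < a ^+ 2 + (n * d) ^+ 2.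
Proof.
move=> n16 d0; have a0 : 0 <= a ^+ 2 by exact: sqr_ge0.
have nd : 16 <= `|n * d| by rewrite normrM; nia.
rewrite -(real_normK (num_real (n * d))) expr2; nia.
Qed.

(** Since P(n) = 4 mod n and n divides Q(n), taking n = 16 T makes the norm 16 times an integer
    congruent to 1 mod T; this integer exceeds 1 because Q(n) is a nonzero multiple of n. *)
Lemma sum_sq_polPQ (T : int) : 0 < T -> exists g, [/\ 1 < g, (T %| g - 1)%Z &
  polP (16 * T) ^+ 2 + polQ (16 * T) ^+ 2 = 16 * g].
Proof.
move=> T0; set n := 16 * T.
have n16 : 16 <= n by rewrite /n; lia.
have [A PE] : exists A, polP n = 4 + n * A.
  by exists (n ^+ 7 - 28 * n ^+ 5 + 76 * n ^+ 3 - 64 * n); rewrite /polP; ring.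
have [D [D0 QE]] : exists D, D != 0 /\ polQ n = n * D.
  exists (8 * (n * (- n ^+ 5 + 7 * n ^+ 3 - 10 * n) + 4)); split.
    by rewrite mulf_neq0// int_mulD4_neq0.
  by rewrite /polQ; ring.
have fE : polP n ^+ 2 + polQ n ^+ 2 = 16 * (1 + T * (8 * A + n * A ^+ 2 + n * D ^+ 2)).
  by rewrite PE QE /n; ring.
exists (1 + T * (8 * A + n * A ^+ 2 + n * D ^+ 2)); split => //.
  have := sum_sq_gt16 (polP n) n16 D0; rewrite -QE fE; set g := 1 + _; clearbody g; lia.
by rewrite addrC addKr dvdz_mulr.
Qed.

Lemma infinitely_many_Vp_gt0 (B : nat) :
  exists p : nat, [/\ (B < p)%N, prime p, (p %% 12 = 1)%N & (0 < Vp p)%N].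
Proof.
(* The factorial forces p > B and also p > 1201, beyond all prime factors of the resultant behind
   [no_common_root]. *)
have T0 : 0 < ((maxn B 1201)`!)%:Z by rewrite ltz_nat fact_gt0.
have [g [g1 Tg fE]] := sum_sq_polPQ T0.
set n := 16 * _ in fE; clearbody n.
have [gg ggE] : exists gg : nat, g = gg%:Z by exists `|g|%N; lia.
have gg1 : (1 < gg)%N by lia.
have [p [pp pg]] : exists p, prime p /\ (p %| g)%Z.
  by exists (pdiv gg); rewrite pdiv_prime// ggE dvdzE /= pdiv_dvd.
have pB : (maxn B 1201 < p)%N.
  rewrite ltnNge; apply/negP => pB.
  have pT : (p %| ((maxn B 1201)`!)%:Z)%Z.
    by rewrite dvdzE /=; apply: dvdn_fact; rewrite prime_gt0.
  have : (p %| (1 : int))%Z.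
    by have := rpredB pg (dvdz_trans pT Tg); rewrite opprB addrC subrK.
  by rewrite dvdz1 /=; have := prime_gt1 pp; lia.
clear T0 Tg ggE gg1 gg g1.
have p1201 : (1201 < p)%N by lia.
have nd k : (0 < k < p)%N -> k%:R != 0 :> 'F_p.
  by case/andP=> k0 kp; apply: Fp_nat_neq0 => //; rewrite gtnNdvd.
have two0 : 2%:R != 0 :> 'F_p by apply: nd; lia.
pose z : 'F_p := n%:~R; pose u := z ^+ 2.
pose P := u ^+ 4 - 28%:R * u ^+ 3 + 76%:R * u ^+ 2 - 64%:R * u + 4%:R.
pose Q' := - u ^+ 3 + 7%:R * u ^+ 2 - 10%:R * u + 4%:R.
pose Q := 8%:R * z * Q'.
have PQ : P ^+ 2 + Q ^+ 2 = 0.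
  have -> : P = (polP n)%:~R by rewrite /polP /P /u /z; ring.
  have -> : Q = (polQ n)%:~R by rewrite /polQ /Q /Q' /u /z; ring.
  apply/eqP; rewrite -!rmorphXn -rmorphD fE -(dvdz_pcharf (pchar_Fp pp)).
  exact: dvdz_mull.
(* Otherwise P = 0 as well. Then z is nonzero, as P is 4 at z = 0, and u would be a common root of
   the polynomials P and Q'. *)
have Q0 : Q != 0.
  apply/eqP => Q0; have P0 : P = 0.
    by move/eqP: PQ; rewrite Q0 expr0n addr0 expf_eq0 => /eqP.
  have z0 : z != 0.
    apply/eqP => z0; have : 4%:R = 0 :> 'F_p.
      rewrite -[RHS]P0 /P (_ : u = 0); first by ring.
      by rewrite /u z0 expr0n.
    by apply/eqP/nd; lia.
  have Q'0 : Q' = 0.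
    apply/eqP; move/eqP: Q0; rewrite mulf_eq0 mulf_eq0 (negPf z0) orbF.
    by rewrite (negPf (nd 8 _))//; lia.
  by apply: (no_common_root P0 Q'0); apply: nd; lia.
pose i := - P / Q.
have iQ : i * Q = - P by rewrite /i divfK.
have i2 : i ^+ 2 = -1.
  apply: (mulIf (expf_neq0 2 Q0)); rewrite -exprMn iQ sqrrN mulN1r.
  by apply/eqP; rewrite -addr_eq0 PQ.
pose w := z - i.
have w8 : w ^+ 8 + 6%:R * w ^+ 4 - 3%:R = 0.
  have w2 : w ^+ 2 = u - 1 - 2%:R * z * i.
    have -> : w ^+ 2 = u + i ^+ 2 - 2%:R * z * i by rewrite /w /u; ring.
    by rewrite i2; ring.
  have w4 : w ^+ 4 = (u - 1) ^+ 2 - 4%:R * u - 4%:R * (u - 1) * z * i.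
    rewrite -[4%N]/(2 * 2)%N exprM w2.
    have -> : (u - 1 - 2%:R * z * i) ^+ 2 =
      (u - 1) ^+ 2 + 4%:R * u * i ^+ 2 - 4%:R * (u - 1) * z * i by rewrite /u; ring.
    by rewrite i2; ring.
  pose v := (u - 1) ^+ 2 - 4%:R * u; pose t := 4%:R * (u - 1).
  have w4' : w ^+ 4 = v - t * z * i by rewrite w4 /v /t.
  rewrite -[8%N]/(4 * 2)%N exprM w4'.
  have -> : (v - t * z * i) ^+ 2 = v ^+ 2 + t ^+ 2 * u * i ^+ 2 - 2%:R * v * t * z * i.
    by rewrite /u; ring.
  rewrite i2 (_ : _ - _ = P + i * Q); last by rewrite /P /Q /Q' /v /t /u; ring.
  by rewrite iQ subrr.
exists p; split => //; first by lia.
- pose r := (w ^+ 4 + 3%:R) / 2%:R.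
  (* As r^2 = 3, the product i r is a square root of - 3. *)
  apply: (@prime_mod12 p i (i * r)) => //; first by lia.
  rewrite exprMn i2 mulN1r; congr (- _).
  exact: sqrt3_of_root.
- exact: Vp_gt0_of_roots i2 w8 two0.
Qed.

Theorem theorem2 :
  (forall N : nat, exists p : nat,
      (N < p)%N /\ prime p /\ (p %% 12 = 1)%N /\ (0 < Vp p)%N) /\
  (forall (m : nat) (c : int),
      (0 < m)%N -> (12 %| m)%N ->
      (c = 1 %[mod 12])%Z -> coprimez c (m%:Z) ->
      exists p : nat, prime p /\ (p%:Z = c %[mod m%:Z])%Z /\ Vp p = 0%N).
Proof.
split=> [N|m c m0 m12 c1 cm].
  by have [p [? ? ? ?]] := infinitely_many_Vp_gt0 N; exists p.
have m1 : (1 < m)%N by lia.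
have [k kE] : exists k : nat, (c %% m%:Z)%Z = k%:Z by exists `|(c %% m%:Z)%Z|%N; lia.
have mk : coprime m k.
  by move: cm; rewrite coprimez_sym /coprimez -gcdz_modr kE.
have k1 : (k %% 12 = 1)%N.
  have : (k%:Z = 1 %[mod 12])%Z.
    case/dvdnP: m12 => q mq; rewrite -c1 {1}(divz_eq c m%:Z) kE mq PoszM mulrA.
    by rewrite modzMDl.
  lia.
have [p [pp pk V0]] := prime_class_Vp0 m1 m12 mk k1.
exists p; split => //; split => //.
by rewrite -(modz_mod c) kE !modz_nat pk.
Qed.
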